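(* Suppose $Q$ is a finitely presented group with Serre's property FA. Then there exists a finitely presented group $G_Q$ such that $Q$ embeds as a finite-index subgroup of $\operatorname{Out}(G_Q)$. Moreover, if $Q$ is residually finite then $G_Q$ can be chosen to be residually finite.
   Context: A group has Serre's property FA if every action of it on a tree has a global fixed point. *)

(* Defs.v *)
From Stdlib Require Import List.
Import ListNotations.


Record Grp := {
  carrier :> Type;
  gmul : carrier -> carrier -> carrier;
  gone : carrier;
  ginv : carrier -> carrier;
  gmul_assoc : forall x y z, gmul x (gmul y z) = gmul (gmul x y) z;
  gmul_1l : forall x, gmul gone x = x;
  gmul_Vl : forall x, gmul (ginv x) x = gone
}.
Arguments gmul {g}. Arguments gone {g}. Arguments ginv {g}.

(* A letter (i, b) is the generator x_i (b = true) or its inverse (b = false). *)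
Definition letter := (nat * bool)%type.
Definition word := list letter.
Definition letter_inv (a : letter) : letter := (fst a, negb (snd a)).

(* The congruence on words generated by free cancellation and the relators R;
   w ~ [] iff w lies in the normal closure of R in the free group. *)
Inductive wequiv (R : list word) : word -> word -> Prop :=
| we_refl w : wequiv R w w
| we_sym u v : wequiv R u v -> wequiv R v u
| we_trans u v w : wequiv R u v -> wequiv R v w -> wequiv R u w
| we_cancel u v a : wequiv R (u ++ a :: letter_inv a :: v) (u ++ v)
| we_rel u v r : In r R -> wequiv R (u ++ r ++ v) (u ++ v).

Definition eval_letter (G : Grp) (gens : nat -> G) (a : letter) : G :=
  if snd a then gens (fst a) else ginv (gens (fst a)).

Definition eval_word (G : Grp) (gens : nat -> G) (w : word) : G :=
  fold_right (fun a g => gmul (eval_letter G gens a) g) gone w.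

Definition word_on (n : nat) (w : word) : Prop := forall a, In a w -> fst a < n.

Definition FinPres (G : Grp) : Prop :=
  exists (n : nat) (gens : nat -> G) (R : list word),
    (forall r, In r R -> word_on n r) /\
    (forall g : G, exists w, word_on n w /\ eval_word G gens w = g) /\
    (forall w, word_on n w -> (eval_word G gens w = gone <-> wequiv R w [])).

Record Tree := {
  vert : Type;
  adj : vert -> vert -> Prop;
  tree_inhabited : inhabited vert;
  adj_sym : forall u v, adj u v -> adj v u;
  adj_irrefl : forall v, ~ adj v v;
  tree_connected : forall u v : vert, exists p : list vert,
      (let fix ok x p := match p with [] => x = v | y :: q => adj x y /\ ok y q end
       in ok u p);
  (* no reduced (non-backtracking) closed edge path of positive length *)
  tree_acyclic : forall (v0 : vert) (p : list vert),
      p <> [] ->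
      ~ ((let fix ok x p := match p with [] => x = v0 | y :: q => adj x y /\ ok y q end
          in ok v0 p) /\
         (forall i, S (S i) <= length p ->
            nth_error (v0 :: p) i <> nth_error (v0 :: p) (S (S i))))
}.

Definition TreeAction (Q : Grp) (T : Tree) (act : Q -> vert T -> vert T) : Prop :=
  (forall v, act gone v = v) /\
  (forall g h v, act (gmul g h) v = act g (act h v)) /\
  (forall g u v, adj T u v -> adj T (act g u) (act g v)) /\
  (forall g u v, adj T u v -> ~ (act g u = v /\ act g v = u)).

Definition PropertyFA (Q : Grp) : Prop :=
  forall (T : Tree) (act : Q -> vert T -> vert T),
    TreeAction Q T act -> exists v, forall g, act g v = v.

Definition IsAut (G : Grp) (f : G -> G) : Prop :=
  (forall x y, f (gmul x y) = gmul (f x) (f y)) /\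
  exists g : G -> G, (forall x, g (f x) = x) /\ (forall x, f (g x) = x).

Definition OutEq (G : Grp) (f g : G -> G) : Prop :=
  exists h : G, forall x, f x = gmul (gmul h (g x)) (ginv h).

Definition EmbedsFiniteIndexInOut (Q G : Grp) : Prop :=
  exists phi : Q -> (G -> G),
    (forall q, IsAut G (phi q)) /\
    (forall q1 q2, OutEq G (phi (gmul q1 q2)) (fun x => phi q1 (phi q2 x))) /\
    (forall q, OutEq G (phi q) (fun x => x) -> q = gone) /\
    (exists L : list (G -> G), forall a : G -> G, IsAut G a ->
        exists b q, In b L /\ OutEq G a (fun x => phi q (b x))).

Definition NormalSubgroup (G : Grp) (N : G -> Prop) : Prop :=
  N gone /\ (forall x y, N x -> N y -> N (gmul x y)) /\ (forall x, N x -> N (ginv x)) /\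
  (forall x h, N x -> N (gmul (gmul h x) (ginv h))).

Definition FiniteIndex (G : Grp) (N : G -> Prop) : Prop :=
  exists L : list G, forall x : G, exists h, In h L /\ N (gmul (ginv h) x).

Definition ResFinite (G : Grp) : Prop :=
  forall g : G, g <> gone ->
    exists N : G -> Prop, NormalSubgroup G N /\ FiniteIndex G N /\ ~ N g.

(* Main.v *)
Require Import Defs.
From Stdlib Require Import List Arith Lia ZArith Classical ClassicalEpsilon
  FunctionalExtensionality PropExtensionality ProofIrrelevance.
From Stdlib Require FinFun.
From Corelib Require Import ssreflect.
Import ListNotations.
Set SsrOldRewriteGoalsOrder.

(** If Q is finite, it acts faithfully by translations on the finite group (Z/2)^Q.

    If Q is infinite, let F = <u, v | u^m, v^2> with m odd, let F_o be a subgroup of finite index in F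
    with a surjective anti-homomorphism c : F_o -> Q, and let G be the HNN extension of Q x F by a letter t with
    x t = c(x) t x for x in F_o.  Equivalently G is the semidirect product by F of the free product of Q
    and the free group on the letters t_j, j in F/F_o.  For q in Q the substitution t -> t q, identity
    on Q x F, is an automorphism, and this gives Q -> Out(G), which is injective because an inner
    automorphism fixing Q x F is conjugation by a central element of Q.

    For finite index, let theta be an automorphism.  By property FA, theta(Q) fixes a vertex of the
    Bass-Serre tree of G.  FA subgroups of F are finite, so theta(Q) meets a conjugate of Q
    nontrivially; nontrivial elements of Q fix only one vertex and commute with F, so after an inner
    automorphism theta preserves Q x F, and then both Q and F.  Comparing stabilizers of the initial
    edges of the geodesics to t and t^-1 times the base vertex, theta does not fold edges and hence
    multiplies displacements of the base vertex by a constant, which is 1 by surjectivity; so theta(t) = t q up to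
    inner automorphisms.  Finally theta is determined by q and its restriction to F, and Out(F) is
    finite by the same no-folding argument. *)

(** * Groups, presentations, permutations *)

(* F has to map a subgroup of finite index onto an arbitrary finitely generated Q and still have
   finite Out(F). Free groups fail the second demand; a free product of two finite cyclic groups
   meets both. For odd m an element of order dividing m cannot invert an edge, so it is conjugate to
   a power of u. The choice of c blocks the remaining sources of automorphisms. As c is onto, the
   action on F determines the action on Q, however large Out(Q) is. Homomorphisms from F to Q with
   commuting values that are trivial on F_o are trivial, so F cannot be twisted by central elements
   of Q. Some element of F_o with trivial c is conjugate in F to one with nontrivial c, so the edge
   groups F_o and { c(x)^-1 x } cannot be confused and t cannot be sent towards t^-1. The
   centralizer of F_o in F is trivial, so t is not multiplied by elements of F. Bass-Serre theory is
   replaced by explicit trees of normal forms on which the generators act by rewriting. *)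
Declare Scope grp_scope.
Delimit Scope grp_scope with g.
Notation "x ** y" := (gmul x y) (at level 40, left associativity) : grp_scope.
Notation "x ^-1" := (ginv x) (at level 3, left associativity, format "x ^-1") : grp_scope.
Notation "\1" := gone : grp_scope.
Open Scope grp_scope.
Global Arguments gmul : simpl never.
Global Arguments gone : simpl never.
Global Arguments ginv : simpl never.

Section GroupTheory.
Context {G : Grp}.
Implicit Types x y z : G.

Lemma mulVK x y : x^-1 ** (x ** y) = y.
Proof. by rewrite gmul_assoc gmul_Vl gmul_1l. Qed.

Lemma mulI x y z : x ** y = x ** z -> y = z.
Proof. by move=> e; rewrite -(mulVK x y) e mulVK. Qed.

Lemma mul1r x : x ** \1 = x.
Proof. by apply: (@mulI x^-1); rewrite gmul_assoc gmul_Vl gmul_1l. Qed.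

Lemma mulVr x : x ** x^-1 = \1.
Proof. by apply: (@mulI x^-1); rewrite gmul_assoc gmul_Vl gmul_1l mul1r. Qed.

Lemma mulKV x y : x ** (x^-1 ** y) = y.
Proof. by rewrite gmul_assoc mulVr gmul_1l. Qed.

Lemma mulA x y z : x ** y ** z = x ** (y ** z).
Proof. by rewrite gmul_assoc. Qed.

Lemma inv_unique x y : x ** y = \1 -> y = x^-1.
Proof. by move=> e; apply: (@mulI x); rewrite e mulVr. Qed.

Lemma invK x : x^-1^-1 = x.
Proof. by symmetry; apply: inv_unique; rewrite gmul_Vl. Qed.

Lemma inv1 : (\1 : G)^-1 = \1.
Proof. by symmetry; apply: inv_unique; rewrite gmul_1l. Qed.

Lemma invM x y : (x ** y)^-1 = y^-1 ** x^-1.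
Proof. by symmetry; apply: inv_unique; rewrite mulA mulKV mulVr. Qed.

Lemma mulIr x y z : y ** x = z ** x -> y = z.
Proof. by move=> e; rewrite -(mul1r y) -(mul1r z) -(mulVr x) !gmul_assoc e. Qed.

End GroupTheory.

Global Hint Rewrite @mulA @gmul_1l @mul1r @gmul_Vl @mulVr @mulVK @mulKV @invM @invK @inv1 : grp.
Ltac grp := autorewrite with grp; try done.

Definition hom {G H : Grp} (f : G -> H) : Prop := forall x y, f (x ** y) = f x ** f y.

Section HomTheory.
Context {G H : Grp} {f : G -> H} (hf : hom f).
Lemma hom1 : f \1 = \1.
Proof. by apply: (@mulI _ (f \1)); rewrite -hf gmul_1l mul1r. Qed.
Lemma homV x : f x^-1 = (f x)^-1.
Proof. by apply: inv_unique; rewrite -hf mulVr hom1. Qed.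
End HomTheory.

Lemma hom_comp {G H K : Grp} (f : G -> H) (g : H -> K) :
  hom f -> hom g -> hom (fun x => g (f x)).
Proof. by move=> hf hg x y; rewrite hf hg. Qed.

Definition commute {G : Grp} (x y : G) : Prop := x ** y = y ** x.

Lemma commuteV {G : Grp} (x y : G) : commute x y -> commute x^-1 y.
Proof.
  rewrite /commute => e; apply: (@mulI _ x); rewrite mulKV -mulA e mulA mulVr mul1r //.
Qed.
Lemma commuteM {G : Grp} (x x' y : G) : commute x y -> commute x' y -> commute (x ** x') y.
Proof. by rewrite /commute => e e'; rewrite mulA e' -mulA e mulA. Qed.
Lemma commute_sym {G : Grp} (x y : G) : commute x y -> commute y x.
Proof. by rewrite /commute. Qed.
Lemma commute1 {G : Grp} (y : G) : commute \1 y.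
Proof. by rewrite /commute gmul_1l mul1r. Qed.

Fixpoint gpow {G : Grp} (g : G) (n : nat) : G :=
  match n with 0 => \1 | S k => g ** gpow g k end.

Lemma gpowD {G : Grp} (g : G) a b : gpow g (a + b) = gpow g a ** gpow g b.
Proof. by elim: a => [|a IH] /=; rewrite ?gmul_1l // IH mulA. Qed.
Lemma gpow1 {G : Grp} a : gpow (\1 : G) a = \1.
Proof. by elim: a => //= a ->; rewrite gmul_1l. Qed.
Lemma gpowM {G : Grp} (g : G) a b : gpow g (a * b) = gpow (gpow g b) a.
Proof. by elim: a => //= a IH; rewrite gpowD IH. Qed.
Lemma hom_pow {G H : Grp} (f : G -> H) : hom f -> forall g n, f (gpow g n) = gpow (f g) n.
Proof. by move=> hf g; elim=> [|n IH] /=; rewrite ?(hom1 hf) // hf IH. Qed.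

Definition conjg {G : Grp} (g x : G) : G := g ** x ** g^-1.
Lemma conjg_hom {G : Grp} (g : G) : hom (conjg g).
Proof. by move=> x y; rewrite /conjg; grp. Qed.
Lemma conjgM {G : Grp} (g h x : G) : conjg (g ** h) x = conjg g (conjg h x).
Proof. by rewrite /conjg; grp. Qed.
Lemma conjgK {G : Grp} (g x : G) : conjg g (conjg g^-1 x) = x.
Proof. by rewrite /conjg; grp. Qed.
Lemma conjgVK {G : Grp} (g x : G) : conjg g^-1 (conjg g x) = x.
Proof. by rewrite /conjg; grp. Qed.
Lemma conjg1 {G : Grp} (x : G) : conjg \1 x = x.
Proof. by rewrite /conjg; grp. Qed.

(** * Words modulo relators *)

Section Words.
Variable R : list word.

Lemma wequiv_app u v w z : wequiv R u v -> wequiv R (w ++ u ++ z) (w ++ v ++ z).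
Proof.
  move=> e; elim: e w z => {u v} [u|u v _ IH|u v w _ IH _ IH'|u v a|u v r hr] x z.
  - exact: we_refl.
  - by apply: we_sym; apply: IH.
  - by apply: we_trans (IH x z) (IH' x z).
  - by rewrite -!app_assoc /= (app_assoc x u) (app_assoc x u); apply: we_cancel.
  - by rewrite -!app_assoc (app_assoc x u) (app_assoc x u); apply: we_rel.
Qed.

Lemma wequiv_app2 u u' v v' : wequiv R u u' -> wequiv R v v' -> wequiv R (u ++ v) (u' ++ v').
Proof.
  move=> e e'; apply: (we_trans _ _ (u' ++ v)).
  - by have := @wequiv_app u u' [] v e.
  - by have := @wequiv_app v v' u' [] e'; rewrite !app_nil_r.
Qed.

Definition winv (w : word) : word := rev (map letter_inv w).

Lemma letter_invK a : letter_inv (letter_inv a) = a.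
Proof. by case: a => i []. Qed.

Lemma winvK w : winv (winv w) = w.
Proof.
  rewrite /winv map_rev rev_involutive map_map -[RHS]map_id.
  by apply: map_ext => a; rewrite letter_invK.
Qed.

Lemma wequiv_winvr w : wequiv R (w ++ winv w) [].
Proof.
  elim: w => [|a w IH]; first exact: we_refl.
  apply: (we_trans _ _ ([a] ++ [] ++ [letter_inv a])).
  - by have := @wequiv_app _ _ [a] [letter_inv a] IH; rewrite /winv /= -!app_assoc.
  - exact: (we_cancel R [] [] a).
Qed.

Lemma wequiv_winvl w : wequiv R (winv w ++ w) [].
Proof. by have := wequiv_winvr (winv w); rewrite winvK. Qed.
End Words.

Section Eval.
Context {H : Grp}.
Variable h : nat -> H.

Lemma eval_app u v : eval_word H h (u ++ v) = eval_word H h u ** eval_word H h v.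
Proof. by elim: u => [|a u IH] /=; rewrite ?gmul_1l // IH mulA. Qed.

Lemma eval_letter_inv a : eval_letter H h (letter_inv a) = (eval_letter H h a)^-1.
Proof. by case: a => i []; rewrite /eval_letter /= ?invK. Qed.

Lemma eval_winv w : eval_word H h (winv w) = (eval_word H h w)^-1.
Proof.
  elim: w => [|a w IH] /=; first by rewrite inv1.
  by rewrite /winv /= eval_app /= -/(winv w) IH eval_letter_inv mul1r invM.
Qed.

Lemma eval_wequiv R u v : (forall r, In r R -> eval_word H h r = \1) ->
  wequiv R u v -> eval_word H h u = eval_word H h v.
Proof.
  move=> hR; elim=> {u v} [u|u v _ ->|u v w _ -> _ ->|u v a|u v r hr] //.
  - by rewrite !eval_app /= eval_letter_inv; grp.
  - by rewrite !eval_app (hR r hr) gmul_1l.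
Qed.
End Eval.

Lemma hom_eval {G H : Grp} (f : G -> H) (g : nat -> G) (h : nat -> H) w n : hom f ->
  (forall i, i < n -> f (g i) = h i) -> word_on n w ->
  f (eval_word G g w) = eval_word H h w.
Proof.
  move=> hf e; elim: w => [|[i b] w IH] hw /=; first exact: hom1.
  have hi : i < n by apply: (hw (i, b)); left.
  rewrite hf IH; last by move=> a ha; apply: hw; right.
  by congr (_ ** _); rewrite /eval_letter /=; case: b hw => _ /=; rewrite ?(homV hf) e.
Qed.

Definition Presents (G : Grp) (n : nat) (gens : nat -> G) (R : list word) : Prop :=
    (forall r, In r R -> word_on n r) /\
    (forall g : G, exists w, word_on n w /\ eval_word G gens w = g) /\
    (forall w, word_on n w -> (eval_word G gens w = gone <-> wequiv R w [])).

Lemma word_on_app n u v : word_on n u -> word_on n v -> word_on n (u ++ v).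
Proof. by move=> hu hv a; rewrite in_app_iff => -[/hu|/hv]. Qed.
Lemma word_on_winv n u : word_on n u -> word_on n (winv u).
Proof.
  move=> hu a; rewrite /winv -in_rev in_map_iff => -[b [<- hb]].
  exact: hu hb.
Qed.

Lemma presents_rel (G : Grp) n gens R : Presents G n gens R ->
  forall r, In r R -> eval_word G gens r = \1.
Proof.
  move=> [on [_ wp]] r hr; apply/wp; first exact: on.
  by have := we_rel R [] [] r hr; rewrite /= app_nil_r.
Qed.

(** Von Dyck's theorem. A word [W g] is chosen for every element; two words for the same element
    differ by relators, so the value does not depend on the choice. *)
Lemma presents_hom (G : Grp) n gens R (H : Grp) (h : nat -> H) : Presents G n gens R ->
  (forall r, In r R -> eval_word H h r = \1) ->
  exists f : G -> H, hom f /\ forall i, i < n -> f (gens i) = h i.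
Proof.
  move=> [on [sur wp]] hR.
  pose W g := proj1_sig (constructive_indefinite_description _ (sur g)).
  have WP g : word_on n (W g) /\ eval_word G gens (W g) = g.
  { exact: (proj2_sig (constructive_indefinite_description _ (sur g))). }
  have key w g : word_on n w -> eval_word G gens w = g -> eval_word H h (W g) = eval_word H h w.
  { move=> hw e; have [hW eW] := WP g.
    have [c1 c2] := wp (W g ++ winv w) (word_on_app _ _ _ hW (word_on_winv _ _ hw)).
    have := eval_wequiv h R _ _ hR (c1 _).
    rewrite !eval_app !eval_winv eW e mulVr => /(_ eq_refl) /= e'.
    apply: (@mulIr _ (eval_word H h w)^-1); by rewrite e' mulVr. }
  exists (fun g => eval_word H h (W g)); split.
  - move=> x y; have [hx ex] := WP x; have [hy ey] := WP y.
    rewrite -eval_app; apply: key; first exact: word_on_app.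
    by rewrite eval_app ex ey.
  - move=> i hi; rewrite (key [(i, true)]) /=.
    + by rewrite /eval_letter /= mul1r.
    + by move=> a [<-|].
    + by rewrite /eval_letter /= mul1r.
Qed.

Lemma presents_ind (G : Grp) n gens R (P : G -> Prop) : Presents G n gens R ->
  P \1 -> (forall x y, P x -> P y -> P (x ** y)) -> (forall x, P x -> P x^-1) ->
  (forall i, i < n -> P (gens i)) -> forall g, P g.
Proof.
  move=> [_ [sur _]] p1 pM pV pg g; have [w [hw <-]] := sur g.
  elim: w hw => [|[i b] w IH] hw //=.
  apply: pM; last by apply: IH => a ha; apply: hw; right.
  have hi : i < n by apply: (hw (i, b)); left.
  by rewrite /eval_letter /=; case: b hw => _; [|apply: pV]; apply: pg.
Qed.

(** * The group defined by a finite presentation *)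

Section PresentedGroup.
Variables (n : nat) (R : list word).
Hypothesis R_on : forall r, In r R -> word_on n r.

(* Letters outside the alphabet are erased, so that the quotient is generated by the first n letters. *)
Definition trim (w : word) : word := filter (fun a : letter => fst a <? n) w.

Lemma trim_app u v : trim (u ++ v) = trim u ++ trim v.
Proof. exact: filter_app. Qed.
Lemma trim_on w : word_on n w -> trim w = w.
Proof.
  move=> hw; elim: w hw => //= a w IH hw.
  have -> : fst a <? n = true by apply/Nat.ltb_lt; apply: hw; left.
  by rewrite IH // => b hb; apply: hw; right.
Qed.
Lemma trim_word_on w : word_on n (trim w).
Proof. by move=> a; rewrite /trim filter_In => -[_ /Nat.ltb_lt]. Qed.

Definition pres_eq (u v : word) : Prop := wequiv R (trim u) (trim v).
(** Elements are the congruence classes themselves, as predicates on words, so that congruent words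
    give equal elements. *)
Definition pres_carrier : Type := {P : word -> Prop | exists w, P = pres_eq w}.
Definition cls (w : word) : pres_carrier := exist _ (pres_eq w) (ex_intro _ w eq_refl).
Definition rep (c : pres_carrier) : word :=
  proj1_sig (constructive_indefinite_description _ (proj2_sig c)).

Lemma cls_eq u v : pres_eq u v <-> cls u = cls v.
Proof.
  split=> [e|[e]].
  - have e' : pres_eq u = pres_eq v.
    { apply: functional_extensionality => w; apply: propositional_extensionality.
      rewrite /pres_eq; split=> e'; [apply: we_trans (we_sym _ _ _ e) e'|exact: we_trans e e']. }
    rewrite /cls; move: (ex_intro _ u _) (ex_intro _ v _); rewrite e' => p q.
    by rewrite (proof_irrelevance _ p q).
  - by rewrite e; apply: we_refl.
Qed.

Lemma repK c : cls (rep c) = c.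
Proof.
  case: c => P [w e]; subst P; apply/cls_eq.
  rewrite /rep /=; case: constructive_indefinite_description => w' /= e.
  by rewrite -/(pres_eq w' w) -e; apply: we_refl.
Qed.

Lemma rep_cls w : pres_eq (rep (cls w)) w.
Proof. by apply/cls_eq; rewrite repK. Qed.

Definition pres_mul c d := cls (rep c ++ rep d).
Definition pres_inv c := cls (winv (rep c)).

Lemma pres_mul_cls u v : pres_mul (cls u) (cls v) = cls (u ++ v).
Proof. by apply/cls_eq; rewrite /pres_eq !trim_app; apply: wequiv_app2; apply: rep_cls. Qed.

Lemma trim_winv w : trim (winv w) = winv (trim w).
Proof.
  rewrite /trim /winv filter_rev; congr (rev _).
  by elim: w => //= a w ->; case: (fst a <? n).
Qed.

Lemma pres_mulA x y z : pres_mul x (pres_mul y z) = pres_mul (pres_mul x y) z.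
Proof. by rewrite -(repK x) -(repK y) -(repK z) !pres_mul_cls app_assoc. Qed.
Lemma pres_mul1 x : pres_mul (cls []) x = x.
Proof. by rewrite -(repK x) pres_mul_cls. Qed.
Lemma pres_mulV x : pres_mul (pres_inv x) x = cls [].
Proof.
  rewrite -{2}(repK x) /pres_inv pres_mul_cls; apply/cls_eq.
  by rewrite /pres_eq trim_app trim_winv; apply: wequiv_winvl.
Qed.

Definition PG : Grp := Build_Grp pres_carrier pres_mul (cls []) pres_inv pres_mulA pres_mul1 pres_mulV.
Definition pgen (i : nat) : PG := cls [(i, true)].

Lemma pgen_inv i : (pgen i)^-1 = cls [(i, false)].
Proof.
  symmetry; apply: inv_unique; rewrite /pgen /gmul /= pres_mul_cls; apply/cls_eq; rewrite /pres_eq /trim /=.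
  by case: (i <? n); [exact: (we_cancel R [] [] (i, true))|exact: we_refl].
Qed.

Lemma eval_pgen w : eval_word PG pgen w = cls w.
Proof.
  elim: w => //= -[i b] w IH; rewrite IH.
  have -> : eval_letter PG pgen (i, b) = cls [(i, b)].
  { by case: b; rewrite /eval_letter //= -pgen_inv. }
  exact: (pres_mul_cls [(i, b)] w).
Qed.

Lemma PG_presents : Presents PG n pgen R.
Proof.
  split; first exact: R_on.
  split.
  - move=> g; exists (trim (rep g)); split; first exact: trim_word_on.
    rewrite eval_pgen -[RHS]repK; apply/cls_eq; rewrite /pres_eq.
    by rewrite (trim_on _ (trim_word_on _)); apply: we_refl.
  - move=> w hw; rewrite eval_pgen.
    rewrite -[\1]/(cls []) -cls_eq /pres_eq (trim_on _ hw); reflexivity.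
Qed.
End PresentedGroup.

(** * Symmetric groups, finiteness, residual finiteness *)

Section Sym.
Variable X : Type.
Record perm := { pfun :> X -> X; pbk : X -> X;
  pfunK : forall x, pbk (pfun x) = x; pbkK : forall x, pfun (pbk x) = x }.

Lemma perm_eq (p q : perm) : (forall x, p x = q x) -> p = q.
Proof.
  case: p q => f g fK gK [f' g' fK' gK'] /= e.
  have ef : f = f' by apply: functional_extensionality.
  subst f'; have eg : g = g' by apply: functional_extensionality => x; rewrite -{1}(gK' x) fK.
  subst g'; by rewrite (proof_irrelevance _ fK fK') (proof_irrelevance _ gK gK').
Qed.

Definition perm_mul (p q : perm) : perm.
Proof.
  refine {| pfun := fun x => p (q x); pbk := fun x => pbk q (pbk p x) |} => x.
  - by rewrite !pfunK.
  - by rewrite !pbkK.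
Defined.
Definition perm_one : perm := {| pfun := fun x => x; pbk := fun x => x;
  pfunK := fun x => eq_refl; pbkK := fun x => eq_refl |}.
Definition perm_inv (p : perm) : perm :=
  {| pfun := pbk p; pbk := p; pfunK := pbkK p; pbkK := pfunK p |}.

Definition Sym : Grp.
Proof.
  refine (Build_Grp perm perm_mul perm_one perm_inv _ _ _).
  - by move=> p q r; apply: perm_eq.
  - by move=> p; apply: perm_eq.
  - by move=> p; apply: perm_eq => x /=; rewrite pfunK.
Defined.

Lemma perm_inj (p : perm) x y : p x = p y -> x = y.
Proof. by move=> e; rewrite -(pfunK p x) e pfunK. Qed.

Definition involution (f : X -> X) (fK : forall x, f (f x) = x) : perm :=
  {| pfun := f; pbk := f; pfunK := fK; pbkK := fK |}.

Lemma sym_mulE (p q : Sym) x : pfun (p ** q) x = pfun p (pfun q x).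
Proof. by []. Qed.
Lemma sym_powE (p : Sym) k x : pfun (gpow p k) x = Nat.iter k (pfun p) x.
Proof. by elim: k => //= k ->. Qed.
End Sym.
Arguments pfun {X}. Arguments pbk {X}. Arguments perm_eq {X}. Arguments involution {X}.

Definition Fin (X : Type) : Prop := exists l : list X, forall x, In x l.

Lemma list_preimage {A B : Type} (f : A -> B) : (forall x y, f x = f y -> x = y) ->
  forall L : list B, exists l : list A, forall a, In (f a) L -> In a l.
Proof.
  move=> inj; elim=> [|b L [l hl]]; first by exists [].
  case: (classic (exists a, f a = b)) => [[a e]|h].
  - exists (a :: l) => a' /= [e'|/hl]; last by right.
    by left; apply: inj; rewrite e -e'.
  - by exists l => a' /= [e'|/hl //]; exfalso; apply: h; exists a'.
Qed.

Lemma Fin_inj {A B : Type} (f : A -> B) : (forall x y, f x = f y -> x = y) -> Fin B -> Fin A.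
Proof.
  move=> inj [L hL]; have [l hl] := list_preimage f inj L.
  by exists l => a; apply: hl; apply: hL.
Qed.

Lemma Fin_prod {A B : Type} : Fin A -> Fin B -> Fin (A * B).
Proof.
  by move=> [la ha] [lb hb]; exists (list_prod la lb) => -[a b]; apply/in_prod_iff; split.
Qed.

Lemma Fin_fun {A B : Type} : Fin A -> Fin B -> Fin (A -> B).
Proof.
  move=> [la ha] [lb hb].
  case: (classic (inhabited (A -> B))) => [[f0]|h]; last first.
  { by exists [] => f; apply: h; split. }
  suff [L hL] : exists L : list (A -> B), forall f, exists g, In g L /\ forall a, In a la -> g a = f a.
  { exists L => f; have [g [hg e]] := hL f.
    by have <- : g = f by apply: functional_extensionality => a; apply: e. }
  elim: la {ha} => [|a la [L hL]]; first by exists [f0] => f; exists f0; split=> //; left.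
  pose upd (g : A -> B) (b : B) x :=
    match excluded_middle_informative (x = a) with left _ => b | right _ => g x end.
  exists (map (fun p => upd (fst p) (snd p)) (list_prod L lb)) => f.
  have [g [hg e]] := hL f; exists (upd g (f a)); split.
  - by apply/in_map_iff; exists (g, f a); split=> //; apply/in_prod_iff.
  - move=> x hx; rewrite /upd; case: excluded_middle_informative => [-> //|h].
    by case: hx => [e'|/e //]; case: h.
Qed.

Lemma Fin_Sym {X : Type} : Fin X -> Fin (Sym X).
Proof.
  move=> hX; apply: (Fin_inj (fun p : Sym X => pfun p)); last exact: Fin_fun.
  by move=> p q e; apply: perm_eq => x; rewrite e.
Qed.

(** The list meets every nonempty fibre; for the map to cosets it contains a transversal. *)
Lemma finite_image {A B : Type} (f : A -> B) : Fin B ->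
  exists l : list A, forall a, exists a', In a' l /\ f a' = f a.
Proof.
  move=> [L hL].
  suff [l hl] : exists l : list A, forall a, In (f a) L -> exists a', In a' l /\ f a' = f a.
  { by exists l => a; apply: hl. }
  elim: L {hL} => [|b L [l hl]]; first by exists [].
  case: (classic (exists a, f a = b)) => [[a e]|h].
  - exists (a :: l) => a' /= [e'|/hl [a'' [h1 h2]]].
    + by exists a; split; [left|rewrite e].
    + by exists a''; split; [right|].
  - by exists l => a' /= [e'|/hl //]; exfalso; apply: h; exists a'.
Qed.

Lemma residual_by_hom {G H : Grp} (f : G -> H) (g : G) : hom f -> Fin H -> f g <> \1 ->
  exists N : G -> Prop, NormalSubgroup G N /\ FiniteIndex G N /\ ~ N g.
Proof.
  move=> hf fH hg; exists (fun x => f x = \1); split; last split=> //.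
  - split; first exact: hom1.
    split; first by move=> x y ex ey; rewrite hf ex ey gmul_1l.
    split; first by move=> x ex; rewrite (homV hf) ex inv1.
    by move=> x h ex; rewrite !hf ex (homV hf) mul1r mulVr.
  - have [l hl] := finite_image f fH; exists l => x; have [h [h1 h2]] := hl x.
    by exists h; split=> //; rewrite hf (homV hf) h2 gmul_Vl.
Qed.

Lemma residual_comap {G H : Grp} (f : G -> H) (g : G) : hom f -> ResFinite H -> f g <> \1 ->
  exists N : G -> Prop, NormalSubgroup G N /\ FiniteIndex G N /\ ~ N g.
Proof.
  move=> hf rfH hg; have [N [[n1 [nM [nV nJ]]] [[L hL] ng]]] := rfH _ hg.
  exists (fun x => N (f x)); split; last split=> //.
  - split; first by rewrite (hom1 hf).
    split; first by move=> x y ex ey; rewrite hf; apply: nM.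
    split; first by move=> x ex; rewrite (homV hf); apply: nV.
    by move=> x h ex; rewrite !hf (homV hf); apply: nJ.
  (* One element of [G] is kept for each coset of [N] that the image of [f] meets. *)
  - pose hits (h : H) (x : G) := N (h^-1 ** f x).
    have [l hl] : exists l : list G, forall x h, In h L -> hits h x -> exists y, In y l /\ hits h y.
    { elim: L {hL} => [|h L [l hl]]; first by exists [].
      case: (classic (exists y, hits h y)) => [[y hy]|no].
      - exists (y :: l) => x h' /= [<-|/hl k] hx; first by exists y; split; [left|].
        by have [z [z1 z2]] := k x hx; exists z; split; [right|].
      - exists l => x h' /= [<-|/hl k] hx; last exact: k hx.
        by exfalso; apply: no; exists x. }
    exists l => x; have [h [hh nx]] := hL (f x).
    have [y [y1 y2]] := hl x h hh nx; exists y; split=> //.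
    rewrite hf (homV hf); have := nM _ _ (nV _ y2) nx.
    by rewrite /hits; grp.
Qed.

(** * Actions on rooted trees *)

(** Parent and depth are all that has to be supplied for a tree of normal forms, where [par] drops
    the last syllable; connectedness and acyclicity then follow uniformly. The value of [par] at the
    root is arbitrary. *)
Record RootedTree := {
  rvert :> Type;
  #[canonical=no] root : rvert;
  #[canonical=no] par : rvert -> rvert;
  #[canonical=no] dep : rvert -> nat;
  #[canonical=no] dep_root : dep root = 0;
  #[canonical=no] dep_par : forall v, v <> root -> dep v = S (dep (par v))
}.
Arguments root {r}. Arguments par {r}. Arguments dep {r}.

Section Rooted.
Context {T : RootedTree}.
Implicit Types (u v w : T) (f : nat -> T).

Definition radj u v : Prop := (v <> root /\ par v = u) \/ (u <> root /\ par u = v).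

Lemma radj_sym u v : radj u v -> radj v u.
Proof. by case=> h; [right|left]. Qed.

Lemma dep0 v : dep v = 0 -> v = root.
Proof. by move=> h; apply: NNPP => /(dep_par T); rewrite h. Qed.

Lemma dep_pos v : v <> root -> 0 < dep v.
Proof. by move=> /(dep_par T) ->; lia. Qed.

Lemma dep_pos_neq v : 0 < dep v -> v <> root.
Proof. by move=> h e; move: h; rewrite e dep_root; lia. Qed.

Lemma radj_dep u v : radj u v ->
  (v <> root /\ par v = u /\ dep v = S (dep u)) \/ (u <> root /\ par u = v /\ dep u = S (dep v)).
Proof.
  by case=> -[h e]; have d := dep_par T _ h; rewrite e in d; [left|right].
Qed.

Lemma radj_irrefl v : ~ radj v v.
Proof. by move=> /radj_dep; lia. Qed.

Definition nbwalk f n : Prop :=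
  (forall i, i < n -> radj (f i) (f (S i))) /\
  (forall i, S (S i) <= n -> f i <> f (S (S i))).

(** A vertex has a single neighbour nearer the root, and here it is the one just left, so a walk
    that once moves away from the root keeps doing so. *)
Lemma nb_up f n : nbwalk f n -> 0 < n -> f 1 <> root -> par (f 1) = f 0 ->
  forall i, i < n -> f (S i) <> root /\ par (f (S i)) = f i.
Proof.
  move=> [ha hb] _ h1 e1; elim=> [|i IH] // hi.
  have [] := IH ltac:(lia) => h e.
  case: (ha (S i) hi) => [//|[h' e']].
  by exfalso; apply: (hb i) => //; rewrite -e -e'.
Qed.

(** If the first edge leads away from the root, depth grows along the whole walk; if the last edge
    leads towards it, the same holds for the reversed walk. Otherwise both end edges join the common
    endpoint to its parent, and removing them leaves a shorter closed walk. *)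
Lemma nb_cycle n : forall f, nbwalk f n -> 0 < n -> f 0 = f n -> False.
Proof.
  elim/(well_founded_induction lt_wf): n => n IH f nb n0 e.
  have [ha hb] := nb.
  case: (radj_dep _ _ (ha 0 n0)) => [[h1 [p1 _]]|[h1 [p1 d1]]].
  { have up := nb_up f n nb n0 h1 p1.
    have: forall i, i <= n -> dep (f i) = i + dep (f 0).
    { elim=> [|i IHi] // hi; have [] := up i ltac:(lia) => hr pr.
      by rewrite (dep_par T _ hr) pr IHi; lia. }
    by move=> /(_ n (le_n n)); rewrite -e; lia. }
  have hn : n = S (n - 1) by lia.
  case: (radj_dep _ _ (ha (n - 1) ltac:(lia))) => [[h2 [p2 _]]|[h2 [p2 d2]]].
  - rewrite -hn in h2 p2.
    have e2 : f 1 = f (n - 1) by rewrite -p2 -e p1.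
    case: (le_lt_dec n 2) => hn2.
    + have [e3|e3] : n = 1 \/ n = 2 by lia.
      * by move: (ha 0 n0); rewrite (_ : 1 = n) // -e => /radj_irrefl.
      * by apply: (hb 0); [lia|rewrite e {1}e3].
    + apply: (IH (n - 2) ltac:(lia) (fun i => f (S i))); try lia.
      * split=> i hi; [apply: ha; lia|apply: hb; lia].
      * by rewrite e2; congr f; lia.
  - have rev : nbwalk (fun i => f (n - i)) n.
    { split=> i hi.
      - apply: radj_sym; have -> : n - i = S (n - S i) by lia.
        by apply: ha; lia.
      - move=> e2; apply: (hb (n - S (S i))); first by lia.
        by rewrite -e2; congr f; lia. }
    rewrite -hn in p2 d2.
    have := nb_up _ n rev n0; rewrite Nat.sub_0_r => /(_ h2 p2) up.
    have: forall i, i <= n -> dep (f (n - i)) = i + dep (f n).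
    { elim=> [|i IHi] hi; first by rewrite Nat.sub_0_r.
      have [] := up i ltac:(lia) => hr pr.
      by rewrite (dep_par T _ hr) pr IHi; lia. }
    by move=> /(_ n (le_n n)); rewrite Nat.sub_diag e; lia.
Qed.

Definition edge_path (v : T) : T -> list T -> Prop :=
  fix ok (x : T) (p : list T) : Prop :=
    match p with [] => x = v | y :: q => radj x y /\ ok y q end.

Lemma edge_path_cat v w x p q : edge_path v x p -> edge_path w v q -> edge_path w x (p ++ q).
Proof. by elim: p x => [|y p IH] x /=; [move=> ->|move=> [h /IH h'] /h']. Qed.

Lemma edge_path_root v : exists p, edge_path root v p.
Proof.
  move E : (dep v) => d; elim: d v E => [|d IH] v E; first by exists []; apply: dep0.
  have hv : v <> root by apply: dep_pos_neq; lia.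
  have [] := IH (par v); first by have := dep_par T v hv; lia.
  by move=> p hp; exists (par v :: p); split=> //; right.
Qed.

Lemma edge_path_rev v x p : edge_path v x p -> exists q, edge_path x v q.
Proof.
  elim: p x => [|y p IH] x /=; first by move=> ->; exists [].
  move=> [h /IH [q hq]]; exists (q ++ [x]); apply: edge_path_cat hq _.
  by split=> //; apply: radj_sym.
Qed.

Lemma rooted_connected u v : exists p, edge_path v u p.
Proof.
  have [p hp] := edge_path_root u; have [q hq] := edge_path_root v.
  by have [r hr] := edge_path_rev _ _ _ hq; exists (p ++ r); apply: edge_path_cat hp hr.
Qed.

Lemma edge_path_nth v x p d : edge_path v x p ->
  (forall i, i < length p -> radj (nth i (x :: p) d) (nth (S i) (x :: p) d)) /\
  nth (length p) (x :: p) d = v.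
Proof.
  elim: p x => [|y p IH] x /=; first by move=> ->; split=> // i; lia.
  move=> [h /IH [h1 h2]]; split=> // -[|i] // hi.
  by apply: (h1 i); lia.
Qed.

Lemma rooted_acyclic v (p : list T) : p <> [] ->
  ~ (edge_path v v p /\ (forall i, S (S i) <= length p ->
       nth_error (v :: p) i <> nth_error (v :: p) (S (S i)))).
Proof.
  move=> hp [hw hnb]; have [h1 h2] := edge_path_nth v v p v hw.
  apply: (nb_cycle (length p) (fun i => nth i (v :: p) v)) => //.
  - split=> // i hi e; apply: (hnb i hi).
    rewrite (nth_error_nth' (v :: p) v); last by simpl; lia.
    by rewrite (nth_error_nth' (v :: p) v) ?e //=; lia.
  - by case: p hp {hw hnb h1 h2} => //= *; lia.
Qed.

Definition tree_of_rooted : Tree :=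
  Build_Tree T radj (inhabits root) radj_sym radj_irrefl rooted_connected rooted_acyclic.

(** [anc w] is the geodesic from the root to [w], indexed by depth; [hdv w] is its first vertex
    after the root and stands for the direction of [w]. Truncated subtraction gives
    [hdv root = root]. *)
Definition anc w i : T := Nat.iter (dep w - i) par w.
Definition hdv w : T := anc w 1.

Lemma dep_iter w k : k <= dep w -> dep (Nat.iter k par w) = dep w - k.
Proof.
  elim: k => [|k IH] hk /=; first by lia.
  have d := IH ltac:(lia).
  have hr : Nat.iter k par w <> root by apply: dep_pos_neq; lia.
  by have := dep_par T _ hr; lia.
Qed.

Lemma dep_anc w i : i <= dep w -> dep (anc w i) = i.
Proof. by move=> h; rewrite /anc dep_iter; lia. Qed.

Lemma anc0 w : anc w 0 = root.
Proof. by apply: dep0; apply: dep_anc; lia. Qed.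

Lemma anc_dep w : anc w (dep w) = w.
Proof. by rewrite /anc Nat.sub_diag. Qed.

Lemma par_anc w i : i < dep w -> par (anc w (S i)) = anc w i.
Proof. by move=> h; rewrite /anc; have -> : dep w - i = S (dep w - S i) by lia. Qed.

Lemma anc_nb w : nbwalk (anc w) (dep w).
Proof.
  split=> i hi.
  - left; rewrite par_anc //; split=> //.
    by apply: dep_pos_neq; rewrite dep_anc; lia.
  - by move=> /(f_equal dep); rewrite !dep_anc; lia.
Qed.

(** The first step from the root can only lead away from it, so [nb_up] fixes the parent of every
    later vertex and the walk is the geodesic to its end. *)
Lemma nb_root f n : nbwalk f n -> f 0 = root ->
  forall i, i <= n -> dep (f i) = i /\ f i = anc (f n) i.
Proof.
  move=> nb e0; have [ha hb] := nb.
  have d : forall i, i <= n -> dep (f i) = i /\ (0 < i -> par (f i) = f (i - 1)).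
  { case: (Nat.eq_0_gt_0_cases n) => hn.
    - by move=> i hi; have -> : i = 0 by [lia]; rewrite e0 dep_root; split=> //; lia.
    - have [h1 [p1 _]] : f 1 <> root /\ par (f 1) = f 0 /\ True.
      { by case: (ha 0 hn) => [[]|[]] // /(_ e0). }
      have up := nb_up f n nb hn h1 p1.
      elim=> [|i IH] hi; first by rewrite e0 dep_root; split=> //; lia.
      have [hr pr] := up i hi; rewrite (dep_par T _ hr) pr; have [-> _] := IH ltac:(lia).
      by split=> // _; congr f; lia. }
  have back : forall k, k <= n -> f (n - k) = anc (f n) (n - k).
  { elim=> [|k IH] hk.
    - by rewrite Nat.sub_0_r -{3}(proj1 (d n (le_n n))) anc_dep.
    - have e := IH ltac:(lia).
      have [_] := d (n - k) ltac:(lia) => /(_ ltac:(lia)) p.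
      have -> : n - S k = n - k - 1 by lia.
      rewrite -p e; have {1}-> : n - k = S (n - k - 1) by lia.
      by rewrite par_anc // (proj1 (d n (le_n n))); lia. }
  move=> i hi; split; first exact: (proj1 (d i hi)).
  by have := back (n - i) ltac:(lia); have -> : n - (n - i) = i by lia.
Qed.

Lemma hd_dep1 w : dep w = 1 -> hdv w = w.
Proof. by move=> h; rewrite /hdv -h anc_dep. Qed.

Lemma dep_hd w : 0 < dep w -> dep (hdv w) = 1.
Proof. by move=> h; rewrite /hdv dep_anc. Qed.

(** * Displacement of the root under a group action *)

Section Action.
Context {G : Grp} (act : G -> T -> T).
Record rooted_action : Prop := {
  act1 : forall v, act \1 v = v;
  actM : forall g h v, act (g ** h) v = act g (act h v);
  act_adj : forall g u v, radj u v -> radj (act g u) (act g v) }.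
Hypothesis A : rooted_action.

Lemma actK g v : act g^-1 (act g v) = v.
Proof. by rewrite -(actM A) gmul_Vl (act1 A). Qed.
Lemma actKV g v : act g (act g^-1 v) = v.
Proof. by rewrite -(actM A) mulVr (act1 A). Qed.
Lemma act_inj g u v : act g u = act g v -> u = v.
Proof. by move=> e; rewrite -(actK g u) e actK. Qed.

Lemma act_nb g f n : nbwalk f n -> nbwalk (fun i => act g (f i)) n.
Proof.
  by move=> [ha hb]; split=> i hi; [apply: (act_adj A); apply: ha|move=> /act_inj; apply: hb].
Qed.

Definition len (g : G) : nat := dep (act g root).

(* The reversed geodesic from g^-1 root followed by the geodesic to w does not backtrack. *)
Lemma act_concat g w :
  dep (act g^-1 root) = 0 \/ dep w = 0 \/ hdv (act g^-1 root) <> hdv w ->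
  dep (act g w) = len g^-1 + dep w /\
  (0 < len g^-1 -> hdv (act g w) = act g (anc (act g^-1 root) (len g^-1 - 1))).
Proof.
  move=> hj; set w' := act g^-1 root; set a := len g^-1.
  have da : dep w' = a by [].
  pose P i := act g (if i <=? a then anc w' (a - i) else anc w (i - a)).
  have Pge i : a <= i -> P i = act g (anc w (i - a)).
  { move=> hi; rewrite /P; case: Nat.leb_spec => // hi'.
    by have -> : i = a by [lia]; rewrite Nat.sub_diag !anc0. }
  have Ple i : i <= a -> P i = act g (anc w' (a - i)).
  { by move=> hi; rewrite /P; case: Nat.leb_spec => //; lia. }
  have nb : nbwalk P (a + dep w).
  { have [h1 h2] := act_nb g _ _ (anc_nb w); have [h1' h2'] := act_nb g _ _ (anc_nb w').
    split=> i hi.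
    - case: (le_lt_dec a i) => hai.
      + rewrite (Pge i) // (Pge (S i)); last by lia.
        by have -> : S i - a = S (i - a) by [lia]; apply: h1; lia.
      + rewrite (Ple i) ?(Ple (S i)); try lia.
        by have -> : a - i = S (a - S i) by [lia]; apply: radj_sym; apply: h1'; lia.
    - case: (le_lt_dec a i) => hai; [|case: (le_lt_dec (S (S i)) a) => hai'].
      + rewrite (Pge i) // (Pge (S (S i))); last by lia.
        by have -> : S (S i) - a = S (S (i - a)) by [lia]; apply: h2; lia.
      + rewrite (Ple i) ?(Ple (S (S i))); try lia.
        have -> : a - i = S (S (a - S (S i))) by lia.
        by move=> e; apply: (h2' (a - S (S i))) => //; lia.
      + rewrite (Ple i) ?(Pge (S (S i))); try lia.
        have -> : a - i = 1 by lia.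
        have -> : S (S i) - a = 1 by lia.
        by move=> /act_inj; move: hj; rewrite -/w' da; case; [lia|case; [lia|]]. }
  have P0 : P 0 = root.
  { by rewrite Ple; [rewrite Nat.sub_0_r -da anc_dep; apply: actKV|lia]. }
  have Pn : P (a + dep w) = act g w.
  { by rewrite Pge; [have -> : a + dep w - a = dep w by [lia]; rewrite anc_dep|lia]. }
  have key := nb_root P _ nb P0.
  split; first by rewrite -Pn; apply: (proj1 (key _ (le_n _))).
  move=> ha; rewrite /hdv -Pn -(proj2 (key 1 ltac:(lia))) Ple //.
Qed.

(** [g] carries the geodesic from [g^-1 root] to the root onto the one from the root to [g root]. *)
Lemma lenV g : len g^-1 = len g.
Proof.
  have [] := act_concat g root; first by right; left; apply: dep_root.
  by rewrite dep_root Nat.add_0_r /len => ->.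
Qed.

(** The geodesics from the root to [g root] and from there to [(g ** h) root] meet at [g root];
    translated back by [g^-1], the turn is between the directions of [g^-1 root] and [h root]. *)
Lemma len_mul g h :
  hdv (act g^-1 root) <> hdv (act h root) \/ len g = 0 \/ len h = 0 ->
  len (g ** h) = len g + len h /\ (0 < len g -> hdv (act (g ** h) root) = hdv (act g root)).
Proof.
  move=> hj; rewrite /len (actM A).
  have hj' : dep (act g^-1 root) = 0 \/ dep (act h root) = 0 \/
    hdv (act g^-1 root) <> hdv (act h root) by rewrite -/(len g^-1) lenV; tauto.
  have [-> e] := act_concat g _ hj'; rewrite lenV in e *; split=> // h0; rewrite e //.
  by have [|_ ->] := act_concat g root; [right; left; apply: dep_root| |]; rewrite lenV.
Qed.

Lemma act_fix_hd g w : act g root = root -> dep (act g w) = dep w /\ hdv (act g w) = act g (hdv w).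
Proof.
  move=> e; have nb := act_nb g _ _ (anc_nb w).
  have key := nb_root _ _ nb; rewrite anc0 anc_dep e in key.
  split; first by have := key eq_refl (dep w) (le_n _); rewrite anc_dep => -[].
  case: (Nat.eq_0_gt_0_cases (dep w)) => hw.
  - by rewrite (dep0 w hw) e /hdv /anc !dep_root.
  - by rewrite /hdv -(proj2 (key eq_refl 1 ltac:(lia))).
Qed.

Lemma len0 g : len g = 0 <-> act g root = root.
Proof. by split=> [/dep0|]; rewrite /len // => ->; apply: dep_root. Qed.

(** Deleting the first edge of the geodesic to [g root] and translating by [r^-1] gives the geodesic
    to [(r^-1 ** g) root], which cannot start back along the deleted edge. *)
Lemma len_split r g : len r = 1 -> 0 < len g -> hdv (act g root) = act r root ->
  len (r^-1 ** g) = len g - 1 /\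
  (1 < len g -> hdv (act (r^-1 ** g) root) <> act r^-1 root).
Proof.
  move=> lr lg e; set w := act g root in e *.
  have hdw : anc w 1 = act r root by [].
  pose f i := act r^-1 (anc w (S i)).
  have nb : nbwalk f (len g - 1).
  { have [h1 h2] := act_nb r^-1 _ _ (anc_nb w).
    by split=> i hi; rewrite /f; [apply: h1|apply: h2]; rewrite /len -/w in hi *; lia. }
  have f0 : f 0 = root by rewrite /f hdw actK.
  have fn : f (len g - 1) = act (r^-1 ** g) root.
  { by rewrite /f (actM A); have -> : S (len g - 1) = dep w; [rewrite /len -/w in lg *; lia|rewrite anc_dep]. }
  have key := nb_root f _ nb f0; rewrite fn in key.
  split; first by rewrite -(proj1 (key _ (le_n _))) fn.
  move=> hl; rewrite /hdv -(proj2 (key 1 ltac:(lia))) /f.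
  rewrite -(anc0 w); have [_ h2] := act_nb r^-1 _ _ (anc_nb w).
  by move=> e2; apply: (h2 0) => //; rewrite /len -/w in hl; lia.
Qed.

(** Successive translates of the geodesic to [g root] join without backtracking. Hence a torsion
    element that moves the root has [g root] and [g^-1 root] in the same direction. *)
Lemma len_gpow g : hdv (act g^-1 root) <> hdv (act g root) -> forall n, len (gpow g n) = n * len g.
Proof.
  move=> h.
  case: (Nat.eq_0_gt_0_cases (len g)) => lg.
  { elim=> [|n IH] /=; first by apply/len0; apply: (act1 A).
    have [|-> _] := len_mul g (gpow g n); first by tauto.
    by rewrite IH; lia. }
  suff: forall n, len (gpow g (S n)) = S n * len g /\ hdv (act (gpow g (S n)) root) = hdv (act g root).
  { by move=> key [|n]; [apply/len0; apply: (act1 A)|apply key]. }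
  elim=> [|n [IH IHh]]; first by rewrite /= mul1r; split=> //; lia.
  have [|e1 e2] := len_mul g (gpow g (S n)); first by left; rewrite IHh.
  split; last by rewrite -e2.
  by have -> : S (S n) * len g = len g + S n * len g; [|rewrite -IH -e1].
Qed.

Hypothesis trans : forall v, exists g, act g root = v.

(* The images of consecutive edges of a geodesic start in different directions, so there is no
   backtracking and lengths add up. *)
Lemma len_scale (theta : G -> G) k : hom theta ->
  (forall g, len g = 0 -> len (theta g) = 0) ->
  (forall r, len r = 1 -> len (theta r) = k) -> 0 < k ->
  (forall r r', len r = 1 -> len r' = 1 ->
     hdv (act (theta r) root) = hdv (act (theta r') root) -> act r root = act r' root) ->
  forall g, len (theta g) = len g * k.
Proof.
  move=> ht h0 h1 hk hinj.
  (* The induction also records that the direction of [theta g] depends only on that of [g]; this is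
     what excludes backtracking when a further edge is put in front. *)
  suff: forall n g, len g = n -> len (theta g) = n * k /\
    (0 < n -> forall r, act r root = hdv (act g root) -> hdv (act (theta g) root) = hdv (act (theta r) root)).
  { by move=> key g; case: (key _ g eq_refl). }
  elim=> [|n IH] g lg; first by split=> //; [apply: h0|lia].
  have [r hr] := trans (hdv (act g root)).
  have lr : len r = 1 by rewrite /len hr dep_hd // -/(len g) lg; lia.
  have [ls hs] := len_split r g lr ltac:(lia) (eq_sym hr).
  have ls' : len (r^-1 ** g) = n by lia.
  have [IH1 IH2] := IH _ ls'.
  have eg : theta g = theta r ** theta (r^-1 ** g) by rewrite -ht mulKV.
  have [|e1 e2] := len_mul (theta r) (theta (r^-1 ** g)).
  { case: (Nat.eq_0_gt_0_cases n) => hn; first by right; right; rewrite IH1 hn.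
    left; have [r1 hr1] := trans (hdv (act (r^-1 ** g) root)).
    rewrite (IH2 hn r1 hr1) -(homV ht) => e.
    apply: (hs ltac:(lia)); rewrite -hr1; symmetry; apply: hinj => //.
    - by rewrite lenV.
    - by rewrite /len hr1 dep_hd // -/(len _); lia. }
  split; first by rewrite eg e1 IH1 h1 //; lia.
  move=> _ r' hr'; rewrite eg e2; last by rewrite h1.
  have -> : r' = r ** (r^-1 ** r') by rewrite mulKV.
  rewrite ht (actM A); congr (hdv (act _ _)); symmetry; apply/len0; apply: h0; apply/len0.
  by rewrite (actM A) hr' -hr actK.
Qed.

End Action.
End Rooted.
Arguments rooted_action T {G} act.

(** * Barycentric subdivision and property FA *)

Section Subdivision.
Context (T : RootedTree).

(* (v, true) is the midpoint of the edge joining v to its parent. *)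
Definition sd_vert : Type := {p : T * bool | snd p = true -> fst p <> root}.

Lemma sd_eq (p q : sd_vert) : proj1_sig p = proj1_sig q -> p = q.
Proof. by case: p q => p hp [q hq] /= e; subst q; rewrite (proof_irrelevance _ hp hq). Qed.

Definition sd_real (v : T) : sd_vert.
Proof. by exists (v, false). Defined.
Definition sd_mid (v : T) (h : v <> root) : sd_vert.
Proof. by exists (v, true). Defined.

Definition sd_par (p : sd_vert) : sd_vert :=
  match p with
  | exist _ (v, true) _ => sd_real (par v)
  | exist _ (v, false) _ =>
      match excluded_middle_informative (v <> root) with
      | left h => sd_mid v h | right _ => sd_real v end
  end.
Definition sd_dep (p : sd_vert) : nat :=
  2 * dep (fst (proj1_sig p)) - (if snd (proj1_sig p) then 1 else 0).

Definition subdiv : RootedTree.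
Proof.
  refine (Build_RootedTree sd_vert (sd_real root) sd_par sd_dep _ _).
  - by rewrite /sd_dep /= dep_root.
  - case=> -[v b] h hr; rewrite /sd_dep /=.
    case: b h hr => h hr /=.
    + by rewrite (dep_par T v); [lia|exact (h eq_refl)].
    + case: excluded_middle_informative => [h'|h'] /=.
      * by have := dep_pos _ h'; lia.
      * by exfalso; apply: hr; apply: sd_eq => /=; congr (_, _); apply: NNPP.
Defined.

(** An edge is named by its end farther from the root. A group element may reverse which end that
    is, so the image of a midpoint has to be named afresh. *)
Definition deeper (u v : T) : T := if dep u <? dep v then v else u.

Lemma deeper_adj u v : radj u v -> deeper u v <> root /\
  ((deeper u v = u /\ par u = v) \/ (deeper u v = v /\ par v = u)).
Proof.
  rewrite /deeper; case/radj_dep=> -[h [p d]]; case: Nat.ltb_spec => d'; try lia; tauto.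
Qed.

Lemma deeper_sym u v : radj u v -> deeper u v = deeper v u.
Proof.
  by rewrite /deeper; case/radj_dep=> -[h [p d]]; do 2 (case: Nat.ltb_spec => ?); try lia.
Qed.

Lemma deeper_par v : v <> root -> deeper v (par v) = v.
Proof. by move=> /(dep_par T) e; rewrite /deeper; case: Nat.ltb_spec => //; lia. Qed.

Lemma radj_par (v : T) : v <> root -> radj v (par v).
Proof. by right. Qed.

Context {Q : Grp} (act : Q -> T -> T) (A : rooted_action T act).

Lemma act_par_adj g v : v <> root -> radj (act g v) (act g (par v)).
Proof. by move=> h; apply: (act_adj _ A); apply: radj_par. Qed.

Definition sd_act (g : Q) (p : subdiv) : subdiv :=
  match p with
  | exist _ (v, true) h => sd_mid (deeper (act g v) (act g (par v)))
        (proj1 (deeper_adj _ _ (act_par_adj g v (h eq_refl))))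
  | exist _ (v, false) _ => sd_real (act g v)
  end.

Lemma sd_actM g h p : sd_act (g ** h) p = sd_act g (sd_act h p).
Proof.
  case: p => -[v []] hv; apply: sd_eq => /=; congr (_, _); last exact: (actM _ A).
  rewrite !(actM _ A).
  have hr := hv eq_refl; have a := act_par_adj h v hr; simpl in hr, a.
  case: (deeper_adj _ _ a) => _ [[-> ->]|[-> ->]] //.
  by apply: deeper_sym; apply: (act_adj _ A).
Qed.

Lemma sd_act1 p : sd_act \1 p = p.
Proof.
  case: p => -[v []] hv; apply: sd_eq => /=; congr (_, _); last exact: (act1 _ A).
  by rewrite !(act1 _ A); apply: deeper_par; apply: hv.
Qed.

Lemma sd_adjE (p q : subdiv) : radj p q <->
  (exists v h, v <> root /\ p = sd_mid v h /\ (q = sd_real v \/ q = sd_real (par v))) \/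
  (exists v h, v <> root /\ q = sd_mid v h /\ (p = sd_real v \/ p = sd_real (par v))).
Proof.
  have down : forall p q : subdiv, q <> root -> par q = p ->
    (exists v h, v <> root /\ p = sd_mid v h /\ (q = sd_real v \/ q = sd_real (par v))) \/
    (exists v h, v <> root /\ q = sd_mid v h /\ (p = sd_real v \/ p = sd_real (par v))).
  { move=> {}p {q} [[v b] h] hr <- /=; case: b h hr => /= h hr.
    - right; exists v, (h eq_refl); split; first exact (h eq_refl).
      by split; [apply: sd_eq|right].
    - case: excluded_middle_informative => h' /=.
      + by left; exists v, h'; split=> //; split=> //; left; apply: sd_eq.
      + by exfalso; apply: hr; apply: sd_eq => /=; congr (_, _); apply: NNPP. }
  have mid v h : v <> root -> radj (sd_mid v h : subdiv) (sd_real v) /\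
    radj (sd_mid v h : subdiv) (sd_real (par v)).
  { move=> hv; split; [left|right]; split.
    - by move=> [e]; apply: hv.
    - by rewrite /=; case: excluded_middle_informative => h' //; apply: sd_eq.
    - by move=> [].
    - by []. }
  split.
  - case=> -[h1 h2]; first exact: down.
    by case: (down q p h1 h2); tauto.
  - by case=> -[v [h [hv [-> [->|->]]]]]; have [m1 m2] := mid v h hv; try exact: radj_sym.
Qed.

Lemma sd_act_adj g p q : radj p q -> radj (sd_act g p) (sd_act g q).
Proof.
  have key v h q' : (q' = sd_real v \/ q' = sd_real (par v)) ->
    radj (sd_act g (sd_mid v h)) (sd_act g q').
  { move=> e; apply/sd_adjE; left; exists _, (proj1 (deeper_adj _ _ (act_par_adj g v h))).
    split; first exact: (proj1 (deeper_adj _ _ (act_par_adj g v h))).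
    split; first by apply: sd_eq.
    have [_] := deeper_adj _ _ (act_par_adj g v h).
    by case: e => -> /= [[-> ->]|[-> ->]]; tauto. }
  by case/sd_adjE=> -[v [h [_ [-> e]]]]; [|apply: radj_sym]; apply: key.
Qed.

Lemma sd_act_type g p : snd (proj1_sig (sd_act g p)) = snd (proj1_sig p).
Proof. by case: p => -[v []] h. Qed.

(** [PropertyFA] covers only actions without inversions, whereas [v] inverts an edge of the tree of
    F. On the subdivision, vertices and midpoints are never exchanged, so FA applies there; a fixed
    midpoint is an edge preserved as a set. *)
Lemma FA_rooted : PropertyFA Q ->
  (exists v, forall g, act g v = v) \/
  (exists v, v <> root /\ forall g, (act g v = v /\ act g (par v) = par v) \/
                                   (act g v = par v /\ act g (par v) = v)).
Proof.
  move=> /(_ (@tree_of_rooted subdiv) sd_act) [].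
  - split; first exact: sd_act1.
    split; first exact: sd_actM.
    split; first exact: sd_act_adj.
    move=> g u v a [e _]; have := sd_act_type g u; rewrite e.
    by case/sd_adjE: a => -[w [h [_ [-> [->|->]]]]].
  - case=> -[v []] h fix_v; last by left; exists v => g; have := fix_v g => -[].
    right; exists v; split; first exact (h eq_refl).
    move=> g; have e := f_equal (fun p => fst (proj1_sig p)) (fix_v g).
    rewrite /= in e; have [_] := deeper_adj _ _ (act_par_adj g v (h eq_refl)).
    by rewrite e; case=> -[e1]; rewrite -e1 => <-; [left|right].
Qed.
End Subdivision.

(** * The free product of two finite cyclic groups *)

Lemma removelast_cons {A : Type} (a : A) l : l <> [] -> removelast (a :: l) = a :: removelast l.
Proof. by case: l. Qed.

Lemma removelast_length {A : Type} (l : list A) : l <> [] -> length l = S (length (removelast l)).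
Proof.
  elim: l => // a l IH _; case: l IH => [|b l] IH //=.
  by rewrite -IH.
Qed.

Lemma removelast_tl {A : Type} (l : list A) : removelast (tl l) = tl (removelast l).
Proof. by case: l => [|a [|b l]]. Qed.

Lemma Forall_removelast {A : Type} (P : A -> Prop) l : Forall P l -> Forall P (removelast l).
Proof.
  elim: l => // a l IH /Forall_cons_iff [h1 h2]; case: l IH h2 => // b l IH h2.
  by rewrite removelast_cons //; constructor=> //; apply: IH.
Qed.

Section FreeProduct.
Variable m : nat.

Definition relF : list word := [repeat (0, true) m; [(1, true); (1, true)]].
Lemma relF_on r : In r relF -> word_on 2 r.
Proof.
  move=> /= [<-|[<-|//]] a.
  - by move=> ha; rewrite (repeat_spec _ _ _ ha) /=; lia.
  - by move=> /= [<-|[<-|//]] /=; lia.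
Qed.

Definition FF : Grp := PG 2 relF.
Definition uF : FF := pgen 2 relF 0.
Definition vF : FF := pgen 2 relF 1.

Lemma eval_repeat (H : Grp) (h : nat -> H) i k : eval_word H h (repeat (i, true) k) = gpow (h i) k.
Proof. by elim: k => //= k ->. Qed.

Lemma FF_hom (H : Grp) (a b : H) : gpow a m = \1 -> b ** b = \1 ->
  exists f : FF -> H, hom f /\ f uF = a /\ f vF = b.
Proof.
  move=> ea eb.
  have [|f [hf e]] := presents_hom _ _ _ _ H (fun i => match i with 0 => a | _ => b end)
     (PG_presents 2 relF relF_on).
  { by move=> r /= [<-|[<-|//]]; rewrite ?eval_repeat //= /eval_letter /= mul1r. }
  by exists f; split=> //; split; [apply: (e 0); lia|apply: (e 1); lia].
Qed.

Lemma FF_ind (P : FF -> Prop) : P \1 -> (forall x y, P x -> P y -> P (x ** y)) ->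
  (forall x, P x -> P x^-1) -> P uF -> P vF -> forall g, P g.
Proof.
  move=> p1 pM pV pu pv; apply: (presents_ind _ _ _ _ P (PG_presents 2 relF relF_on)) => //.
  by move=> [|[|i]] // ; lia.
Qed.

Lemma uF_pow : gpow uF m = \1.
Proof.
  have := presents_rel _ _ _ _ (PG_presents 2 relF relF_on) _ (or_introl eq_refl).
  by rewrite eval_repeat.
Qed.
Lemma vF_sq : vF ** vF = \1.
Proof.
  have := presents_rel _ _ _ _ (PG_presents 2 relF relF_on) [(1, true); (1, true)]
    (or_intror (or_introl eq_refl)).
  by rewrite -[eval_word _ _ _]/(vF ** (vF ** \1)) mul1r.
Qed.
Lemma vF_inv : vF^-1 = vF.
Proof. by symmetry; apply: inv_unique; apply: vF_sq. Qed.

Lemma FF_hom_ext (H : Grp) (f g : FF -> H) : hom f -> hom g -> f uF = g uF -> f vF = g vF ->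
  forall x, f x = g x.
Proof.
  move=> hf hg eu ev; apply: FF_ind => //; first by rewrite (hom1 hf) (hom1 hg).
  - by move=> x y ex ey; rewrite hf hg ex ey.
  - by move=> x ex; rewrite (homV hf) (homV hg) ex.
Qed.

Definition inU (x : FF) : Prop := exists i, x = gpow uF i.
Lemma inU1 : inU \1. Proof. by exists 0. Qed.
Lemma inUM x y : inU x -> inU y -> inU (x ** y).
Proof. by move=> [i ->] [j ->]; exists (i + j); rewrite gpowD. Qed.
Lemma uF_mod i : gpow uF i = gpow uF (i mod m).
Proof.
  rewrite {1}(Nat.div_mod_eq i m) Nat.mul_comm gpowD gpowM uF_pow gpow1 gmul_1l //.
Qed.
Hypothesis m2 : 2 < m.

Lemma inUV x : inU x -> inU x^-1.
Proof.
  move=> [i ->]; exists ((m - 1) * i); symmetry; apply: inv_unique.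
  rewrite -gpowD; have -> : i + (m - 1) * i = i * m by nia.
  by rewrite gpowM uF_pow gpow1.
Qed.
Lemma inU_lt x : inU x -> exists i, i < m /\ x = gpow uF i.
Proof.
  by move=> [i ->]; exists (i mod m); rewrite -uF_mod; split=> //; apply: Nat.mod_upper_bound; lia.
Qed.

Section Words.
(* The syllable list [b1; ...; bk] stands for the coset u^b1 v ... u^bk v U.
   lim bounds the length; the unbounded case is a tree, the bounded ones are finite. *)
Variable lim : nat -> bool.
Hypothesis lim_mono : forall k, lim (S k) = true -> lim k = true.

Definition okF (l : list nat) : Prop :=
  Forall (fun b => b < m) l /\ Forall (fun b => b <> 0) (tl l) /\
  (l <> [] -> lim (length (tl l)) = true).
Definition VF : Type := {l : list nat | okF l}.
Lemma VF_eq (p q : VF) : proj1_sig p = proj1_sig q -> p = q.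
Proof. by case: p q => p hp [q hq] /= e; subst q; rewrite (proof_irrelevance _ hp hq). Qed.

Definition rawu (l : list nat) : list nat :=
  match l with [] => [] | b :: t => (S b) mod m :: t end.
(** A leading syllable with exponent 0 is a bare [v] and cancels. Where [lim] forbids lengthening,
    the list is left fixed, which keeps the map an involution. *)
Definition rawv (l : list nat) : list nat :=
  match l with
  | 0 :: t => t
  | _ => if lim (length l) then 0 :: l else l
  end.

Lemma okF_nil : okF [].
Proof. by split; [|split]; try constructor. Qed.
Lemma okF_tail b t : okF (b :: t) -> okF t.
Proof.
  move=> [/Forall_cons_iff [h1 h2] [h3 h4]]; split=> //; split.
  - by case: t h3 {h2 h4} => //= c t /Forall_cons_iff [].
  - by have /= := h4 ltac:(done); case: t {h2 h3 h4} => //= c t /lim_mono.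
Qed.
Lemma rawu_ok l : okF l -> okF (rawu l).
Proof.
  case: l => // b t [/Forall_cons_iff [h1 h2] [h3 h4]]; split; last by split=> // _; apply: h4.
  by constructor=> //; apply: Nat.mod_upper_bound; lia.
Qed.
Lemma rawv_push l : hd_error l <> Some 0 -> rawv l = if lim (length l) then 0 :: l else l.
Proof. by case: l => [|[|b] t]. Qed.
Lemma rawv_ok l : okF l -> okF (rawv l).
Proof.
  move=> hl; case: (classic (hd_error l = Some 0)) => h0.
  - by case: l h0 hl => //= [[|b] t] // _; apply: okF_tail.
  - rewrite rawv_push //; case E : (lim (length l)) => //.
    have [h1 [h2 h3]] := hl; split; first by constructor=> //; lia.
    split=> //=; case: l h0 h1 h2 {h3 hl E} => //= b t h0 h1 h2.
    by constructor=> // e; apply: h0; rewrite e.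
Qed.
Lemma rawv_K l : okF l -> rawv (rawv l) = l.
Proof.
  move=> hl; case: (classic (hd_error l = Some 0)) => h0.
  - case: l h0 hl => //= [[|b] t] // _ [_ [h3 h4]].
    have /= ht := h4 ltac:(done); rewrite rawv_push ?ht //.
    by case: t h3 {h4 ht} => //= c t /Forall_cons_iff [hc _] [].
  - by rewrite (rawv_push l) //; case E : (lim (length l)) => //; rewrite rawv_push // E.
Qed.
Lemma rawu_iter k b t : b < m -> Nat.iter k rawu (b :: t) = (b + k) mod m :: t.
Proof.
  move=> hb; elim: k => [|k IH] /=; first by rewrite Nat.add_0_r Nat.mod_small.
  rewrite IH /=; congr (_ :: _).
  rewrite -[S (_ mod m)]Nat.add_1_r Nat.Div0.add_mod_idemp_l; congr (_ mod m); lia.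
Qed.
Lemma rawu_iter_nil k : Nat.iter k rawu [] = [].
Proof. by elim: k => //= k ->. Qed.
Lemma rawu_m l : okF l -> Nat.iter m rawu l = l.
Proof.
  case: l => [|b t] hl; first exact: rawu_iter_nil.
  have [/Forall_cons_iff [h1 _] _] := hl; rewrite rawu_iter //.
  congr (_ :: _); have -> : b + m = b + 1 * m by lia.
  by rewrite Nat.Div0.mod_add Nat.mod_small.
Qed.

Definition actu (p : VF) : VF := exist _ _ (rawu_ok _ (proj2_sig p)).
Definition actv (p : VF) : VF := exist _ _ (rawv_ok _ (proj2_sig p)).
Lemma actv_K p : actv (actv p) = p.
Proof. by apply: VF_eq; apply: rawv_K; apply: (proj2_sig p). Qed.
Lemma actu_iter k p : proj1_sig (Nat.iter k actu p) = Nat.iter k rawu (proj1_sig p).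
Proof. by elim: k => //= k ->. Qed.
Lemma actu_m p : Nat.iter m actu p = p.
Proof. by apply: VF_eq; rewrite actu_iter; apply: rawu_m; apply: (proj2_sig p). Qed.

Definition permu : Sym VF.
Proof.
  refine {| pfun := actu; pbk := Nat.iter (m - 1) actu |} => x.
  - by rewrite -Nat.iter_succ_r; have -> : S (m - 1) = m by [lia]; apply: actu_m.
  - by rewrite -Nat.iter_succ; have -> : S (m - 1) = m by [lia]; apply: actu_m.
Defined.
Definition permv : Sym VF := involution actv actv_K.

Lemma rho_ex : exists f : FF -> Sym VF, hom f /\ f uF = permu /\ f vF = permv.
Proof.
  apply: FF_hom.
  - by apply: perm_eq => x; rewrite sym_powE; apply: actu_m.
  - by apply: perm_eq => x; apply: actv_K.
Qed.
Definition rhoF : FF -> Sym VF := proj1_sig (constructive_indefinite_description _ rho_ex).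
Lemma rhoF_hom : hom rhoF.
Proof. exact: (proj1 (proj2_sig (constructive_indefinite_description _ rho_ex))). Qed.
Lemma rhoF_u : rhoF uF = permu.
Proof. exact: (proj1 (proj2 (proj2_sig (constructive_indefinite_description _ rho_ex)))). Qed.
Lemma rhoF_v : rhoF vF = permv.
Proof. exact: (proj2 (proj2 (proj2_sig (constructive_indefinite_description _ rho_ex)))). Qed.

Definition actF (g : FF) (p : VF) : VF := pfun (rhoF g) p.
Lemma actF1 p : actF \1 p = p.
Proof. by rewrite /actF (hom1 rhoF_hom). Qed.
Lemma actFM g h p : actF (g ** h) p = actF g (actF h p).
Proof. by rewrite /actF rhoF_hom. Qed.
Lemma actF_u p : proj1_sig (actF uF p) = rawu (proj1_sig p).
Proof. by rewrite /actF rhoF_u. Qed.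
Lemma actF_v p : proj1_sig (actF vF p) = rawv (proj1_sig p).
Proof. by rewrite /actF rhoF_v. Qed.
Lemma actF_upow k p : proj1_sig (actF (gpow uF k) p) = Nat.iter k rawu (proj1_sig p).
Proof. by elim: k => [|k IH] /=; [rewrite actF1|rewrite actFM actF_u IH]. Qed.

Definition rootF : VF := exist _ [] okF_nil.

Fixpoint realF (l : list nat) : FF :=
  match l with [] => \1 | b :: t => gpow uF b ** vF ** realF t end.

Lemma realF_act p : actF (realF (proj1_sig p)) rootF = p.
Proof.
  case: p => l hl; elim: l hl => [|b t IH] hl /=; first by rewrite actF1; apply: VF_eq.
  apply: VF_eq; rewrite !actFM (IH (okF_tail _ _ hl)) actF_upow actF_v /=.
  have [/Forall_cons_iff [h1 _] [h3 h4]] := hl.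
  rewrite rawv_push.
  - have /= -> := h4 ltac:(done); rewrite rawu_iter /=; last by lia.
    by rewrite Nat.mod_small.
  - by case: t h3 {IH hl h4} => //= c t /Forall_cons_iff [hc _] [].
Qed.

Lemma inU_root x : inU x -> actF x rootF = rootF.
Proof. by move=> [i ->]; apply: VF_eq; rewrite actF_upow rawu_iter_nil. Qed.

(** [u^i] adds [i] to the first exponent modulo [m], so a fixed vertex other than the root forces
    [m] to divide [i]. This holds in the truncated actions as well. *)
Lemma inU_free x p : inU x -> p <> rootF -> actF x p = p -> x = \1.
Proof.
  move=> [i ->] hp; case: p hp => -[|b t] hl hp; first by case: hp; apply: VF_eq.
  have [/Forall_cons_iff [h1 _] _] := hl.
  move=> /(f_equal (@proj1_sig _ _)); rewrite actF_upow /= rawu_iter // => -[e].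
  suff i0 : i mod m = 0 by rewrite uF_mod i0.
  have := Nat.div_mod_eq (b + i) m; rewrite e => e2.
  have -> : i = ((b + i) / m) * m by lia.
  exact: Nat.Div0.mod_mul.
Qed.
End Words.

(** * The tree of F *)

Definition nolim (k : nat) : bool := true.
Lemma nolim_mono k : nolim (S k) = true -> nolim k = true. Proof. by []. Qed.
Local Notation V := (VF nolim).
Local Notation act := (actF nolim nolim_mono).

Lemma okF_removelast l : okF nolim l -> okF nolim (removelast l).
Proof.
  move=> [h1 [h2 h3]]; split; first exact: Forall_removelast.
  by split=> //; rewrite -removelast_tl; apply: Forall_removelast.
Qed.

Definition parF (p : V) : V := exist _ _ (okF_removelast _ (proj2_sig p)).

Lemma length_parF (p : V) : p <> rootF nolim -> length (proj1_sig p) = S (length (proj1_sig (parF p))).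
Proof. by case: p => l hl hr /=; apply: removelast_length => e; apply: hr; apply: VF_eq. Qed.

(** The Bass-Serre tree of F with the vertices of degree two, the cosets of the group generated by
    [v], suppressed; for this reason [v] inverts an edge. *)
Definition treeF : RootedTree :=
  Build_RootedTree V (rootF nolim) parF (fun p => length (proj1_sig p)) eq_refl length_parF.

Canonical treeF.

Lemma treeF_nil (p : treeF) : p <> root <-> proj1_sig p <> [].
Proof.
  by split=> h e; apply: h; [apply: VF_eq|rewrite e].
Qed.

Lemma treeF_adj (p q : treeF) : radj p q <->
  (proj1_sig q <> [] /\ removelast (proj1_sig q) = proj1_sig p) \/
  (proj1_sig p <> [] /\ removelast (proj1_sig p) = proj1_sig q).
Proof.
  split; case=> -[/treeF_nil h1 h2]; [left|right|left|right]; split=> //.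
  - by rewrite -h2.
  - by rewrite -h2.
  - exact: VF_eq.
  - exact: VF_eq.
Qed.

Lemma actF_rooted : rooted_action treeF act.
Proof.
  split; [exact: actF1|exact: actFM|].
  have key x : (forall u v : treeF, proj1_sig v <> [] -> removelast (proj1_sig v) = proj1_sig u ->
     radj (act x u : treeF) (act x v)) -> forall u v : treeF, radj u v -> radj (act x u : treeF) (act x v).
  { by move=> h u v /treeF_adj [[h1 h2]|[h1 h2]]; [|apply: radj_sym]; apply: h. }
  (* Treating [g] and [g^-1] together lets the induction over generators pass through inverses. *)
  suff: forall g : FF, (forall u v : treeF, radj u v -> radj (act g u : treeF) (act g v)) /\
    (forall u v : treeF, radj u v -> radj (act g^-1 u : treeF) (act g^-1 v)).
  { by move=> h g; case: (h g). }
  have hu : forall u v : treeF, radj u v -> radj (act uF u : treeF) (act uF v).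
  { apply: key => u v h1 h2; apply/treeF_adj; left; rewrite !actF_u -h2.
    by case: (proj1_sig v) h1 => [|b [|c t]]. }
  have hv : forall u v : treeF, radj u v -> radj (act vF u : treeF) (act vF v).
  { apply: key => u v h1 h2; apply/treeF_adj; rewrite !actF_v -h2.
    case: (proj1_sig v) h1 => [|[|b] t] // _.
    - case: t => [|c t]; first by right.
      by left; split=> //.
    - by left; split=> //; case: t. }
  apply: FF_ind.
  - by rewrite inv1; split=> u v; rewrite !actF1.
  - move=> x y [h1 h2] [h3 h4]; split=> u v huv.
    + by rewrite !actFM; apply: h1; apply: h3.
    + by rewrite invM !actFM; apply: h4; apply: h2.
  - by move=> x [h1 h2]; rewrite invK.
  - split=> //; have [i ->] : inU uF^-1 by apply: inUV; exists 1; rewrite /= mul1r.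
    elim: i => [|i IH] u v huv; first by rewrite !actF1.
    by rewrite /= !actFM; apply: hu; apply: IH.
  - by rewrite vF_inv.
Qed.

Lemma treeF_trans (p : treeF) : exists g, act g (root : treeF) = p.
Proof. by exists (realF (proj1_sig p)); apply: realF_act. Qed.

Local Notation lenF := (@len treeF FF act).

(** Existence of normal forms, by induction over generators. Taking the root for [p] writes [g] as
    [realF] of its coset times a power of [u], so the stabilizer of the root is no larger than
    [inU]. *)
Lemma realF_nf (g : FF) (p : treeF) :
  exists x, inU x /\ g ** realF (proj1_sig p) = realF (proj1_sig (act g p)) ** x.
Proof.
  move: g p; apply: FF_ind.
  - by move=> p; exists \1; split; [apply: inU1|rewrite actF1 gmul_1l mul1r].
  - move=> x y hx hy p; have [a [ha ea]] := hy p; have [b [hb eb]] := hx (act y p).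
    exists (b ** a); split; first exact: inUM.
    by rewrite actFM mulA ea -[LHS]mulA eb mulA.
  - move=> x hx p; have [a [ha ea]] := hx (act x^-1 p).
    exists a^-1; split; first exact: inUV.
    rewrite -actFM mulVr actF1 in ea.
    by apply: (@mulIr _ a); apply: (@mulI _ x); rewrite !mulA gmul_Vl mul1r ea mulKV.
  - case=> -[|b t] hl.
    + exists uF; split; first by exists 1; rewrite /= mul1r.
      by rewrite actF_u /= mul1r gmul_1l.
    + exists \1; split; first exact: inU1.
      by rewrite actF_u mul1r /= -(uF_mod (S b)) /=; grp.
  - case=> l hl; exists \1; split; first exact: inU1.
    rewrite actF_v mul1r /=; case: l hl => [|[|b] t] hl /=; try by rewrite gmul_1l.
    by rewrite gmul_1l -[LHS]mulA vF_sq gmul_1l.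
Qed.

Lemma stab_root (g : FF) : act g (rootF nolim) = rootF nolim -> inU g.
Proof.
  by move=> e; have [x [hx]] := realF_nf g (rootF nolim); rewrite e /= mul1r gmul_1l => ->.
Qed.

Lemma lenF0 (g : FF) : lenF g = 0 <-> inU g.
Proof. by rewrite (len0 act); split; [apply: stab_root|apply: inU_root]. Qed.

Lemma okF1 b : b < m -> okF nolim [b].
Proof. by move=> hb; split; [constructor|split]; try constructor. Qed.

Lemma act_v_root : act vF (rootF nolim) = exist _ [0] (okF1 0 ltac:(lia)).
Proof. by apply: VF_eq; rewrite actF_v. Qed.

Lemma act_v_root_neq : act vF (rootF nolim) <> rootF nolim.
Proof. by rewrite act_v_root => -[]. Qed.

Lemma uF_neq1 : uF <> \1.
Proof.
  move=> e; have := actF_u nolim nolim_mono (exist _ [0] (okF1 0 ltac:(lia))).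
  by rewrite e actF1 /= Nat.mod_small //; lia.
Qed.

Lemma vF_notU : ~ inU vF.
Proof. by move=> /inU_root => /(_ nolim nolim_mono) /act_v_root_neq. Qed.

Lemma fix_all (g : FF) : (forall x, act g (act x (rootF nolim)) = act x (rootF nolim)) -> g = \1.
Proof.
  move=> h; apply: (inU_free nolim nolim_mono g (act vF (rootF nolim))) => //.
  - by apply: stab_root; have := h \1; rewrite actF1.
  - exact: act_v_root_neq.
Qed.

(** The only fixed point of [u] is the root, and that of its conjugate is [x root], a different
    vertex. An element commuting with both fixes both vertices, hence is trivial. *)
Lemma centralizer_trivial (x y : FF) : ~ inU x ->
  commute y uF -> commute y (x ** uF ** x^-1) -> y = \1.
Proof.
  move=> hx c1 c2.
  have fixed (z : FF) : commute z uF -> act z (rootF nolim) = rootF nolim.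
  { move=> c; apply: NNPP => h; apply: uF_neq1.
    apply: (inU_free nolim nolim_mono _ (act z (rootF nolim))) => //.
    - by exists 1; rewrite /= mul1r.
    - by rewrite -actFM -c actFM inU_root //; exists 1; rewrite /= mul1r. }
  apply: (inU_free nolim nolim_mono _ (act x (rootF nolim))).
  - by apply: stab_root; apply: fixed.
  - by move=> e; apply: hx; apply: stab_root.
  - have c3 : commute (x^-1 ** y ** x) uF.
    { by rewrite /commute; apply: (@mulI _ x); apply: (@mulIr _ x^-1); move: c2; rewrite /commute; grp. }
    have := fixed _ c3; rewrite !actFM => e.
    by rewrite -{2}e -[RHS]actFM mulVr actF1.
Qed.

(** * Images in F of groups with property FA *)

Section HomFromFA.
Context {Q : Grp} (FA : PropertyFA Q) (h : Q -> FF) (hh : hom h).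

Let actQ (q : Q) (p : treeF) : treeF := act (h q) p.
Lemma actQ_rooted : rooted_action treeF actQ.
Proof.
  split=> [p|q r p|q]; rewrite /actQ.
  - by rewrite (hom1 hh); apply: actF1.
  - by rewrite hh; apply: actFM.
  - by apply: (act_adj _ actF_rooted).
Qed.

(** Vertex stabilizers are conjugates of the finite group generated by [u]; if an edge is preserved
    and some [s] flips it, one further coset suffices. *)
Lemma FA_image_finite : exists l : list FF, forall q, In (h q) l.
Proof.
  have U_list (g : FF) : exists l, forall x, act x (act g (rootF nolim)) = act g (rootF nolim) -> In x l.
  { exists (map (fun i => conjg g (gpow uF i)) (seq 0 m)) => x e.
    have [i [hi ei]] : exists i, i < m /\ g^-1 ** x ** g = gpow uF i.
    { by apply: inU_lt; apply: stab_root; rewrite !actFM e -actFM gmul_Vl actF1. }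
    apply/in_map_iff; exists i; split; last by apply/in_seq; lia.
    by rewrite -ei /conjg; grp. }
  case: (FA_rooted treeF actQ actQ_rooted FA) => -[p].
  - have [g <-] := treeF_trans p; have [l hl] := U_list g => hfix.
    by exists l => q; apply: hl; apply: hfix.
  - move=> [hr hfix]; have [g eg] := treeF_trans p; have [l hl] := U_list g; rewrite /root /= eg in hl.
    case: (classic (exists q, actQ q p = par p /\ actQ q (par p) = p)) => [[s [s1 s2]]|no].
    + exists (l ++ map (fun x => h s ** x) l) => q; apply/in_app_iff.
      case: (hfix q) => -[e1 e2]; first by left; apply: hl.
      right; apply/in_map_iff; exists (h s^-1 ** h q); split; first by rewrite -!hh mulKV.
      apply: hl; rewrite -hh -/(actQ _ p) (actM _ actQ_rooted) e1.
      by apply: (act_inj actQ actQ_rooted s); rewrite (actKV actQ actQ_rooted) s1.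
    + exists l => q; apply: hl; case: (hfix q) => -[e1 e2] //.
      by exfalso; apply: no; exists q.
Qed.

(** Normality of the image spreads a fixed vertex to every vertex. A preserved edge spreads likewise
    to every edge; no element exchanges the root with both [v root] and [u v root], so the root and
    [v root] are fixed. *)
Lemma FA_image_trivial : (forall x q, exists q', x ** h q ** x^-1 = h q') -> forall q, h q = \1.
Proof.
  move=> norm.
  have norm' x q : exists q', x^-1 ** h q ** x = h q'.
  { by have := norm x^-1 q; rewrite invK. }
  case: (FA_rooted treeF actQ actQ_rooted FA) => -[p].
  - have [g <-] := treeF_trans p => hfix q; apply: fix_all => x.
    have [q' e] := norm' (x ** g^-1) q.
    have := hfix q'; rewrite /actQ -e invM invK !actFM.
    rewrite -(actFM _ _ g^-1 g) gmul_Vl actF1.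
    move=> /(act_inj _ actF_rooted) e2.
    by rewrite -[LHS](actKV _ actF_rooted x) e2.
  - move=> [hr hfix].
    (* Every edge is a translate of the one from the root to [v root]. *)
    have [b [g [eg ep]]] : exists b g, act g (act (gpow uF b ** vF) (rootF nolim)) = p /\
      act g (rootF nolim) = par p.
    { have [g eg] := treeF_trans (par p).
      have a : radj (root : treeF) (act g^-1 p).
      { have := act_adj _ actF_rooted g^-1 _ _ (radj_par treeF p hr) => /radj_sym.
        by rewrite -eg (actK _ actF_rooted). }
      case/treeF_adj: a => -[h1 h2] //.
      move: h1 h2; case E : (proj1_sig (act g^-1 p)) => [|b [|c t]] // _ _.
      exists b, g; split=> //; rewrite -[RHS](actKV _ actF_rooted g); congr act.
      have := realF_act nolim nolim_mono (act g^-1 p); rewrite E /= => <-.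
      by rewrite mul1r. }
    have edge q x : act (h q) (act x (rootF nolim)) = act x (rootF nolim) /\
         act (h q) (act (x ** vF) (rootF nolim)) = act (x ** vF) (rootF nolim) \/
       act (h q) (act x (rootF nolim)) = act (x ** vF) (rootF nolim) /\
         act (h q) (act (x ** vF) (rootF nolim)) = act x (rootF nolim).
    { pose y := x ** (g ** gpow uF b)^-1.
      have [q' e] := norm' y q.
      have ub : act (gpow uF b) (rootF nolim) = rootF nolim by apply: inU_root; exists b.
      have e1 : act y (par p) = act x (rootF nolim).
      { by rewrite -ep -{1}ub -!actFM /y; grp. }
      have e2 : act y p = act (x ** vF) (rootF nolim) by rewrite -eg -!actFM /y; grp.
      have tr z : act (h q) (act y z) = act y (act (h q') z) by rewrite -e -!actFM; grp.
      rewrite -e1 -e2 !tr; have := hfix q'; rewrite /actQ.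
      by case=> -[-> ->]; tauto. }
    move=> q; apply: (inU_free nolim nolim_mono _ (act vF (rootF nolim))).
    + apply: stab_root; case: (edge q \1) => -[+ _]; rewrite actF1 ?gmul_1l // => e1.
      case: (edge q uF) => -[+ _]; rewrite (inU_root nolim nolim_mono uF) //; try by exists 1; rewrite /= mul1r.
      rewrite e1 actFM act_v_root => /(f_equal (@proj1_sig _ _)).
      by rewrite actF_u /= Nat.mod_small //; lia.
    + exact: act_v_root_neq.
    + case: (edge q \1) => -[]; rewrite actF1 gmul_1l // => e1 _.
      case: (edge q uF) => -[+ _]; rewrite (inU_root nolim nolim_mono uF) //; try by exists 1; rewrite /= mul1r.
      * by rewrite e1 => /act_v_root_neq.
      * rewrite e1 actFM act_v_root => /(f_equal (@proj1_sig _ _)).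
        by rewrite actF_u /= Nat.mod_small //; lia.
Qed.
End HomFromFA.

(** Syllable lists of bounded length form a finite F-set. If it contains the list of [g root], then
    [g] moves the root there, unless [g] is a power of [u], and then it moves [[0]]. *)
Lemma FF_residually_finite : ResFinite FF.
Proof.
  move=> g hg.
  have [x [[i ex] eg]] := realF_nf g (rootF nolim).
  rewrite /= mul1r in eg; set w := act g (rootF nolim) in eg.
  (* The successor keeps [[0]] admissible even when [w] is empty. *)
  pose N := S (length (proj1_sig w)).
  pose lim k := k <? N.
  have lim_mono k : lim (S k) = true -> lim k = true.
  { by rewrite /lim !Nat.ltb_lt; lia. }
  have bounded : forall K, exists L : list (list nat), forall l, length l <= K ->
    Forall (fun b => b < m) l -> In l L.
  { elim=> [|K [L hL]]; first by exists [[]] => -[|a l] //=; [left|lia].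
    exists ([] :: map (fun p => fst p :: snd p) (list_prod (seq 0 m) L)) => -[|a l] /= hl; first by left.
    move=> /Forall_cons_iff [h1 h2]; right; apply/in_map_iff; exists (a, l); split=> //.
    by apply/in_prod_iff; split; [apply/in_seq; lia|apply: hL => //; lia]. }
  have fin : Fin (VF lim).
  { have [L hL] := bounded N.
    have [l hl] := list_preimage (fun p : VF lim => proj1_sig p) (VF_eq lim) L.
    exists l => -[p hp]; apply: hl => /=; have [h1 [_ h3]] := hp; apply: hL => //.
    case: p hp h1 h3 => [|a t] _ _ /= h3; first by lia.
    by have := h3 ltac:(done); rewrite /lim Nat.ltb_lt; lia. }
  apply: (residual_by_hom (rhoF lim lim_mono) g (rhoF_hom lim lim_mono) (Fin_Sym fin)) => e.
  have triv p : actF lim lim_mono g p = p by rewrite /actF e.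
  have hw : okF lim (proj1_sig w).
  { have [h1 [h2 _]] := proj2_sig w; split=> //; split=> // _.
    by rewrite /lim Nat.ltb_lt /N; case: (proj1_sig w) => //= *; lia. }
  have w0 : proj1_sig w = [].
  { have := triv (rootF lim); rewrite eg actFM inU_root; last by exists i.
    by rewrite (realF_act lim lim_mono (exist _ _ hw)) => -[]. }
  rewrite w0 /= gmul_1l in eg; apply: hg.
  have ok0 : okF lim [0].
  { by split; [constructor; [lia|constructor]|split=> //; constructor]. }
  apply: (inU_free lim lim_mono g (exist _ [0] ok0)) => //.
  by rewrite eg; exists i.
Qed.

(** * Automorphisms of F *)

Section Out.
Hypothesis m_odd : exists k, m = S (2 * k).

(** By [len_gpow], [g root] and [g^-1 root] lie in one direction, and conjugating by a step [r] that
    way shortens [g] by two. At displacement one, [g] inverts an edge, so [g ** g] is trivial, and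
    as [m] is odd so is [g]. *)
Lemma torsion_conj n : forall g, lenF g <= n -> gpow g m = \1 -> exists y, inU (conjg y g).
Proof.
  elim: n => [|n IH] g hl ht.
  { by exists \1; rewrite conjg1; apply/lenF0; lia. }
  case: (Nat.eq_0_gt_0_cases (lenF g)) => l0.
  { by exists \1; rewrite conjg1; apply/lenF0. }
  case: (classic (hdv (act g^-1 root : treeF) = hdv (act g (root : treeF)))) => hh; last first.
  { have := len_gpow act actF_rooted g hh m; rewrite ht.
    have -> : lenF \1 = 0 by apply/lenF0; apply: inU1.
    by nia. }
  have [r er] := treeF_trans (hdv (act g (root : treeF))).
  have lr : lenF r = 1 by rewrite /len er dep_hd.
  case: (le_lt_dec (lenF g) 1) => l1.
  { exfalso; have l1' : lenF g = 1 by lia.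
    have e : act g^-1 (rootF nolim) = act g (rootF nolim).
    { rewrite -(hd_dep1 (act g (root : treeF)) l1') -hh hd_dep1 //.
      by rewrite -/(lenF g^-1) (lenV act actF_rooted). }
    have e2 : act (g ** g) (rootF nolim) = rootF nolim by rewrite actFM -e (actKV act actF_rooted).
    have sq : g ** g = \1.
    { apply: (inU_free nolim nolim_mono _ (act g (rootF nolim))).
      - exact: stab_root.
      - by move=> /stab_root /lenF0; lia.
      - by rewrite -actFM mulA actFM e2. }
    have [k ek] := m_odd; move: ht; rewrite ek /=.
    have -> : k + (k + 0) = k * 2 by lia.
    rewrite gpowM /= mul1r sq gpow1 mul1r => g1.
    by move: l0; rewrite g1; have -> : lenF \1 = 0 by [apply/lenF0; apply: inU1]; lia. }
  have [ls hs] := len_split act actF_rooted r g lr l0 (eq_sym er).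
  have hs' := hs l1; set g1 := r^-1 ** g in ls hs'.
  have eg : g^-1 = g1^-1 ** r^-1 by rewrite /g1; grp.
  have [|_ hd1] := len_mul act actF_rooted g1^-1 r^-1.
  { left; rewrite invK (hd_dep1 (act r^-1 (root : treeF))) //.
    by rewrite -/(lenF r^-1) (lenV act actF_rooted). }
  rewrite -eg (lenV act actF_rooted) ls in hd1.
  have hd2 : hdv (act g1^-1 (root : treeF)) = act r root by rewrite -hd1; [rewrite hh|lia].
  have lg1 : 0 < lenF g1^-1 by rewrite (lenV act actF_rooted); lia.
  have [ls2 _] := len_split act actF_rooted r g1^-1 lr lg1 hd2.
  have [y hy] : exists y, inU (conjg y (conjg r^-1 g)).
  { apply: IH; last by rewrite -(hom_pow _ (conjg_hom _)) ht (hom1 (conjg_hom _)).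
    have -> : conjg r^-1 g = (r^-1 ** g1^-1)^-1 by rewrite /conjg /g1; grp.
    by rewrite (lenV act actF_rooted) ls2 (lenV act actF_rooted); lia. }
  by exists (y ** r^-1); rewrite conjgM.
Qed.

Lemma lenF_mulU a x b : inU a -> inU b -> lenF (a ** x ** b) = lenF x.
Proof.
  move=> ha hb; rewrite /len actFM (inU_root nolim nolim_mono b) //.
  rewrite actFM; exact: (proj1 (act_fix_hd act actF_rooted a _ (inU_root _ _ a ha))).
Qed.

Lemma len1_form r : lenF r = 1 -> exists b j, r = gpow uF b ** vF ** gpow uF j.
Proof.
  move=> lr; have [x [[j ->]]] := realF_nf r (rootF nolim); rewrite /= mul1r => ->.
  move: lr; rewrite /len /root /=; case: (proj1_sig _) => [|b [|c t]] //= _.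
  by exists b, j; rewrite mul1r.
Qed.

(** [psi u] is torsion, so after conjugation [inU] is preserved. Since [inU] acts freely on the
    edges at the root, an injective map cannot fold two of them. Evaluating [len_scale] at the
    preimage of [v] shows that the image of [v] has displacement 1, and such elements have the
    stated form. *)
Lemma FF_out_finite (psi psi' : FF -> FF) : hom psi ->
  (forall x, psi' (psi x) = x) -> (forall x, psi (psi' x) = x) ->
  exists y a i j, a < m /\ i < m /\ j < m /\
    conjg y (psi uF) = gpow uF a /\ conjg y (psi vF) = gpow uF i ** vF ** gpow uF j.
Proof.
  move=> hp pK pK'.
  have [y [a ea]] : exists y, inU (conjg y (psi uF)).
  { apply: (torsion_conj _ _ (le_n _)).
    by rewrite -(hom_pow _ hp) uF_pow (hom1 hp). }
  pose th x := conjg y (psi x).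
  have hth : hom th by apply: hom_comp hp (conjg_hom y).
  have thE x : th x = conjg y (psi x) by [].
  clearbody th.
  have thK x : psi' (conjg y^-1 (th x)) = x by rewrite thE conjgVK pK.
  have th_inj x x' : th x = th x' -> x = x' by move=> e; rewrite -(thK x) e thK.
  have thK' x : th (psi' (conjg y^-1 x)) = x by rewrite thE pK' conjgK.
  have thU x : inU x -> inU (th x).
  { by move=> [i ->]; rewrite (hom_pow _ hth) thE ea; exists (i * a); rewrite gpowM. }
  have sU : ~ inU (th vF).
  { move=> hs; apply: vF_notU; rewrite -(thK' vF).
    move: (psi' _); apply: FF_ind.
    - by rewrite (hom1 hth); apply: inU1.
    - by move=> x x' h h'; rewrite hth; apply: inUM.
    - by move=> x h; rewrite (homV hth); apply: inUV.
    - by apply: thU; exists 1; rewrite /= mul1r.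
    - by []. }
  have pos : 0 < lenF (th vF) by case: (Nat.eq_0_gt_0_cases (lenF (th vF))) => // /lenF0.
  have lv : lenF vF = 1 by rewrite /len /root /= act_v_root.
  have U0 g : lenF g = 0 -> lenF (th g) = 0 by move=> /lenF0 /thU /lenF0.
  have th1 b j : inU (th (gpow uF b)) /\ inU (th (gpow uF j)) by split; apply: thU; [exists b|exists j].
  have scale : forall g, lenF (th g) = lenF g * lenF (th vF).
  { apply: (len_scale act actF_rooted treeF_trans) => //.
    - by move=> r /len1_form [b [j ->]]; rewrite !hth lenF_mulU //; apply th1.
    - move=> r r' /len1_form [b [j ->]] /len1_form [b' [j' ->]].
      change (@root treeF) with (rootF nolim).
      have red c k : hdv (act (th (gpow uF c ** vF ** gpow uF k)) (rootF nolim)) =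
        act (th (gpow uF c)) (hdv (act (th vF) (rootF nolim))).
      { rewrite !hth !actFM (inU_root nolim nolim_mono (th (gpow uF k))); last by apply th1.
        by apply: (proj2 (act_fix_hd act actF_rooted _ _ _)); apply: inU_root; apply th1. }
      have redr c k : act (gpow uF c ** vF ** gpow uF k) (rootF nolim) =
        act (gpow uF c ** vF) (rootF nolim).
      { by rewrite actFM (inU_root nolim nolim_mono (gpow uF k)) //; exists k. }
      rewrite !red !redr => e.
      have e1 : (th (gpow uF b))^-1 ** th (gpow uF b') = \1.
      { apply: (inU_free nolim nolim_mono _ (hdv (act (th vF) (rootF nolim)))).
        - by apply: inUM; [apply: inUV|]; apply th1.
        - by apply: dep_pos_neq; rewrite dep_hd //; lia.
        - by rewrite actFM -e (actK act actF_rooted). }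
      congr (act (_ ** _) _); apply: th_inj; apply: (@mulI _ (th (gpow uF b))^-1).
      by rewrite e1 gmul_Vl. }
  have k1 : lenF (th vF) = 1.
  { have := scale (psi' (conjg y^-1 vF)); rewrite thK' lv => e.
    by case: (proj1 (Nat.eq_mul_1 _ _) (eq_sym e)). }
  have [i [j e]] := len1_form _ k1.
  have mm k : k mod m < m by apply: Nat.mod_upper_bound; lia.
  exists y, (a mod m), (i mod m), (j mod m); rewrite -!uF_mod; do 3 (split; first exact: mm).
  by split; [|rewrite -thE].
Qed.
End Out.
End FreeProduct.

(** * HNN extensions of Q x F and their trees *)

(* The group generated by the commuting groups Q and F = FF m and by letters tj j subject to
   x (tj j) = c(x, j) (tj (x.j)) x: an HNN extension of Q x F with stable letter tj o. *)
Record Ext (Q : Grp) (m : nat) := {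
  EG :> Grp;
  EJ : Type;
  pj : FF m -> EJ -> EJ;
  cc : FF m -> EJ -> Q;
  iQ : Q -> EG;
  iF : FF m -> EG;
  tj : EJ -> EG;
  rF : EG -> FF m;
  pj1 : forall j, pj \1 j = j;
  pjM : forall x y j, pj (x ** y) j = pj x (pj y j);
  ccM : forall x y j, cc (x ** y) j = cc y j ** cc x (pj y j);
  iQ_hom : hom iQ;
  iF_hom : hom iF;
  rF_hom : hom rF;
  iQF : forall q x, commute (iQ q) (iF x);
  tt_rel : forall x j, iF x ** tj j = iQ (cc x j) ** tj (pj x j) ** iF x;
  rF_Q : forall q, rF (iQ q) = \1;
  rF_F : forall x, rF (iF x) = x;
  rF_t : forall j, rF (tj j) = \1;
  EG_ind : forall P : EG -> Prop, P \1 -> (forall g h, P g -> P h -> P (g ** h)) ->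
    (forall g, P g -> P g^-1) -> (forall q, P (iQ q)) -> (forall x, P (iF x)) ->
    (forall j, P (tj j)) -> forall g, P g;
  EG_hom : forall (H : Grp) (a : Q -> H) (b : FF m -> H) (s : EJ -> H), hom a -> hom b ->
    (forall q x, commute (a q) (b x)) ->
    (forall x j, b x ** s j = a (cc x j) ** s (pj x j) ** b x) ->
    exists f : EG -> H, hom f /\ (forall q, f (iQ q) = a q) /\
      (forall x, f (iF x) = b x) /\ (forall j, f (tj j) = s j)
}.
Arguments EJ {Q m}. Arguments pj {Q m e}. Arguments cc {Q m e}. Arguments iQ {Q m e}.
Arguments iF {Q m e}. Arguments tj {Q m e}. Arguments rF {Q m e}.
Arguments pj1 {Q m}. Arguments pjM {Q m}. Arguments ccM {Q m}. Arguments iQ_hom {Q m}.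
Arguments iF_hom {Q m}. Arguments rF_hom {Q m}. Arguments iQF {Q m}. Arguments tt_rel {Q m}.
Arguments rF_Q {Q m}. Arguments rF_F {Q m}. Arguments rF_t {Q m}. Arguments EG_ind {Q m}.
Arguments EG_hom {Q m}.

Section ExtTree.
Context {Q : Grp} {m : nat} (D : Ext Q m).
Local Notation F := (FF m).
Local Notation J := (EJ D).
Implicit Types (q b : Q) (x y : F) (j : J) (g : D).

Lemma cc1 j : cc \1 j = \1.
Proof.
  have := ccM D \1 \1 j; rewrite gmul_1l pj1 => e.
  by apply: (@mulI _ (cc \1 j)); rewrite -e mul1r.
Qed.
Lemma pjK x j : pj x^-1 (pj x j) = j.
Proof. by rewrite -pjM gmul_Vl pj1. Qed.
Lemma pjKV x j : pj x (pj x^-1 j) = j.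
Proof. by rewrite -pjM mulVr pj1. Qed.
Lemma pj_inj x i j : pj x i = pj x j -> i = j.
Proof. by move=> e; rewrite -(pjK x i) e pjK. Qed.

(** Cosets of [Q x F] in [D] are cosets of Q in the free product of Q and the free group on the
    [t_j]. A syllable [(b, (j, e))] stands for [b t_j] or [b t_j^-1], and a list for the coset of
    its product. *)
Definition syl : Type := Q * (J * bool).
Definition back (s : syl) : syl := (\1, (fst (snd s), negb (snd (snd s)))).

Fixpoint okG (l : list syl) : Prop :=
  match l with
  | [] => True
  | s :: t => hd_error t <> Some (back s) /\ okG t
  end.

(** With [c = cc x j], the element [x] moves to the right by [x t_j = c t_(x j) x] and
    [x t_j^-1 = t_(x j)^-1 c^-1 x]; in the second case [c^-1] lands on the next syllable. *)
Fixpoint actA (q : Q) (x : F) (l : list syl) : list syl :=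
  match l with
  | [] => []
  | (b, (j, true)) :: t => (q ** b ** cc x j, (pj x j, true)) :: actA \1 x t
  | (b, (j, false)) :: t => (q ** b, (pj x j, false)) :: actA (cc x j)^-1 x t
  end.

Lemma actAM q q' x x' l : actA q x (actA q' x' l) = actA (q ** q') (x ** x') l.
Proof.
  elim: l q q' => [|[b [j []]] t IH] q q' //=.
  - by rewrite IH gmul_1l ccM pjM !mulA.
  - by rewrite IH ccM pjM invM !mulA.
Qed.

Lemma actA1 l : actA \1 \1 l = l.
Proof.
  by elim: l => [|[b [j []]] t IH] //=; rewrite cc1 pj1 ?inv1 IH ?mul1r gmul_1l.
Qed.

Lemma actA_back q x b j e t : hd_error t <> Some (back (b, (j, e))) ->
  hd_error (actA (if e then \1 else (cc x j)^-1) x t) <> Some (back (b, (pj x j, e))).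
Proof.
  rewrite /back /=; case: t => [|[b' [j' e']] t] // h; case: e e' h => -[] //= h [] h1 h2.
  - by apply: h; move/pj_inj: h2 => ->; move: h1; rewrite gmul_1l => ->.
  - have ej := pj_inj _ _ _ h2; subst j'; apply: h; congr (Some (_, _)).
    apply: (@mulI _ (cc x j)^-1); apply: (@mulIr _ (cc x j)).
    by rewrite h1 mul1r gmul_Vl.
Qed.

Lemma actA_ok q x l : okG l -> okG (actA q x l).
Proof.
  elim: l q => [|[b [j e]] t IH] q // [h1 h2].
  have := actA_back q x b j e t h1.
  by case: e {h1} => h /=; split=> //; apply: IH.
Qed.

Lemma actA_removelast q x l : removelast (actA q x l) = actA q x (removelast l).
Proof.
  elim: l q => [|[b [j e]] t IH] q //.
  case: t IH => [|s t] IH; first by case: e.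
  have nz q' : actA q' x (s :: t) <> [] by case: s {IH} => ? [? []].
  rewrite (removelast_cons _ (s :: t)) //; case: e.
  - change (removelast ((q ** b ** cc x j, (pj x j, true)) :: actA \1 x (s :: t)) =
      (q ** b ** cc x j, (pj x j, true)) :: actA \1 x (removelast (s :: t))).
    by rewrite removelast_cons // IH.
  - change (removelast ((q ** b, (pj x j, false)) :: actA (cc x j)^-1 x (s :: t)) =
      (q ** b, (pj x j, false)) :: actA (cc x j)^-1 x (removelast (s :: t))).
    by rewrite removelast_cons // IH.
Qed.

Definition push (j : J) (e : bool) (l : list syl) : list syl :=
  match excluded_middle_informative (hd_error l = Some (back (\1, (j, e)))) with
  | left _ => tl l
  | right _ => (\1, (j, e)) :: l
  end.

Lemma push_pop j e t : push j e ((\1, (j, negb e)) :: t) = t.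
Proof. by rewrite /push; case: excluded_middle_informative => // -[]. Qed.
Lemma push_cons j e l : hd_error l <> Some (back (\1, (j, e))) -> push j e l = (\1, (j, e)) :: l.
Proof. by rewrite /push; case: excluded_middle_informative. Qed.
Lemma back_inv l j e : hd_error l = Some (back (\1, (j, e))) -> exists t, l = (\1, (j, negb e)) :: t.
Proof. by case: l => // s t [->]; exists t. Qed.
Lemma push_ok j e l : okG l -> okG (push j e l).
Proof.
  move=> hl; case: (classic (hd_error l = Some (back (\1, (j, e))))) => h.
  - by have [t et] := back_inv _ _ _ h; subst l; rewrite push_pop; case: hl.
  - by rewrite push_cons.
Qed.
Lemma pushK j e l : okG l -> push j (negb e) (push j e l) = l.
Proof.
  move=> hl; case: (classic (hd_error l = Some (back (\1, (j, e))))) => h.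
  - have [t et] := back_inv _ _ _ h; subst l; rewrite push_pop push_cons //; by case: hl.
  - by rewrite (push_cons j e l) // -{2}(Bool.negb_involutive e) push_pop.
Qed.

Lemma actA_push x j l :
  actA \1 x (push j true l) = actA (cc x j) \1 (push (pj x j) true (actA \1 x l)).
Proof.
  case: (classic (hd_error l = Some (back (\1, (j, true))))) => h.
  - have [t et] := back_inv _ _ _ h; subst l; rewrite push_pop /= gmul_1l.
    by rewrite (push_pop _ true) actAM gmul_1l mulVr.
  - rewrite !push_cons //=; first by rewrite actAM !gmul_1l cc1 pj1 !mul1r.
    have := actA_back \1 x \1 j true l h; exact.
Qed.

Definition VG : Type := {l : list syl | okG l}.
Lemma VG_eq (p p' : VG) : proj1_sig p = proj1_sig p' -> p = p'.
Proof. by case: p p' => l h [l' h'] /= e; subst l'; rewrite (proof_irrelevance _ h h'). Qed.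

Definition permA (q : Q) (x : F) : Sym VG.
Proof.
  refine {| pfun := fun p : VG => exist _ _ (actA_ok q x _ (proj2_sig p)) : VG;
            pbk := fun p : VG => exist _ _ (actA_ok q^-1 x^-1 _ (proj2_sig p)) : VG |} => p;
  by apply: VG_eq; rewrite /= actAM ?gmul_Vl ?mulVr actA1.
Defined.

Definition permT (j : J) : Sym VG.
Proof.
  refine {| pfun := fun p : VG => exist _ _ (push_ok j true _ (proj2_sig p)) : VG;
            pbk := fun p : VG => exist _ _ (push_ok j false _ (proj2_sig p)) : VG |} => p.
  - by apply: VG_eq; apply: (pushK j true); apply: (proj2_sig p).
  - by apply: VG_eq; apply: (pushK j false); apply: (proj2_sig p).
Defined.

Lemma rhoG_ex : exists f : D -> Sym VG, hom f /\ (forall q, f (iQ q) = permA q \1) /\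
  (forall x, f (iF x) = permA \1 x) /\ (forall j, f (tj j) = permT j).
Proof.
  apply: EG_hom.
  - by move=> q q'; apply: perm_eq => p; apply: VG_eq; rewrite /= actAM gmul_1l.
  - by move=> x x'; apply: perm_eq => p; apply: VG_eq; rewrite /= actAM gmul_1l.
  - by move=> q x; apply: perm_eq => p; apply: VG_eq; rewrite /= !actAM !gmul_1l !mul1r.
  - by move=> x j; apply: perm_eq => p; apply: VG_eq; rewrite /= actA_push.
Qed.

Definition rhoG : D -> Sym VG := proj1_sig (constructive_indefinite_description _ rhoG_ex).
Lemma rhoG_spec : hom rhoG /\ (forall q, rhoG (iQ q) = permA q \1) /\
  (forall x, rhoG (iF x) = permA \1 x) /\ (forall j, rhoG (tj j) = permT j).
Proof. exact: (proj2_sig (constructive_indefinite_description _ rhoG_ex)). Qed.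

Definition act (g : D) (p : VG) : VG := pfun (rhoG g) p.
Lemma aact1 p : act \1 p = p.
Proof. by rewrite /act (hom1 (proj1 rhoG_spec)). Qed.
Lemma aactM g h p : act (g ** h) p = act g (act h p).
Proof. by rewrite /act (proj1 rhoG_spec). Qed.
Lemma act_A q x p : proj1_sig (act (iQ q ** iF x) p) = actA q x (proj1_sig p).
Proof.
  have [h [hq [hx _]]] := rhoG_spec.
  by rewrite /act h hq hx /= actAM gmul_1l mul1r.
Qed.
Lemma act_Q q p : proj1_sig (act (iQ q) p) = actA q \1 (proj1_sig p).
Proof. by rewrite -act_A (hom1 (iF_hom D)) mul1r. Qed.
Lemma act_F x p : proj1_sig (act (iF x) p) = actA \1 x (proj1_sig p).
Proof. by rewrite -act_A (hom1 (iQ_hom D)) gmul_1l. Qed.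
Lemma act_t j p : proj1_sig (act (tj j) p) = push j true (proj1_sig p).
Proof. by have [_ [_ [_ h]]] := rhoG_spec; rewrite /act h. Qed.
Lemma act_tV j p : proj1_sig (act (tj j)^-1 p) = push j false (proj1_sig p).
Proof. by have [h [_ [_ e]]] := rhoG_spec; rewrite /act (homV h) e. Qed.

Definition rootG : VG := exist _ [] I.

Lemma okG_removelast l : okG l -> okG (removelast l).
Proof.
  elim: l => // s [|s' t] IH //; rewrite removelast_cons // => -[h1 h2]; split; last exact: IH.
  by case: t h1 {IH h2} => //= s'' t h1; case: t.
Qed.

Definition parG (p : VG) : VG := exist _ _ (okG_removelast _ (proj2_sig p)).
Lemma length_parG (p : VG) : p <> rootG -> length (proj1_sig p) = S (length (proj1_sig (parG p))).
Proof. by case: p => l hl hr /=; apply: removelast_length => e; apply: hr; apply: VG_eq. Qed.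
Definition treeG : RootedTree :=
  Build_RootedTree VG rootG parG (fun p => length (proj1_sig p)) eq_refl length_parG.
Canonical treeG.

Lemma treeG_nil (p : VG) : p <> rootG <-> proj1_sig p <> [].
Proof. by split=> h e; apply: h; [apply: VG_eq|rewrite e]. Qed.

Lemma treeG_adj (p p' : treeG) : radj p p' <->
  (proj1_sig p' <> [] /\ removelast (proj1_sig p') = proj1_sig p) \/
  (proj1_sig p <> [] /\ removelast (proj1_sig p) = proj1_sig p').
Proof.
  split; case=> -[/treeG_nil h1 h2]; [left|right|left|right]; split=> //.
  - by rewrite -h2.
  - by rewrite -h2.
  - exact: VG_eq.
  - exact: VG_eq.
Qed.

Lemma push_adj j e l : l <> [] ->
  (push j e l <> [] /\ removelast (push j e l) = push j e (removelast l)) \/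
  (push j e (removelast l) <> [] /\ removelast (push j e (removelast l)) = push j e l).
Proof.
  move=> hl; case: (classic (hd_error l = Some (back (\1, (j, e))))) => h.
  - have [t et] := back_inv _ _ _ h; subst l; rewrite push_pop.
    case: t {hl h} => [|s t]; first by right; rewrite push_cons.
    by left; rewrite (removelast_cons _ (s :: t)) // push_pop.
  - left; rewrite !push_cons //; first by rewrite removelast_cons.
    by case: l hl h => // s [|s' t].
Qed.

Lemma act_rooted : rooted_action treeG act.
Proof.
  split; [exact: aact1|exact: aactM|].
  have key g : (forall u v : treeG, proj1_sig v <> [] -> removelast (proj1_sig v) = proj1_sig u ->
     radj (act g u : treeG) (act g v)) -> forall u v : treeG, radj u v -> radj (act g u : treeG) (act g v).
  { by move=> h u v /treeG_adj [[h1 h2]|[h1 h2]]; [|apply: radj_sym]; apply: h. }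
  suff: forall g, (forall u v : treeG, radj u v -> radj (act g u : treeG) (act g v)) /\
    (forall u v : treeG, radj u v -> radj (act g^-1 u : treeG) (act g^-1 v)).
  { by move=> h g; case: (h g). }
  have hA q x : forall u v : treeG, radj u v -> radj (act (iQ q ** iF x) u : treeG) (act (iQ q ** iF x) v).
  { apply: key => u v h1 h2; apply/treeG_adj; left; rewrite !act_A -h2 actA_removelast; split=> //.
    by case: (proj1_sig v) h1 => [|[b [j []]] t]. }
  apply: EG_ind.
  - by rewrite inv1; split=> u v; rewrite !aact1.
  - move=> x y [h1 h2] [h3 h4]; split=> u v huv.
    + by rewrite !aactM; apply: h1; apply: h3.
    + by rewrite invM !aactM; apply: h4; apply: h2.
  - by move=> x [h1 h2]; rewrite invK.
  - move=> q; have hq q' : forall u v : treeG, radj u v -> radj (act (iQ q') u : treeG) (act (iQ q') v).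
    { by move=> u v; rewrite -(mul1r (iQ q')) -(hom1 (iF_hom D)); apply: hA. }
    by split; [|rewrite -(homV (iQ_hom D))]; apply: hq.
  - move=> x; have hx x' : forall u v : treeG, radj u v -> radj (act (iF x') u : treeG) (act (iF x') v).
    { by move=> u v; rewrite -(gmul_1l _ (iF x')) -(hom1 (iQ_hom D)); apply: hA. }
    by split; [|rewrite -(homV (iF_hom D))]; apply: hx.
  - move=> j; split; apply: key => u v h1 h2; apply/treeG_adj; rewrite ?act_t ?act_tV -h2;
      exact: push_adj.
Qed.

Fixpoint real (l : list syl) : D :=
  match l with
  | [] => \1
  | (b, (j, e)) :: t => iQ b ** (if e then tj j else (tj j)^-1) ** real t
  end.

Definition inA (g : D) : Prop := exists q x, g = iQ q ** iF x.
Lemma inA1 : inA \1.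
Proof. by exists \1, \1; rewrite (hom1 (iQ_hom D)) (hom1 (iF_hom D)) mul1r. Qed.
Lemma inAM g h : inA g -> inA h -> inA (g ** h).
Proof.
  move=> [q [x ->]] [q' [x' ->]]; exists (q ** q'), (x ** x').
  rewrite iQ_hom iF_hom !mulA; congr (_ ** _); rewrite -!mulA; congr (_ ** _).
  by symmetry; apply: iQF.
Qed.
Lemma inA_Q q : inA (iQ q). Proof. by exists q, \1; rewrite (hom1 (iF_hom D)) mul1r. Qed.
Lemma inA_F x : inA (iF x). Proof. by exists \1, x; rewrite (hom1 (iQ_hom D)) gmul_1l. Qed.
Lemma inAV g : inA g -> inA g^-1.
Proof.
  move=> [q [x ->]]; rewrite invM -(homV (iF_hom D)) -(homV (iQ_hom D)).
  by apply: inAM; [apply: inA_F|apply: inA_Q].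
Qed.

Lemma tt_relV x j : iF x ** (tj j)^-1 = (tj (pj x j))^-1 ** iQ (cc x j)^-1 ** iF x :> D.
Proof.
  apply: (@mulIr _ (tj j)); apply: (@mulI _ (iQ (cc x j) ** tj (pj x j))).
  rewrite [RHS]mulA [in RHS]mulA tt_rel (homV (iQ_hom D)) [LHS]mulA.
  by rewrite -tt_rel; grp; rewrite tt_rel; grp.
Qed.

Lemma A_real q x l : exists a, inA a /\ iQ q ** iF x ** real l = real (actA q x l) ** a.
Proof.
  elim: l q => [|[b [j e]] t IH] q.
  { exists (iQ q ** iF x); split; last by rewrite /= mul1r gmul_1l.
    by exists q, x. }
  have swap : iQ q ** iF x ** iQ b = iQ (q ** b) ** iF x :> D.
  { by rewrite mulA -(iQF D b x) -mulA -iQ_hom. }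
  case: e => /=.
  - have [a [ha ea]] := IH \1; exists a; split=> //.
    rewrite (hom1 (iQ_hom D)) gmul_1l in ea.
    rewrite [RHS]mulA -ea.
    have -> : iQ q ** iF x ** (iQ b ** tj j ** real t) = (iQ q ** iF x ** iQ b) ** tj j ** real t by grp.
    by rewrite swap (mulA (iQ (q ** b))) tt_rel (iQ_hom D (q ** b)); grp.
  - have [a [ha ea]] := IH (cc x j)^-1; exists a; split=> //.
    rewrite [RHS]mulA -ea.
    have -> : iQ q ** iF x ** (iQ b ** (tj j)^-1 ** real t) =
      (iQ q ** iF x ** iQ b) ** (tj j)^-1 ** real t by grp.
    by rewrite swap (mulA (iQ (q ** b))) tt_relV; grp.
Qed.

(** Existence of normal forms again; at the root it identifies the stabilizer with [Q x F] and
    writes [g] as a reduced word times an element of [Q x F]. *)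
Lemma real_nf g (p : VG) : exists a, inA a /\ g ** real (proj1_sig p) = real (proj1_sig (act g p)) ** a.
Proof.
  move: g p; apply: EG_ind.
  - by move=> p; exists \1; split; [apply: inA1|rewrite aact1 gmul_1l mul1r].
  - move=> x y hx hy p; have [a [ha ea]] := hy p; have [b [hb eb]] := hx (act y p).
    exists (b ** a); split; first exact: inAM.
    by rewrite aactM mulA ea -[LHS]mulA eb mulA.
  - move=> x hx p; have [a [ha ea]] := hx (act x^-1 p).
    exists a^-1; split; first exact: inAV.
    rewrite -aactM mulVr aact1 in ea.
    by apply: (@mulIr _ a); apply: (@mulI _ x); rewrite !mulA gmul_Vl mul1r ea mulKV.
  - move=> q p; have := A_real q \1 (proj1_sig p).
    by rewrite (hom1 (iF_hom D)) mul1r act_Q.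
  - move=> x p; have := A_real \1 x (proj1_sig p).
    by rewrite (hom1 (iQ_hom D)) gmul_1l act_F.
  - move=> j p; exists \1; split; first exact: inA1.
    rewrite act_t mul1r; case: (classic (hd_error (proj1_sig p) = Some (back (\1, (j, true))))) => h.
    + have [t ->] := back_inv _ _ _ h; rewrite push_pop /= (hom1 (iQ_hom D)).
      by grp.
    + by rewrite push_cons //= (hom1 (iQ_hom D)) gmul_1l.
Qed.

Lemma real_act (p : VG) : act (real (proj1_sig p)) rootG = p.
Proof.
  case: p => l hl; elim: l hl => [|[b [j e]] t IH] hl /=; first by rewrite aact1; apply: VG_eq.
  have [h1 h2] := hl.
  apply: VG_eq; rewrite !aactM (IH h2) act_Q.
  by case: e hl h1 => hl h1; rewrite ?act_t ?act_tV push_cons //= cc1 pj1 ?inv1 actA1 ?mul1r.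
Qed.

Lemma treeG_trans (p : treeG) : exists g, act g (root : treeG) = p.
Proof. by exists (real (proj1_sig p)); apply: real_act. Qed.

Lemma inA_root g : inA g -> act g rootG = rootG.
Proof. by move=> [q [x ->]]; apply: VG_eq; rewrite act_A. Qed.

Lemma root_inA g : act g rootG = rootG -> inA g.
Proof. by move=> e; have [a [ha]] := real_nf g rootG; rewrite e /= mul1r gmul_1l => ->. Qed.

(** [q] multiplies the first coefficient on the left and changes nothing else. *)
Lemma Q_free q (p : VG) : p <> rootG -> act (iQ q) p = p -> q = \1.
Proof.
  move=> hp /(f_equal (@proj1_sig _ _)); rewrite act_Q; move/treeG_nil: hp.
  case: (proj1_sig p) => [|[b [j []]] t] //= _ [e _ _]; apply: (@mulIr _ b); rewrite gmul_1l //.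
  by rewrite -[RHS]e cc1 mul1r.
Qed.

Lemma okG_single (s : syl) : okG [s].
Proof. by []. Qed.
Definition edge (b : Q) (j : J) (e : bool) : VG := exist _ [(b, (j, e))] (okG_single _).

Lemma edge_inj b j e b' j' e' : edge b j e = edge b' j' e' -> b = b' /\ j = j' /\ e = e'.
Proof. by case=> -> -> ->. Qed.
Lemma edge_ex (p : treeG) : dep p = 1 -> exists b j e, p = edge b j e.
Proof.
  case: p => -[|[b [j e]] [|s t]] h //= _; exists b, j, e; exact: VG_eq.
Qed.
Lemma act_edge q x b j e : act (iQ q ** iF x) (edge b j e) =
  edge (if e then q ** b ** cc x j else q ** b) (pj x j) e.
Proof. by apply: VG_eq; rewrite act_A; case: e. Qed.
Lemma act_t_root j : act (tj j) rootG = edge \1 j true.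
Proof. by apply: VG_eq; rewrite act_t push_cons. Qed.
Lemma act_tV_root j : act (tj j)^-1 rootG = edge \1 j false.
Proof. by apply: VG_eq; rewrite act_tV push_cons. Qed.

Lemma iQ_inj q (j : J) : iQ q = \1 :> D -> q = \1.
Proof. by move=> e; apply: (Q_free q (edge \1 j true)) => //; rewrite e aact1. Qed.

(** The exponent sum in the [t_j]. Group elements shift it by a constant, while neighbouring
    vertices differ in it, so no edge is inverted. *)
Fixpoint height (l : list syl) : Z :=
  match l with [] => 0 | s :: t => (if snd (snd s) then 1 else -1) + height t end%Z.

Lemma height_actA q x l : height (actA q x l) = height l.
Proof. by elim: l q => // -[b [j []]] t IH q /=; rewrite IH. Qed.
Lemma height_push j l : height (push j true l) = (1 + height l)%Z.
Proof.
  case: (classic (hd_error l = Some (back (\1, (j, true))))) => h; last by rewrite push_cons.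
  have [t ->] := back_inv _ _ _ h; rewrite push_pop.
  by have -> : height ((\1, (j, negb true)) :: t) = (-1 + height t)%Z by []; lia.
Qed.
Lemma height_act g : exists n : Z, forall p : VG,
  height (proj1_sig (act g p)) = (n + height (proj1_sig p))%Z.
Proof.
  move: g; apply: EG_ind.
  - by exists 0%Z => p; rewrite aact1.
  - by move=> g h [n hn] [k hk]; exists (n + k)%Z => p; rewrite aactM hn hk; lia.
  - move=> g [n hn]; exists (- n)%Z => p.
    by have := hn (act g^-1 p); rewrite -aactM mulVr aact1; lia.
  - by move=> q; exists 0%Z => p; rewrite act_Q height_actA.
  - by move=> x; exists 0%Z => p; rewrite act_F height_actA.
  - by move=> j; exists 1%Z => p; rewrite act_t height_push.
Qed.
Lemma height_removelast l : l <> [] -> height l <> height (removelast l).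
Proof.
  elim: l => // s [|s' t] IH _; first by rewrite /=; case: (snd (snd s)); lia.
  rewrite removelast_cons //; have := IH ltac:(done).
  move: (s' :: t) (removelast _) => l l' h; rewrite [height (s :: l)]/= [height (s :: l')]/=; lia.
Qed.

Lemma no_swap g (p : treeG) : p <> root -> act g p = par p -> act g (par p) = p -> False.
Proof.
  move=> hp e1 e2; have [n hn] := height_act g.
  have h1 := hn p; have h2 := hn (par p); rewrite e1 in h1; rewrite e2 in h2.
  have := height_removelast (proj1_sig p) (proj1 (treeG_nil p) hp).
  by move: h1 h2; rewrite /par /=; lia.
Qed.

Lemma FA_fixed (P : Grp) (h : P -> D) : hom h -> PropertyFA P -> exists g, forall r, act (h r) (act g rootG) = act g rootG.
Proof.
  move=> hh FA.
  have A : rooted_action treeG (fun r => act (h r)).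
  { split=> [p|r r' p|r u v].
    - by rewrite (hom1 hh) aact1.
    - by rewrite hh aactM.
    - by apply: (act_adj _ act_rooted). }
  case: (FA_rooted treeG _ A FA) => -[p hp].
  - by have [g eg] := treeG_trans p; exists g => r; rewrite /root /= in eg; rewrite eg.
  - case: hp => hr hp; have [g eg] := treeG_trans p; exists g => r; rewrite /root /= in eg; rewrite eg.
    by case: (hp r) => -[e1 e2] //; case: (no_swap (h r) p hr).
Qed.
End ExtTree.

(** * Automorphisms of the extension *)

(* F_o is the stabilizer of o for the action pj, and cc restricts on it to an anti-homomorphism
   to Q; the two edge groups are F_o and its twist by cc. *)
Record Generic {Q : Grp} {m : nat} (D : Ext Q m) (o : EJ D) : Prop := {
  g_m2 : 2 < m;
  g_odd : exists k, m = S (2 * k);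
  g_inf : ~ Fin Q;
  g_fin : Fin (EJ D);
  g_trans : forall j, exists x, pj x o = j;
  g_u : pj (uF m) o = o;
  g_cu : cc (uF m) o = \1 :> Q;
  g_surj : forall q, exists x, pj x o = o /\ cc x o = q;
  g_pair : exists p y, pj p o = o /\ pj (y ** p ** y^-1) o = o /\
             cc p o = \1 :> Q /\ cc (y ** p ** y^-1) o <> \1 :> Q;
  g_ab : forall z : FF m -> Q, hom z -> (forall x y, commute (z x) (z y)) ->
    (forall x, pj x o = o -> z x = \1) -> forall x, z x = \1
}.

Section Automorphisms.
Context {Q : Grp} {m : nat} (D : Ext Q m) (o : EJ D) (C : Generic D o).
Local Notation F := (FF m).
Local Notation J := (EJ D).
Local Notation act := (act D).
Local Notation rt := (rootG D).
Local Notation inA := (inA D).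
Local Notation edge := (edge D).
Local Notation lenG := (@len (treeG D) D act).
Implicit Types (g : D).

Lemma nontrivial_Q : exists q : Q, q <> \1.
Proof.
  apply: NNPP => h; apply: (g_inf _ _ C); exists [\1] => q; left.
  by apply: NNPP => hq; apply: h; exists q => e; apply: hq.
Qed.

Lemma fix_root_of_Q q g : q <> \1 -> act (iQ q) (act g rt) = act g rt -> act g rt = rt.
Proof. by move=> hq e; apply: NNPP => h; apply: hq; apply: Q_free h e. Qed.

(** F permutes the indices transitively, so every [t_j] is [c^-1 x t_o x^-1] for suitable [x] in F
    and [c] in Q. *)
Lemma EG_ext (H : Grp) (f f' : D -> H) : hom f -> hom f' -> (forall q, f (iQ q) = f' (iQ q)) ->
  (forall x, f (iF x) = f' (iF x)) -> f (tj o) = f' (tj o) -> forall g, f g = f' g.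
Proof.
  move=> hf hf' eq ex et; apply: EG_ind => //.
  - by rewrite (hom1 hf) (hom1 hf').
  - by move=> g h e e'; rewrite hf hf' e e'.
  - by move=> g e; rewrite (homV hf) (homV hf') e.
  - move=> j; have [x <-] := g_trans _ _ C j.
    have e : tj (pj x o) = (iQ (cc x o))^-1 ** (iF x ** tj o) ** (iF x)^-1 :> D.
    { by rewrite tt_rel; grp. }
    by rewrite e !hf !hf' (homV hf) (homV hf') (homV hf) (homV hf') eq ex et.
Qed.

Lemma phi_ex (q : Q) : exists f : D -> D, hom f /\ (forall r, f (iQ r) = iQ r) /\
  (forall x, f (iF x) = iF x) /\ (forall j, f (tj j) = tj j ** iQ q).
Proof.
  apply: EG_hom; [exact: iQ_hom|exact: iF_hom|exact: iQF|].
  by move=> x j; rewrite -mulA tt_rel mulA -(iQF D q x); grp.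
Qed.
Definition phi (q : Q) : D -> D := proj1_sig (constructive_indefinite_description _ (phi_ex q)).
Lemma phi_spec q : hom (phi q) /\ (forall r, phi q (iQ r) = iQ r) /\
  (forall x, phi q (iF x) = iF x) /\ (forall j, phi q (tj j) = tj j ** iQ q).
Proof. exact: (proj2_sig (constructive_indefinite_description _ (phi_ex q))). Qed.

Lemma phiM q q' g : phi (q ** q') g = phi q (phi q' g).
Proof.
  have [h [hq [hx ht]]] := phi_spec (q ** q').
  have [h1 [hq1 [hx1 ht1]]] := phi_spec q; have [h2 [hq2 [hx2 ht2]]] := phi_spec q'.
  move: g; apply: EG_ext => //.
  - exact: hom_comp h2 h1.
  - by move=> r; rewrite hq hq2 hq1.
  - by move=> x; rewrite hx hx2 hx1.
  - by rewrite ht ht2 h1 ht1 hq1 iQ_hom mulA.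
Qed.

Lemma phi1 g : phi \1 g = g.
Proof.
  have [h [hq [hx ht]]] := phi_spec \1.
  by move: g; apply: EG_ext => //; rewrite ht (hom1 (iQ_hom D)) mul1r.
Qed.

Lemma phi_aut q : IsAut D (phi q).
Proof.
  split; first exact: (proj1 (phi_spec q)).
  by exists (phi q^-1); split=> x; rewrite -phiM ?gmul_Vl ?mulVr phi1.
Qed.

Lemma commute_iQ_root q g : q <> \1 -> commute g (iQ q) -> act g rt = rt.
Proof.
  move=> hq c; apply: (fix_root_of_Q q) => //.
  by rewrite -aactM -c aactM inA_root //; apply: inA_Q.
Qed.

Lemma F_center (y : F) : (forall x, commute y x) -> y = \1.
Proof. by move=> h; apply: (centralizer_trivial m (g_m2 _ _ C) (vF m)) => //; apply: (vF_notU m (g_m2 _ _ C)). Qed.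

Lemma phi_inj q : OutEq D (phi q) (fun x => x) -> q = \1.
Proof.
  move=> [h e]; have [pq [hq [hx ht]]] := phi_spec q.
  have [q1 hq1] := nontrivial_Q.
  have comm g : phi q g = g -> commute h g.
  { by rewrite e => e'; rewrite /commute -{2}e'; grp. }
  have [z [y eh]] : inA h by apply: root_inA; apply: (commute_iQ_root q1) => //; apply: comm.
  have y1 : y = \1.
  { apply: F_center => x; have := f_equal rF (comm _ (hx x)).
    by rewrite !rF_hom eh rF_hom rF_Q !rF_F gmul_1l. }
  rewrite y1 (hom1 (iF_hom D)) mul1r in eh.
  have := e (tj o); rewrite ht eh => e2.
  have e3 : tj o ** iQ q ** iQ z = iQ z ** tj o :> D by rewrite e2; grp.
  have := f_equal (fun g => act g rt) e3.
  rewrite mulA aactM inA_root; last by apply: inAM; apply: inA_Q.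
  rewrite aactM act_t_root -(mul1r (iQ z)) -(hom1 (iF_hom D)) act_edge (cc1 D) !mul1r (pj1 D).
  case/edge_inj=> z1 _; rewrite -z1 (hom1 (iQ_hom D)) gmul_1l !mul1r in e3.
  apply: (iQ_inj D q o); apply: (@mulI _ (tj o)); rewrite mul1r //.
Qed.

Record Stab (th th' : D -> D) : Prop := {
  s_hom : hom th;
  s_hom' : hom th';
  s_K : forall g, th' (th g) = g;
  s_K' : forall g, th (th' g) = g;
  s_A : forall a, inA a -> inA (th a);
  s_A' : forall a, inA a -> inA (th' a)
}.

Lemma Stab_sym th th' : Stab th th' -> Stab th' th.
Proof. by case=> *; split. Qed.

Lemma Stab_conj th th' a : inA a -> Stab th th' ->
  Stab (fun x => conjg a (th x)) (fun x => th' (conjg a^-1 x)).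
Proof.
  move=> ha [h h' k k' hA hA']; split.
  - exact: hom_comp h (conjg_hom a).
  - exact: hom_comp (conjg_hom a^-1) h'.
  - by move=> g; rewrite conjgVK k.
  - by move=> g; rewrite k' conjgK.
  - by move=> x /hA hx; apply: inAM; [apply: inAM|apply: inAV].
  - by move=> x hx; apply: hA'; apply: inAM; [apply: inAM => //; apply: inAV|do 2 apply: inAV].
Qed.

Lemma inA_rF g : inA g -> exists q, g = iQ q ** iF (rF g).
Proof. by move=> [q [x ->]]; exists q; rewrite rF_hom rF_Q rF_F gmul_1l. Qed.

Section FA.
Hypothesis FA : PropertyFA Q.

(* The image of Q in F is finite, so some nontrivial element of Q is sent into Q up to conjugation;
   it fixes a single vertex, which F must then fix as well. *)
Lemma A_elliptic (th : D -> D) : hom th -> (forall x y, th x = th y -> x = y) ->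
  exists g, forall a, inA a -> inA (conjg g^-1 (th a)).
Proof.
  move=> ht inj; have [g hg] := FA_fixed D Q (fun q => th (iQ q)) (hom_comp _ _ (iQ_hom D) ht) FA.
  exists g; pose t1 x := conjg g^-1 (th x).
  have ht1 : hom t1 by apply: hom_comp ht (conjg_hom _).
  have inj1 x y : t1 x = t1 y -> x = y.
  { by move=> e; apply: inj; rewrite -(conjgK g (th x)) -/(t1 x) e /t1 conjgK. }
  have tQ q : inA (t1 (iQ q)).
  { apply: root_inA; rewrite /t1 /conjg !aactM invK hg -aactM gmul_Vl aact1 //. }
  have hh : hom (fun q => rF (t1 (iQ q))).
  { by move=> q r; rewrite iQ_hom ht1 rF_hom. }
  have [q [hq eq]] : exists q, q <> \1 /\ rF (t1 (iQ q)) = \1.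
  { apply: NNPP => no; apply: (g_inf _ _ C).
    have [l hl] := FA_image_finite m (g_m2 _ _ C) FA _ hh.
    have [l' hl'] : exists l' : list Q, forall q, In (rF (t1 (iQ q))) l -> In q l'.
    { apply: (list_preimage (fun q => rF (t1 (iQ q)))) => q r e.
      apply: NNPP => hqr; apply: no; exists (q^-1 ** r); split.
      - by move=> e'; apply: hqr; rewrite -(mulKV q r) e' mul1r.
      - by rewrite hh (homV hh) e gmul_Vl. }
    by exists l' => q; apply: hl'. }
  have [q1 e1] := inA_rF _ (tQ q); rewrite eq (hom1 (iF_hom D)) mul1r in e1.
  have hq1 : q1 <> \1.
  { move=> e; apply: hq; apply: (iQ_inj D q o); apply: inj1.
    by rewrite e1 e (hom1 (iQ_hom D)) (hom1 ht1). }
  have tF x : inA (t1 (iF x)).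
  { apply: root_inA; apply: (commute_iQ_root q1) => //.
    by rewrite /commute -e1 -!ht1 iQF. }
  by move=> a [r [x ->]]; rewrite -/(t1 _) ht1; apply: inAM.
Qed.

(** [A_elliptic] only places the image of A = [Q x F] inside a conjugate of A. Applied to the
    inverse too, it yields [s] with [s^-1 A s] inside A. As a nontrivial element of Q fixes only the
    root, [s] lies in A, and the inclusion is an equality. *)
Lemma Stab_ex th th' : hom th -> hom th' -> (forall g, th' (th g) = g) -> (forall g, th (th' g) = g) ->
  exists g, Stab (fun x => conjg g (th x)) (fun x => th' (conjg g^-1 x)).
Proof.
  move=> h h' k k'.
  have [g hg] := A_elliptic th h (fun x y e => eq_trans (eq_sym (k x)) (eq_trans (f_equal th' e) (k y))).
  exists g^-1; rewrite invK.
  pose t x := conjg g^-1 (th x); pose t' x := th' (conjg g x).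
  have ht : hom t by apply: hom_comp h (conjg_hom _).
  have ht' : hom t' by apply: (hom_comp (conjg g) th') => //; apply: conjg_hom.
  have tK x : t' (t x) = x by rewrite /t /t' conjgK k.
  have tK' x : t (t' x) = x by rewrite /t /t' k' conjgVK.
  have [g2 hg2] := A_elliptic t' ht' (fun x y e => eq_trans (eq_sym (tK' x)) (eq_trans (f_equal t e) (tK' y))).
  pose s := t g2.
  have hs a : inA a -> inA (s^-1 ** a ** s).
  { move=> ha; have := hg _ (hg2 a ha); rewrite -/(t _) /conjg invK !ht tK' (homV ht) //. }
  have es : t' s = g2 by apply: tK.
  clearbody s.
  have s_inA : inA s.
  { have [q1 hq1] := nontrivial_Q; apply: root_inA; apply: (fix_root_of_Q q1) => //.
    have := inA_root D _ (hs _ (inA_Q D q1)); rewrite !aactM => e.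
    by rewrite -/s -{2}e -[RHS]aactM mulVr aact1. }
  split=> // a ha.
  have e : conjg g2^-1 (t' (s ** a ** s^-1)) = t' a.
  { by rewrite !ht' (homV ht') es /conjg; grp. }
  have := hg2 (s ** a ** s^-1) (inAM _ _ _ (inAM _ _ _ s_inA ha) (inAV _ _ s_inA)).
  by rewrite e.
Qed.

Section StabTheory.
Variables (th th' : D -> D).
Hypothesis S : Stab th th'.

Lemma th_inj x y : th x = th y -> x = y.
Proof. by move=> e; rewrite -(s_K _ _ S x) e (s_K _ _ S). Qed.

(** Q is normal in [Q x F], which [th] maps onto itself; so the image of Q in F is normal, and
    [FA_image_trivial] applies. *)
Lemma th_Q_trivial q : rF (th (iQ q)) = \1.
Proof.
  have hh : hom (fun q => rF (th (iQ q))) by move=> r r'; rewrite iQ_hom (s_hom _ _ S) rF_hom.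
  move: q; apply: (FA_image_trivial m (g_m2 _ _ C) FA _ hh) => x q.
  have [qa [xa ea]] := s_A' _ _ S _ (inA_F D x).
  (* [th' x] is [qa] times the element [xa] of F, and [xa] commutes with [q]. *)
  exists (qa ** q ** qa^-1).
  rewrite -{1 2}(rF_F D x) -(s_K' _ _ S (iF x)) ea -(homV (rF_hom D)) -!(rF_hom D) -(homV (s_hom _ _ S)) -!(s_hom _ _ S).
  do 2 congr (_ _); rewrite !iQ_hom (homV (iQ_hom D)) invM.
  by rewrite (mulA (iQ qa)) -(iQF D q xa); grp.
Qed.

Lemma beta_ex q : exists r, th (iQ q) = iQ r.
Proof.
  have [r e] := inA_rF _ (s_A _ _ S _ (inA_Q D q)).
  by exists r; rewrite e th_Q_trivial (hom1 (iF_hom D)) mul1r.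
Qed.
Definition beta q := proj1_sig (constructive_indefinite_description _ (beta_ex q)).
Lemma betaE q : th (iQ q) = iQ (beta q).
Proof. exact: (proj2_sig (constructive_indefinite_description _ (beta_ex q))). Qed.

Lemma iQ_inj2 q r : iQ q = iQ r :> D -> q = r.
Proof.
  move=> e; apply: (@mulI _ r^-1); rewrite gmul_Vl; apply: (iQ_inj D _ o).
  by rewrite iQ_hom (homV (iQ_hom D)) e gmul_Vl.
Qed.
Lemma beta_hom : hom beta.
Proof. by move=> q r; apply: iQ_inj2; rewrite -betaE !iQ_hom (s_hom _ _ S) !betaE. Qed.
Lemma beta_inj q : beta q = \1 -> q = \1.
Proof.
  move=> e; apply: (iQ_inj D q o); apply: th_inj.
  by rewrite betaE e (hom1 (iQ_hom D)) (hom1 (s_hom _ _ S)).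
Qed.

(** On [Q x F] the automorphism reads [q -> beta q] and [x -> zeta x * psi x]; the factor [zeta]
    will turn out central and then trivial. *)
Definition psi x := rF (th (iF x)).
Lemma zeta_ex x : exists q, th (iF x) = iQ q ** iF (psi x).
Proof. exact: inA_rF (s_A _ _ S _ (inA_F D x)). Qed.
Definition zeta x := proj1_sig (constructive_indefinite_description _ (zeta_ex x)).
Lemma thF x : th (iF x) = iQ (zeta x) ** iF (psi x).
Proof. exact: (proj2_sig (constructive_indefinite_description _ (zeta_ex x))). Qed.

Lemma psi_hom : hom psi.
Proof. by move=> x y; rewrite /psi iF_hom (s_hom _ _ S) rF_hom. Qed.

Lemma zeta_hom : hom zeta.
Proof.
  move=> x y; apply: iQ_inj2; apply: (@mulIr _ (iF (psi (x ** y)))).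
  rewrite -thF iF_hom (s_hom _ _ S) !thF iQ_hom psi_hom iF_hom !mulA; congr (_ ** _).
  by rewrite -!mulA -iQF.
Qed.
End StabTheory.

Lemma psiK th th' (S : Stab th th') x : psi th (psi th' x) = x.
Proof.
  have := s_K' _ _ S (iF x); rewrite (thF _ _ (Stab_sym _ _ S)) (s_hom _ _ S) (betaE _ _ S).
  by move/(f_equal rF); rewrite rF_hom rF_Q gmul_1l rF_F.
Qed.

Lemma beta_surj th th' (S : Stab th th') q : exists r, beta th th' S r = q.
Proof.
  have S' := Stab_sym _ _ S; exists (beta _ _ S' q).
  by apply: iQ_inj2; rewrite -betaE -betaE (s_K' _ _ S).
Qed.

(** [th x] commutes with [th Q], which is all of Q. *)
Lemma zeta_central th th' (S : Stab th th') x q : commute (zeta th th' S x) q.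
Proof.
  have [r <-] := beta_surj _ _ S q.
  have e : th (iF x) ** th (iQ r) = th (iQ r) ** th (iF x) by rewrite -!(s_hom _ _ S) iQF.
  apply: iQ_inj2; rewrite !iQ_hom; apply: (@mulIr _ (iF (psi th x))).
  by move: e; rewrite (betaE _ _ S) (thF _ _ S) mulA -iQF -!mulA.
Qed.

(** * First edges of the images of t and t^-1; absence of folding *)

Section Edges.
Variables (th th' : D -> D).
Hypothesis S : Stab th th'.
Local Notation beta := (beta th th' S).
Local Notation zeta := (zeta th th' S).
Local Notation psi' := (psi th').
Local Notation psi := (psi th).
Local Notation stabo x := (@pj _ _ D x o = o).

Definition tpm (e : bool) : D := if e then tj o else (tj o)^-1.
(** An element of [Q x F] that fixes [th t root] also fixes the first edge on the way there, and
    likewise for [t^-1]. The image of [t] is located through this edge. *)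
Definition spm (e : bool) : VG D := hdv (act (th (tpm e)) rt).

Lemma tpm_root e : act (tpm e) rt = edge \1 o e.
Proof. by case: e; [apply: act_t_root|apply: act_tV_root]. Qed.

Lemma th_tpm_len e : 0 < lenG (th (tpm e)).
Proof.
  case: (Nat.eq_0_gt_0_cases (lenG (th (tpm e)))) => // /len0 /root_inA /(s_A' _ _ S).
  by rewrite (s_K _ _ S) => /inA_root; rewrite tpm_root.
Qed.

Lemma spm_edge e : exists b j e', spm e = edge b j e'.
Proof. by apply: edge_ex; apply: dep_hd; apply: th_tpm_len. Qed.

Lemma fix_spm e a : inA a -> act a (act (th (tpm e)) rt) = act (th (tpm e)) rt ->
  act a (spm e) = spm e.
Proof.
  move=> /inA_root ha e1.
  by rewrite /spm -(proj2 (act_fix_hd act (act_rooted D) a _ ha)) e1.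
Qed.

(** For [x] in F_o, the relation [x t = c(x) t x] says that [c(x)^-1 x] fixes [t root] and that [x]
    fixes [t^-1 root]. Applying [th] gives this lemma and [fix_minus]. *)
Lemma fix_plus x : stabo x -> act (iQ ((beta (cc x o))^-1 ** zeta x) ** iF (psi x)) (spm true) = spm true.
Proof.
  move=> hx; apply: fix_spm; first by exists ((beta (cc x o))^-1 ** zeta x), (psi x).
  have := f_equal th (tt_rel D x o); rewrite hx !(s_hom _ _ S) (betaE _ _ S) => e.
  rewrite iQ_hom (homV (iQ_hom D)) [_ ** iF _]mulA -(thF _ _ S) /= -aactM mulA e.
  rewrite mulA mulVK aactM inA_root //; apply: (s_A _ _ S); exact: inA_F.
Qed.

Lemma fix_minus x : stabo x -> act (iQ (zeta x) ** iF (psi x)) (spm false) = spm false.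
Proof.
  move=> hx; apply: fix_spm; first by exists (zeta x), (psi x).
  have := f_equal th (tt_relV D x o); rewrite hx -(thF _ _ S) !(s_hom _ _ S) /= => e.
  rewrite -aactM e !aactM (inA_root D (th (iF x))); last by apply: (s_A _ _ S); apply: inA_F.
  by rewrite inA_root //; apply: (s_A _ _ S); apply: inA_Q.
Qed.

Lemma cc_conj y x : stabo x ->
  cc (y ** x ** y^-1) (pj y o) = (cc y o)^-1 ** cc x o ** cc y o :> Q.
Proof.
  move=> hx; have e : cc (y^-1) (pj y o) = (cc y o)^-1 :> Q.
  { have := ccM D y y^-1 (pj y o); rewrite mulVr (cc1 D) (pjK D) => e.
    by rewrite (inv_unique _ _ (eq_sym e)) invK. }
  by rewrite !(ccM D) (pjK D) hx e mulA.
Qed.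

Lemma zeta_conj y x : zeta (y ** x ** y^-1) = zeta x.
Proof.
  have hz := zeta_hom _ _ S; rewrite !hz (homV hz).
  by rewrite (zeta_central _ _ S y (zeta x)) mulA mulVr mul1r.
Qed.

(** If [th t] pointed along some [t_j^-1], whose edge stabilizer lies in F, then [zeta] would equal
    [beta] after [c] on F_o. But [zeta], being central, is invariant under conjugation in F, and
    [g_pair] shows that [c] is not. *)
Lemma spm_true_sign : exists b j, spm true = edge b j true.
Proof.
  have [b [j [[] e]]] := spm_edge true; first by exists b, j.
  have eq x : stabo x -> zeta x = beta (cc x o).
  { move=> hx; have := fix_plus x hx; rewrite e act_edge => /edge_inj [e1 _].
    apply: (@mulI _ (beta (cc x o))^-1); rewrite gmul_Vl; apply: (@mulIr _ b); by rewrite e1 gmul_1l. }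
  have [p [y [hp [hp' [c1 c2]]]]] := g_pair _ _ C; exfalso; apply: c2.
  apply: (beta_inj _ _ S); rewrite -eq // zeta_conj eq // c1; exact: (hom1 (beta_hom _ _ S)).
Qed.

(** An index count: [x o -> psi x j] is a well-defined surjection of the finite set J to itself,
    hence injective. *)
Lemma psi_stab_converse (j : J) : (forall x, stabo x -> pj (psi x) j = j) ->
  forall x, pj (psi x) j = j -> stabo x.
Proof.
  move=> h; have hs i := constructive_indefinite_description _ (g_trans _ _ C i).
  pose f (i : J) : J := pj (psi (proj1_sig (hs i))) j.
  have fE x : f (pj x o) = pj (psi x) j.
  { rewrite /f; case: (hs (pj x o)) => y /= ey.
    rewrite -(mulKV y x) (psi_hom _ _ S) (pjM D) (h (y^-1 ** x)) //.
    by rewrite (pjM D) -ey (pjK D). }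
  have fsurj : FinFun.Surjective f.
  { move=> i; have [y ey] := g_trans _ _ C j; have [y' ey'] := g_trans _ _ C i.
    exists (pj (psi' (y' ** y^-1)) o).
    by rewrite fE (psiK _ _ S) (pjM D) -{1}ey (pjK D). }
  have dec : ListDec.decidable_eq J by move=> i i'; case: (classic (i = i')); [left|right].
  have inj := proj2 (FinFun.Endo_Injective_Surjective (g_fin _ _ C) dec f) fsurj.
  move=> x hx; apply: inj; rewrite fE hx.
  by rewrite -[in RHS](pj1 D o) fE (hom1 (psi_hom _ _ S)) (pj1 D).
Qed.

(** Otherwise [c] on F_o would be, up to inversion and conjugation by a fixed element of Q, the
    homomorphism [zeta] after [w], which is constant on conjugacy classes of F, against [g_pair]. *)
Lemma spm_false_sign : exists b j, spm false = edge b j false.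
Proof.
  have [b [j [[] e]]] := spm_edge false; last by exists b, j.
  have eq x : stabo x -> pj (psi x) j = j /\ zeta x ** b ** cc (psi x) j = b.
  { by move=> hx; have := fix_minus x hx; rewrite e act_edge => /edge_inj [e1 [e2 _]]. }
  have conv := psi_stab_converse j (fun x hx => proj1 (eq x hx)).
  have [p [y [hp [hp' [c1 c2]]]]] := g_pair _ _ C.
  have [y0 ey0] := g_trans _ _ C j.
  (* Chosen so that [psi (w x)], for [x] in F_o, fixes [j = y0 o]. *)
  pose w x := psi' (y0 ** x ** y0^-1).
  have hw : hom w by move=> x x'; rewrite /w -(psi_hom _ _ (Stab_sym _ _ S)); congr psi'; grp.
  have ew x : psi (w x) = y0 ** x ** y0^-1 by apply: (psiK _ _ S).
  have fixw x : stabo x -> pj (psi (w x)) j = j by move=> hx; rewrite ew -ey0 !(pjM D) (pjK D) hx.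
  have key x : stabo x -> zeta (w x) ** b ** (cc y0 o)^-1 ** cc x o ** cc y0 o = b.
  { move=> hx; have [_] := eq (w x) (conv _ (fixw x hx)).
    by rewrite ew -{1}ey0 (cc_conj _ _ hx) !mulA. }
  exfalso; apply: c2.
  have k1 := key p hp; have k2 := key _ hp'.
  rewrite hw hw (homV hw) zeta_conj in k2.
  by rewrite (mulI _ _ _ (mulIr _ _ _ (eq_trans k2 (eq_sym k1)))) c1.
Qed.

(** The stabilizer of an edge of negative sign has trivial Q-part, so [zeta] vanishes on F_o; its
    values commute, and [g_ab] applies. *)
Lemma zeta1 x : zeta x = \1.
Proof.
  have [b [j e]] := spm_false_sign.
  apply: (g_ab _ _ C zeta (zeta_hom _ _ S)); first by move=> *; apply: zeta_central.
  move=> y hy; have := fix_minus y hy; rewrite e act_edge => /edge_inj [e1 _].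
  by apply: (@mulIr _ b); rewrite e1 gmul_1l.
Qed.

Lemma thFE x : th (iF x) = iF (psi x).
Proof. by rewrite (thF _ _ S) zeta1 (hom1 (iQ_hom D)) gmul_1l. Qed.

(** No folding: the stabilizer of the first edge towards the image of [tpm e] is no larger than the
    image of the stabilizer of the original edge. The index count controls the F-part, injectivity
    of [beta] the Q-part. *)
Lemma spm_fixer e a : inA a -> act (th a) (spm e) = spm e -> act a (edge \1 o e) = edge \1 o e.
Proof.
  move=> [q [x ->]]; rewrite (s_hom _ _ S) (betaE _ _ S) thFE; case: e.
  - have [b [j e]] := spm_true_sign.
    have eq y : stabo y -> pj (psi y) j = j /\ (beta (cc y o))^-1 ** b ** cc (psi y) j = b.
    { move=> hy; have := fix_plus y hy; rewrite zeta1 mul1r e act_edge.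
      by move=> /edge_inj [e1 [e2 _]]. }
    rewrite e act_edge => /edge_inj [e1 [e2 _]].
    have hx := psi_stab_converse j (fun y hy => proj1 (eq y hy)) x e2.
    have [_ e3] := eq x hx.
    have e4 : beta q = (beta (cc x o))^-1.
    { apply: (@mulIr _ (b ** cc (psi x) j)); by rewrite !gmul_assoc e1 e3. }
    have e5 : q ** cc x o = \1.
    { apply: (beta_inj _ _ S); by rewrite (beta_hom _ _ S) e4 gmul_Vl. }
    by rewrite act_edge mul1r e5 hx.
  - have [b [j e]] := spm_false_sign.
    rewrite e act_edge => /edge_inj [e1 [e2 _]].
    have eq y : stabo y -> pj (psi y) j = j.
    { by move=> hy; have := fix_minus y hy; rewrite e act_edge => /edge_inj [_ []]. }
    have hx := psi_stab_converse j eq x e2.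
    have q1 : q = \1.
    { by apply: (beta_inj _ _ S); apply: (@mulIr _ b); rewrite e1 gmul_1l. }
    by rewrite act_edge q1 mul1r hx.
Qed.

Lemma edge_orbit b j e : exists a, inA a /\ edge b j e = act a (edge \1 o e).
Proof.
  have [y <-] := g_trans _ _ C j; case: e.
  - exists (iQ (b ** (cc y o)^-1) ** iF y); split; first by exists (b ** (cc y o)^-1), y.
    by rewrite act_edge; grp.
  - exists (iQ b ** iF y); split; first by exists b, y.
    by rewrite act_edge mul1r.
Qed.

Lemma len1_orbit r : lenG r = 1 -> exists a e a', inA a /\ inA a' /\ r = a ** tpm e ** a'.
Proof.
  move=> /edge_ex [b [j [e er]]]; have [a [ha ea]] := edge_orbit b j e.
  exists a, e, ((a ** tpm e)^-1 ** r); split=> //; split; last by rewrite mulKV.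
  have e2 : act r rt = act (a ** tpm e) rt by rewrite aactM tpm_root -ea.
  by apply: root_inA; rewrite aactM e2 -aactM gmul_Vl aact1.
Qed.

(** Edges at the root of equal sign differ by an element of [Q x F], to which [spm_fixer] applies;
    edges of opposite sign have images of opposite sign. So [len_scale] holds for [th], and at
    [th' t], whose image is [t], it forces the factor 1. *)
Lemma len_tau : lenG (th (tj o)) = 1.
Proof.
  have sgn e : exists b j, spm e = edge b j e by case: e; [apply: spm_true_sign|apply: spm_false_sign].
  have red a e a' : inA a -> inA a' ->
    act (th (a ** tpm e ** a')) rt = act (th a) (act (th (tpm e)) rt).
  { move=> ha ha'; rewrite !(s_hom _ _ S) !aactM (inA_root D (th a')) //.
    exact: (s_A _ _ S). }
  have thA a : inA a -> act (th a) rt = rt by move=> ha; apply: inA_root; apply: (s_A _ _ S).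
  have lentpm e : lenG (th (tpm e)) = lenG (th (tj o)).
  { by case: e => //; rewrite -[tpm false]/((tj o)^-1) (homV (s_hom _ _ S)) (lenV _ (act_rooted D)). }
  have scale := len_scale act (act_rooted D) (treeG_trans D) th (lenG (th (tj o))) (s_hom _ _ S).
  have e : lenG (th (th' (tj o))) = lenG (th' (tj o)) * lenG (th (tj o)).
  { apply: scale.
    - by move=> g /len0 /root_inA /(s_A _ _ S) /inA_root /len0.
    - move=> r /len1_orbit [a [e [a' [ha [ha' ->]]]]].
      rewrite -(lentpm e) {1}/len -[@root _]/rt red //.
      exact: (proj1 (act_fix_hd act (act_rooted D) _ _ (thA a ha))).
    - exact: (th_tpm_len true).
    - move=> r r' /len1_orbit [a [e [a' [ha [ha' ->]]]]] /len1_orbit [c [e' [c' [hc [hc' ->]]]]].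
      rewrite -[@root _]/rt !red // (proj2 (act_fix_hd act (act_rooted D) _ _ (thA a ha)))
        (proj2 (act_fix_hd act (act_rooted D) _ _ (thA c hc))).
      move=> es0; have es : act (th a) (spm e) = act (th c) (spm e') := es0.
      have ee : e = e'.
      { have [b [j e1]] := sgn e; have [b' [j' e2]] := sgn e'; move: es; rewrite e1 e2.
        have [q [x ->]] := s_A _ _ S _ ha; have [q' [x' ->]] := s_A _ _ S _ hc.
        by rewrite !act_edge => /edge_inj [_ []]. }
      subst e'.
      have : act (c^-1 ** a) (edge \1 o e) = edge \1 o e.
      { apply: spm_fixer; first by apply: inAM => //; apply: inAV.
        by rewrite (s_hom _ _ S) (homV (s_hom _ _ S)) aactM es -aactM gmul_Vl aact1. }
      rewrite !aactM (inA_root D a') // (inA_root D c') // tpm_root => e1.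
      by rewrite -{2}e1 -[RHS]aactM mulVr aact1. }
  have l1 : lenG (tj o) = 1 by rewrite /len -[@root _]/rt act_t_root.
  by rewrite (s_K' _ _ S) l1 in e; case: (proj1 (Nat.eq_mul_1 _ _) (eq_sym e)).
Qed.

Lemma tau_orbit : exists a, inA a /\ act (conjg a (th (tj o))) rt = act (tj o) rt.
Proof.
  have [b [j e]] := spm_true_sign; have [a [ha ea]] := edge_orbit b j true.
  have hl := len_tau; rewrite /spm /= in e.
  have hr : hdv (act (th (tj o)) rt) = act (th (tj o)) rt by apply: hd_dep1.
  rewrite hr in e; exists a^-1; split; first exact: inAV.
  rewrite /conjg !aactM invK (inA_root D a) // e ea -aactM gmul_Vl aact1 act_t_root //.
Qed.

Hypothesis tau_root : act (th (tj o)) rt = act (tj o) rt.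

Lemma psi_stab x : stabo x <-> stabo (psi x).
Proof.
  have e : spm true = edge \1 o true by rewrite /spm /= tau_root act_t_root hd_dep1.
  have fw y : stabo y -> stabo (psi y).
  { by move=> hy; have := fix_plus y hy; rewrite e act_edge => /edge_inj [_ []]. }
  by split; [apply: fw|apply: psi_stab_converse].
Qed.

(** Both [beta(c(x))^-1 psi(x)] and [c(psi(x))^-1 psi(x)] fix the edge to [t root]. As [c] is onto,
    [psi] therefore determines [beta]. *)
Lemma beta_cc x : stabo x -> beta (cc x o) = cc (psi x) o.
Proof.
  have e : spm true = edge \1 o true by rewrite /spm /= tau_root act_t_root hd_dep1.
  move=> hx; have := fix_plus x hx; rewrite e act_edge => /edge_inj [e1 _].
  rewrite zeta1 !mul1r in e1.
  by apply: (@mulI _ (beta (cc x o))^-1); rewrite gmul_Vl e1.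
Qed.

(** Since [th t root = t root], [th t] is [t q y] with [y] in F. Applying [th] to the relations over
    F_o shows that [y] centralizes F_o, which contains [u] and a conjugate of [u] with another fixed
    vertex; so [y] is trivial. *)
Lemma tau_form : exists q, th (tj o) = tj o ** iQ q.
Proof.
  have [q [y e]] : inA ((tj o)^-1 ** th (tj o)).
  { by apply: root_inA; rewrite aactM tau_root -aactM gmul_Vl aact1. }
  have et : th (tj o) = tj o ** (iQ q ** iF y) by rewrite -e mulKV.
  have comm w : stabo w -> commute y w.
  { move=> hw; have ew : psi (psi' w) = w by apply: psiK.
    have hx : stabo (psi' w) by apply/psi_stab; rewrite ew.
    have := f_equal th (tt_rel D (psi' w) o).
    rewrite hx !(s_hom _ _ S) (betaE _ _ S) thFE ew (beta_cc _ hx) ew et => e2.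
    have e3 : iF w ** (iQ q ** iF y) = iQ q ** iF y ** iF w :> D.
    { apply: (@mulI _ (iQ (cc w o) ** tj o)); move: e2.
      by rewrite gmul_assoc tt_rel hw; grp. }
    by have := f_equal rF e3; rewrite !rF_hom rF_Q !rF_F !gmul_1l. }
  exists q; rewrite et; suff -> : y = \1 by rewrite (hom1 (iF_hom D)) mul1r.
  have [p [y' [hp [hp' [c1 c2]]]]] := g_pair _ _ C.
  apply: (centralizer_trivial m (g_m2 _ _ C) (y' ** p ** y'^-1)).
  (* Powers of [u] have trivial [c], the chosen conjugator does not. *)
  - move=> [i ei]; apply: c2; rewrite ei.
    have: stabo (gpow (uF m) i) /\ cc (gpow (uF m) i) o = \1 :> Q; last by case.
    elim: i {ei} => [|i [IH1 IH2]]; first by rewrite /= pj1 cc1.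
    by rewrite /= (pjM D) (ccM D) IH1 IH2 (g_u _ _ C) (g_cu _ _ C) gmul_1l.
  - by apply: comm; apply: (g_u _ _ C).
  - apply: comm; rewrite (pjM D) (pjM D _ (uF m)) -{1}hp' (pjK D) (g_u _ _ C) hp' //.
Qed.
End Edges.

(** Automorphisms brought to a standard position with given restriction to F. Any two with the same
    [(a, b)] differ by some [phi q], and finitely many pairs suffice up to inner automorphisms. *)
Definition NF (th : D -> D) (a b : F) : Prop :=
  exists th', Stab th th' /\ act (th (tj o)) rt = act (tj o) rt /\
    psi th (uF m) = a /\ psi th (vF m) = b.

Lemma NF_unique th1 th2 a b : NF th1 a b -> NF th2 a b -> exists q, forall g, th1 g = phi q (th2 g).
Proof.
  move=> [th1' [S1 [r1 [a1 b1]]]] [th2' [S2 [r2 [a2 b2]]]].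
  have [q1 t1] := tau_form _ _ S1 r1; have [q2 t2] := tau_form _ _ S2 r2.
  have epsi : forall x, psi th1 x = psi th2 x.
  { apply: FF_hom_ext; [exact: (psi_hom _ _ S1)|exact: (psi_hom _ _ S2)|by rewrite a1 a2|by rewrite b1 b2]. }
  have ebeta q : beta _ _ S1 q = beta _ _ S2 q.
  { have [x [hx <-]] := g_surj _ _ C q.
    by rewrite (beta_cc _ _ S1 r1 _ hx) (beta_cc _ _ S2 r2 _ hx) epsi. }
  (* The two maps send [t] to [t q1] and [t q2], and [phi q] sends [t q2] to [t q q2]. *)
  exists (q1 ** q2^-1); have [hp [pq [px pt]]] := phi_spec (q1 ** q2^-1).
  apply: EG_ext.
  - exact: (s_hom _ _ S1).
  - exact: hom_comp (s_hom _ _ S2) hp.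
  - by move=> q; rewrite (betaE _ _ S1) (betaE _ _ S2) pq ebeta.
  - by move=> x; rewrite (thFE _ _ S1) (thFE _ _ S2) px epsi.
  - by rewrite t1 t2 hp pt pq mulA -iQ_hom mulA gmul_Vl mul1r.
Qed.

(** [FF_out_finite] may require conjugation by any [y] in F, but only [x] in F_o can be used without
    moving [t root]. Writing [y = r x] with [r] in a finite transversal leaves finitely many forms,
    each conjugated by some [r^-1]. *)
Lemma NF_ex : exists L : list (F * F), forall th th', hom th -> hom th' ->
  (forall g, th' (th g) = g) -> (forall g, th (th' g) = g) ->
  exists h a b, In (a, b) L /\ NF (fun x => conjg h (th x)) a b.
Proof.
  have [l hl] := finite_image (fun x : F => @pj _ _ D x o) (g_fin _ _ C).
  pose U := map (fun i => gpow (uF m) i) (seq 0 m).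
  have inU i : i < m -> In (gpow (uF m) i) U.
  { by move=> hi; apply: (in_map (fun i => gpow (uF m) i)); apply/in_seq; lia. }
  pose W := map (fun p : F * F => fst p ** vF m ** snd p) (list_prod U U).
  exists (map (fun p : F * (F * F) => (conjg (fst p)^-1 (fst (snd p)), conjg (fst p)^-1 (snd (snd p))))
    (list_prod l (list_prod U W))) => th0 th0' h0 h0' k0 k0'.
  have [g S0] := Stab_ex th0 th0' h0 h0' k0 k0'.
  have [a0 [ha0 r0]] := tau_orbit _ _ S0.
  pose th x := conjg a0 (conjg g (th0 x)).
  pose th' x := th0' (conjg g^-1 (conjg a0^-1 x)).
  have S : Stab th th' := Stab_conj _ _ a0 ha0 S0.
  have thE x : th x = conjg a0 (conjg g (th0 x)) by [].
  change (act (th (tj o)) rt = act (tj o) rt) in r0.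
  clearbody th th'.
  have [y [a [i [j [la [li [lj [eu ev]]]]]]]] := FF_out_finite m (g_m2 _ _ C) (g_odd _ _ C)
    (psi th) (psi th') (psi_hom _ _ S) (fun x => psiK _ _ (Stab_sym _ _ S) x) (psiK _ _ S).
  have [r [hr er]] := hl y; pose x := r^-1 ** y.
  have hx : pj x o = o by rewrite /x (pjM D) -er (pjK D).
  have [q t] := tau_form _ _ S r0.
  (* With this choice [A0 t = t x], so conjugation by [A0] keeps the image of [t root] in place
     while acting on F as conjugation by [x]. *)
  pose A0 : D := iQ (cc x o)^-1 ** iF x.
  have hA0 : inA A0 by exists (cc x o)^-1, x.
  have eA0 : A0 ** tj o = tj o ** iF x.
  { by rewrite /A0 mulA tt_rel hx (homV (iQ_hom D)) mulA mulVK. }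
  have rA : rF A0 = x by rewrite /A0 rF_hom rF_Q rF_F gmul_1l.
  clearbody A0.
  have conj_x z : conjg x z = conjg r^-1 (conjg y z) by rewrite /x conjgM.
  have epsi z : psi (fun w => conjg A0 (th w)) z = conjg x (psi th z).
  { by rewrite /psi /conjg !rF_hom (homV (rF_hom D)) rA. }
  exists (A0 ** a0 ** g), (conjg r^-1 (gpow (uF m) a)), (conjg r^-1 (gpow (uF m) i ** vF m ** gpow (uF m) j)).
  split.
  { apply/in_map_iff; exists (r, (gpow (uF m) a, gpow (uF m) i ** vF m ** gpow (uF m) j)); split=> //.
    apply/in_prod_iff; split=> //; apply/in_prod_iff; split; first exact: inU.
    apply/in_map_iff; exists (gpow (uF m) i, gpow (uF m) j); split=> //.
    by apply/in_prod_iff; split; apply: inU. }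
  have -> : (fun x => conjg (A0 ** a0 ** g) (th0 x)) = (fun x => conjg A0 (th x)).
  { by apply: functional_extensionality => z; rewrite thE !conjgM. }
  exists (fun x => th' (conjg A0^-1 x)); split; first exact: Stab_conj.
  split; last by rewrite !epsi !conj_x eu ev.
  rewrite t; have -> : conjg A0 (tj o ** iQ q) = tj o ** (iF x ** iQ q ** A0^-1).
  { by rewrite /conjg gmul_assoc eA0; grp. }
  rewrite aactM inA_root //; apply: inAM; last exact: inAV.
  by apply: inAM; [apply: inA_F|apply: inA_Q].
Qed.

Theorem Ext_embeds : EmbedsFiniteIndexInOut Q D.
Proof.
  exists phi; split; first exact: phi_aut.
  split.
  { by move=> q q'; exists \1 => x; rewrite phiM; grp. }
  split; first exact: phi_inj.
  have [L hL] := NF_ex.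
  (* One normalized automorphism is kept for every pair [(a, b)] that occurs. *)
  have [B hB] : exists B : list (D -> D), forall th a b, In (a, b) L -> NF th a b ->
    exists t, In t B /\ NF t a b.
  { elim: L {hL} => [|[a b] L [B hB]]; first by exists [].
    case: (classic (exists t, NF t a b)) => [[t ht]|no].
    - exists (t :: B) => th a' b' /= [[<- <-]|h] hN; first by exists t; split; [left|].
      by have [t' [h1 h2]] := hB th a' b' h hN; exists t'; split; [right|].
    - exists B => th a' b' /= [[<- <-]|h] hN; last exact: hB h hN.
      by case: no; exists th. }
  exists B => th [ht [th' [k k']]].
  have ht' : hom th'.
  { by move=> x y; rewrite -{1}(k' x) -{1}(k' y) -ht k. }
  have [h [a [b [hab hN]]]] := hL th th' ht ht' k k'.
  have [t [hB1 hB2]] := hB _ a b hab hN; have [q e] := NF_unique _ _ a b hN hB2.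
  exists t, q; split=> //; exists h^-1 => x.
  by rewrite -e -/(conjg h^-1 _) conjgVK.
Qed.
End FA.
End Automorphisms.

(** * Residual finiteness of the extension *)

Definition swap {X : Type} (a b x : X) : X :=
  match excluded_middle_informative (x = a) with
  | left _ => b
  | right _ => match excluded_middle_informative (x = b) with left _ => a | right _ => x end
  end.
Lemma swap_l {X : Type} (a b : X) : swap a b a = b.
Proof. by rewrite /swap; case: excluded_middle_informative. Qed.
Lemma swap_r {X : Type} (a b : X) : swap a b b = a.
Proof. by rewrite /swap; do 2 case: excluded_middle_informative => //. Qed.
Lemma swap_other {X : Type} (a b x : X) : x <> a -> x <> b -> swap a b x = x.
Proof. by rewrite /swap; do 2 case: excluded_middle_informative => //. Qed.
Lemma swapK {X : Type} (a b x : X) : swap a b (swap a b x) = x.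
Proof.
  case: (classic (x = a)) => [->|ha]; first by rewrite swap_l swap_r.
  case: (classic (x = b)) => [->|hb]; first by rewrite swap_r swap_l.
  by rewrite !swap_other.
Qed.

(** The permutation for the shorter list is followed by the transposition of [pi a] and [b]; by
    injectivity the values at the other sources avoid both points. *)
Lemma partial_injection_extends {X : Type} (ps : list (X * X)) :
  (forall p p', In p ps -> In p' ps -> (fst p = fst p' <-> snd p = snd p')) ->
  exists pi : Sym X, forall p, In p ps -> pfun pi (fst p) = snd p.
Proof.
  elim: ps => [|[a b] ps IH] h; first by exists \1.
  have [pi hpi] : exists pi : Sym X, forall p, In p ps -> pfun pi (fst p) = snd p.
  { by apply: IH => p p' hp hp'; apply: h; right. }
  exists ((involution (swap (pfun pi a) b) (swapK _ _) : Sym X) ** pi) => p /= [<-|hp] /=.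
  - exact: swap_l.
  - rewrite (hpi p hp).
    case: (classic (fst p = a)) => e.
    + have e2 : snd p = b by apply: (proj1 (h p (a, b) (or_intror hp) (or_introl eq_refl))).
      by rewrite -e hpi // e2 swap_l.
    + apply: swap_other => e2; apply: e.
      * by apply: (perm_inj _ pi); rewrite hpi.
      * exact: (proj2 (h p (a, b) (or_intror hp) (or_introl eq_refl))).
Qed.

Section FiniteActions.
Context {Q : Grp}.

Lemma coset_action (N : Q -> Prop) (q0 : Q) : NormalSubgroup Q N -> FiniteIndex Q N -> ~ N q0 ->
  exists (X : Type) (rho : Q -> Sym X) (x : X), Fin X /\ hom rho /\ pfun (rho q0) x <> x.
Proof.
  move=> [n1 [nM [nV nJ]]] [L hL] nq.
  pose cs (x : Q) := fun y => N (x^-1 ** y).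
  pose X := {P : Q -> Prop | exists x, P = cs x}.
  have Xeq (c d : X) : proj1_sig c = proj1_sig d -> c = d.
  { by case: c d => P hP [P' hP'] /= e; subst P'; rewrite (proof_irrelevance _ hP hP'). }
  pose mk x : X := exist _ (cs x) (ex_intro _ x eq_refl).
  have mkP (c : X) : exists x, c = mk x by case: c => P [x e]; exists x; apply: Xeq.
  have shift_ok q (c : X) : exists x, (fun y => proj1_sig c (q^-1 ** y)) = cs x.
  { have [x ->] := mkP c; exists (q ** x); apply: functional_extensionality => y.
    by rewrite /cs /=; grp. }
  pose sh q (c : X) : X := exist _ (fun y => proj1_sig c (q^-1 ** y)) (shift_ok q c).
  have shM q r c : sh (q ** r) c = sh q (sh r c).
  { by apply: Xeq; apply: functional_extensionality => y /=; rewrite invM mulA. }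
  have sh1 c : sh \1 c = c.
  { by apply: Xeq; apply: functional_extensionality => y /=; rewrite inv1 gmul_1l. }
  have shK q c : sh q^-1 (sh q c) = c by rewrite -shM gmul_Vl sh1.
  have shKV q c : sh q (sh q^-1 c) = c by rewrite -shM mulVr sh1.
  pose rho q : Sym X := {| pfun := sh q; pbk := sh q^-1; pfunK := shK q; pbkK := shKV q |}.
  exists X, rho, (mk \1); split; last split.
  - exists (map mk L) => c; have [x ->] := mkP c; have [h [h1 h2]] := hL x.
    apply/in_map_iff; exists h; split=> //; apply: Xeq => /=.
    apply: functional_extensionality => y; apply: propositional_extensionality; rewrite /cs; split=> e.
    + by have := nM _ _ (nV _ h2) e; grp.
    + by have := nM _ _ h2 e; grp.
  - by move=> q r; apply: perm_eq => c; apply: shM.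
  - move=> /(f_equal (fun c => proj1_sig c q0)) /=; rewrite /cs gmul_Vl inv1 !gmul_1l => e.
    by apply: nq; rewrite -e.
Qed.

(** A product of coset actions, one for each nontrivial element of [B]. *)
Lemma separating_action (B : list Q) : ResFinite Q ->
  exists (X : Type) (rho : Q -> Sym X) (x : X), Fin X /\ hom rho /\
    forall b, In b B -> pfun (rho b) x = x -> b = \1.
Proof.
  move=> rf; elim: B => [|b B [X [rho [x [hX [hr hB]]]]]].
  { exists unit, (fun _ => \1), Datatypes.tt; split; first by exists [Datatypes.tt] => -[]; left.
    by split=> // q r; rewrite gmul_1l. }
  case: (classic (b = \1)) => hb.
  { by exists X, rho, x; split=> //; split=> // b' /= [<-|/hB]. }
  have [N [nN [fN ng]]] := rf b hb.
  have [Y [sig [y [hY [hs hy]]]]] := coset_action N b nN fN ng.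
  pose f q (p : X * Y) := (pfun (rho q) (fst p), pfun (sig q) (snd p)).
  have fM q r p : f (q ** r) p = f q (f r p) by rewrite /f hr hs.
  have f1 p : f \1 p = p by rewrite /f (hom1 hr) (hom1 hs); case: p.
  have fK q p : f q^-1 (f q p) = p by rewrite -fM gmul_Vl f1.
  have fKV q p : f q (f q^-1 p) = p by rewrite -fM mulVr f1.
  exists (X * Y)%type, (fun q => {| pfun := f q; pbk := f q^-1; pfunK := fK q; pbkK := fKV q |} : Sym _), (x, y).
  split; first exact: Fin_prod.
  split; first by move=> q r; apply: perm_eq => p; apply: fM.
  by move=> b' /= [<-|/hB h]; rewrite /f /= => -[e1 e2] //; apply: h.
Qed.
End FiniteActions.

Section ExtResidual.
Context {Q : Grp} {m : nat} (D : Ext Q m).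
Local Notation F := (FF m).
Local Notation J := (EJ D).
Hypothesis m2 : 2 < m.
Hypothesis finJ : Fin J.

Section Induced.
Context {X : Type} (rho : Q -> Sym X) (hr : hom rho).

(* Since the t_j are free over Q, D acts on (J -> Sym X) * X with tj j acting on the fibre over s
   by s j; F permutes the choices s. *)
Let Om : Type := ((J -> Sym X) * X)%type.

(** Chosen so that [s j = c(x, j) (twist x s) (x j)], which is the relation
    [x t_j = c(x, j) t_(x j) x] read in the fibre over [s]. *)
Definition twist (x : F) (s : J -> Sym X) : J -> Sym X :=
  fun j => (rho (cc x (pj x^-1 j)))^-1 ** s (pj x^-1 j).
Lemma twistM x y s : twist (x ** y) s = twist x (twist y s).
Proof.
  apply: functional_extensionality => j; rewrite /twist invM (pjM D) (ccM D) hr (pjKV D).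
  by rewrite invM mulA.
Qed.
Lemma twist1 s : twist \1 s = s.
Proof.
  apply: functional_extensionality => j.
  by rewrite /twist inv1 (pj1 D) (cc1 D) (hom1 hr) inv1 gmul_1l.
Qed.

Definition permQ (q : Q) : Sym Om.
Proof.
  refine {| pfun := fun p : Om => (fst p, pfun (rho q) (snd p)) : Om;
            pbk := fun p : Om => (fst p, pbk (rho q) (snd p)) : Om |}.
  - by case=> s y /=; rewrite pfunK.
  - by case=> s y /=; rewrite pbkK.
Defined.
Definition permF (x : F) : Sym Om.
Proof.
  refine {| pfun := fun p : Om => (twist x (fst p), snd p) : Om;
            pbk := fun p : Om => (twist x^-1 (fst p), snd p) : Om |}.
  - by case=> s y /=; rewrite -twistM gmul_Vl twist1.
  - by case=> s y /=; rewrite -twistM mulVr twist1.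
Defined.
Definition permJ (j : J) : Sym Om.
Proof.
  refine {| pfun := fun p : Om => (fst p, pfun (fst p j) (snd p)) : Om;
            pbk := fun p : Om => (fst p, pbk (fst p j) (snd p)) : Om |}.
  - by case=> s y /=; rewrite pfunK.
  - by case=> s y /=; rewrite pbkK.
Defined.

Lemma induced_action : exists R : D -> Sym Om, hom R /\ (forall q, R (iQ q) = permQ q) /\
  (forall x, R (iF x) = permF x) /\ (forall j, R (tj j) = permJ j).
Proof.
  apply: EG_hom.
  - by move=> q r; apply: perm_eq => -[s y]; rewrite sym_mulE /= hr.
  - by move=> x y; apply: perm_eq => -[s z]; rewrite sym_mulE /= twistM.
  - by move=> q x; apply: perm_eq.
  - move=> x j; apply: perm_eq => -[s y]; rewrite !sym_mulE /=; congr (_, _).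
    by rewrite /twist (pjK D) -{1}(mulKV (rho (cc x j)) (s j)).
Qed.

Fixpoint evalX (s : J -> Sym X) (l : list (syl D)) (y : X) : X :=
  match l with
  | [] => y
  | (b, (j, e)) :: t => pfun (rho b) ((if e then pfun (s j) else pbk (s j)) (evalX s t y))
  end.

Lemma induced_real (R : D -> Sym Om) : hom R -> (forall q, R (iQ q) = permQ q) ->
  (forall j, R (tj j) = permJ j) ->
  forall s l y, pfun (R (real D l)) (s, y) = (s, evalX s l y).
Proof.
  move=> hR RQ Rt s; elim=> [|[b [j e]] t IH] y /=; first by rewrite (hom1 hR).
  by rewrite !hR !sym_mulE IH RQ; case: e; rewrite ?(homV hR) Rt.
Qed.
End Induced.

(** * Tracing a reduced word along a path in a finite set *)

Section Path.
Context {X0 : Type} (rho0 : Q -> Sym X0) (h0 : hom rho0) (x0 : X0) (k : nat) (q : Q).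
Let Lv : Type := {i : nat | i <= k}.
Let X : Type := (X0 * Lv)%type.

Definition lv (i : nat) : Lv := exist _ (Nat.min i k) (Nat.le_min_r i k).
Lemma lv_inj i i' : i <= k -> i' <= k -> lv i = lv i' -> i = i'.
Proof. by move=> h h' [e]; lia. Qed.

Definition head_elt (t : list (syl D)) : Q := match t with [] => q | (b, _) :: _ => b end.
Definition base (i : nat) : X := (x0, lv i).
(** The intended position after [q] and then the suffix [t] have acted on [base 0], one level higher
    for each syllable; for the empty suffix only [q] has acted. *)
Definition entry (t : list (syl D)) : X := (pfun (rho0 (head_elt t)) x0, lv (length t)).

(* The values required of the permutation attached to j for l to trace the path base 0, base 1, ... *)
Fixpoint steps (j : J) (l : list (syl D)) : list (X * X) :=
  match l with
  | [] => []
  | (b, (j', e)) :: t =>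
      match excluded_middle_informative (j' = j) with
      | left _ => [if e then (entry t, base (S (length t))) else (base (S (length t)), entry t)]
      | right _ => []
      end ++ steps j t
  end.

Lemma steps_level j l p : length l <= k -> In p (steps j l) ->
  (exists i, i <= length l /\ snd (fst p) = lv i) /\ (exists i, i <= length l /\ snd (snd p) = lv i).
Proof.
  elim: l => // -[b [j' e]] t IH hl; simpl in hl; move=> /= /in_app_iff [|hp].
  - case: excluded_middle_informative => // _ [<-|//].
    by case: e => /=; split; [exists (length t)|exists (S (length t))|exists (S (length t))|exists (length t)]; split=> //; lia.
  - simpl in hl; have [[i [h1 h2]] [i' [h3 h4]]] := IH ltac:(lia) hp.
    by split; [exists i|exists i']; split=> //; lia.
Qed.

Definition separated (l : list (syl D)) : Prop :=
  forall b, In b (map fst l) -> pfun (rho0 b) x0 = x0 -> b = \1.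

(** Only the most recent step reaches level [length t], and it does so at [x0]. If this is also
    [entry t], separation makes the coefficient in front trivial. *)
Lemma steps_top j t p : length t <= k -> separated t -> In p (steps j t) ->
  (fst p = entry t -> hd_error t = Some (\1, (j, false))) /\
  (snd p = entry t -> hd_error t = Some (\1, (j, true))).
Proof.
  case: t => // -[b [j' e]] t hl sep /= /in_app_iff [|hp].
  - have hb : pfun (rho0 b) x0 = x0 -> b = \1 by apply: sep; left.
    simpl in hl; case: excluded_middle_informative => // -> [<-|//].
    clear sep; case: e => /=; split=> e1; have e2 := f_equal snd e1; have {}e1 := f_equal fst e1.
    + by exfalso; have h := fun a b => lv_inj _ _ a b e2; have := h ltac:(lia) ltac:(simpl; lia); simpl; lia.
    + by rewrite (hb (eq_sym e1)).
    + by rewrite (hb (eq_sym e1)).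
    + by exfalso; have h := fun a b => lv_inj _ _ a b e2; have := h ltac:(lia) ltac:(simpl; lia); simpl; lia.
  - simpl in hl; have [[i [h1 h2]] [i' [h3 h4]]] := steps_level j t p ltac:(lia) hp.
    split=> e1; exfalso; move: h2 h4; rewrite e1 /=.
    + move=> e2 _; have h := fun a b => lv_inj _ _ a b e2; have := h ltac:(simpl; lia) ltac:(lia); lia.
    + move=> _ e2; have h := fun a b => lv_inj _ _ a b e2; have := h ltac:(simpl; lia) ltac:(lia); lia.
Qed.

(** By [steps_top], a clash of a new step with an older one would exhibit adjacent letters [t_j] and
    [t_j^-1] with trivial coefficient between them, which a reduced word does not contain. *)
Lemma steps_compatible j l : okG D l -> length l <= k -> separated l ->
  forall p p', In p (steps j l) -> In p' (steps j l) -> (fst p = fst p' <-> snd p = snd p').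
Proof.
  elim: l => // -[b [j' e]] t IH [ok1 ok2] hl sep; simpl in hl.
  have sep' : separated t by move=> b' hb'; apply: sep; right.
  have {}IH := IH ok2 ltac:(lia) sep'; clear sep.
  rewrite /=; case: excluded_middle_informative => // ej; subst j'.
  have top p : In p (steps j t) -> 
    fst p <> (if e then entry t else base (S (length t))) /\
    snd p <> (if e then base (S (length t)) else entry t).
  { move=> hp; have [t1 t2] := steps_top j t p ltac:(lia) sep' hp.
    have [[i [h1 h2]] [i' [h3 h4]]] := steps_level j t p ltac:(lia) hp.
    case: e ok1 => ok1; split=> e1.
    - by apply: ok1; rewrite t1.
    - move: h4; rewrite e1 => e2; have h := fun a b => lv_inj _ _ a b e2.
      have := h ltac:(lia) ltac:(lia); lia.
    - move: h2; rewrite e1 => e2; have h := fun a b => lv_inj _ _ a b e2.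
      have := h ltac:(lia) ltac:(lia); lia.
    - by apply: ok1; rewrite t2. }
  move=> p p' /= [<-|hp] [<-|hp'] //.
  - by have [t1 t2] := top _ hp'; case: e {ok1 top} t1 t2 => /= t1 t2; split=> e1; exfalso;
      [apply: t1|apply: t2|apply: t1|apply: t2].
  - by have [t1 t2] := top _ hp; case: e {ok1 top} t1 t2 => /= t1 t2; split=> e1; exfalso;
      [apply: t1|apply: t2|apply: t1|apply: t2].
  - exact: IH.
Qed.

Definition liftX (r : Q) : Sym X.
Proof.
  refine {| pfun := fun p : X => (pfun (rho0 r) (fst p), snd p) : X;
            pbk := fun p : X => (pbk (rho0 r) (fst p), snd p) : X |}.
  - by case=> s y /=; rewrite pfunK.
  - by case=> s y /=; rewrite pbkK.
Defined.
Lemma liftX_hom : hom liftX.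
Proof. by move=> r r'; apply: perm_eq => -[s y]; rewrite sym_mulE /= h0. Qed.

Lemma evalX_path (s : J -> Sym X) l : 
  (forall j p, In p (steps j l) -> pfun (s j) (fst p) = snd p) ->
  evalX liftX s l (entry []) = entry l.
Proof.
  elim: l => // -[b [j e]] t IH hs.
  have -> : evalX liftX s ((b, (j, e)) :: t) (entry []) =
    pfun (liftX b) ((if e then pfun (s j) else pbk (s j)) (evalX liftX s t (entry []))) by [].
  rewrite IH; last by move=> j' p hp; apply: hs; apply/in_app_iff; right.
  have hin : In (if e then (entry t, base (S (length t))) else (base (S (length t)), entry t))
    (steps j ((b, (j, e)) :: t)).
  { by apply/in_app_iff; left; case: excluded_middle_informative => // _; left. }
  have := hs j _ hin; case: e {hs hin} => /= e1.
  - by rewrite e1.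
  - by rewrite -e1 pfunK.
Qed.

Lemma Fin_X : Fin X0 -> Fin X.
Proof.
  move=> h; apply: Fin_prod => //.
  have [l hl] := list_preimage (fun i : Lv => proj1_sig i)
    (fun i i' e => eq_sig_hprop (fun _ => proof_irrelevance _) i i' e) (seq 0 (S k)).
  by exists l => -[i hi]; apply: hl; apply/in_seq => /=; lia.
Qed.
End Path.

Lemma rF_real l : rF (real D l) = \1.
Proof.
  elim: l => [|[b [j e]] t IH] /=; first by rewrite (hom1 (rF_hom D)).
  by rewrite !(rF_hom D) IH rF_Q; case: e; rewrite ?(homV (rF_hom D)) rF_t; grp.
Qed.

(** Elements with nontrivial image in F are separated by residual finiteness of F. Any other [g] is
    a reduced word [w] times [q] in Q, and a finite action built for it lifts the base point to
    level [length w]. This leaves [g = q], which moves [x0]. *)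
Theorem Ext_residually_finite : ResFinite Q -> ResFinite D.
Proof.
  move=> rf g hg.
  case: (classic (rF g = \1)) => hF; last first.
  { apply: (residual_comap rF g) => //; [exact: rF_hom|exact: FF_residually_finite]. }
  have [a [[q [x ea]] eg]] := real_nf D g (rootG D).
  rewrite /= mul1r in eg; set w := act D g (rootG D) in eg.
  have x1 : x = \1.
  { by move: hF; rewrite eg ea !(rF_hom D) rF_real rF_Q rF_F !gmul_1l. }
  rewrite x1 (hom1 (iF_hom D)) mul1r in ea; subst a.
  have [X0 [rho0 [x0 [fX0 [h0 sep]]]]] := separating_action (q :: map fst (proj1_sig w)) rf.
  pose k := length (proj1_sig w).
  have sep' : separated rho0 x0 (proj1_sig w) by move=> b hb; apply: sep; right.
  have pis j := partial_injection_extends _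
    (steps_compatible rho0 x0 k q j _ (proj2_sig w) (le_n k) sep').
  pose s j := proj1_sig (constructive_indefinite_description _ (pis j)).
  have hs j p : In p (steps rho0 x0 k q j (proj1_sig w)) -> pfun (s j) (fst p) = snd p.
  { exact: (proj2_sig (constructive_indefinite_description _ (pis j))). }
  have hl := liftX_hom rho0 h0 k.
  have [R [hR [RQ [RF Rt]]]] := induced_action _ hl.
  apply: (residual_by_hom R) => //.
  { apply: Fin_Sym; apply: Fin_prod; last exact: Fin_X.
    by apply: Fin_fun => //; apply: Fin_Sym; apply: Fin_X. }
  move=> e; have e1 : pfun (R g) (s, base x0 k 0) = (s, base x0 k 0) by rewrite e.
  rewrite eg hR sym_mulE RQ in e1.
  have e2 : pfun (R (real D (proj1_sig w))) (s, entry rho0 x0 k q []) = (s, base x0 k 0) := e1.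
  rewrite (induced_real _ R hR RQ Rt) (evalX_path rho0 x0 k q s _ hs) in e2.
  have e3 := f_equal snd e2; simpl in e3.
  have k0 : k = 0 by apply: (lv_inj k k 0 (le_n k) (Nat.le_0_l k)); exact: (f_equal snd e3).
  apply: hg; rewrite eg; move: k0 (f_equal fst e3); rewrite /k.
  case: (proj1_sig w) => // _ e4; rewrite /= gmul_1l (sep q) ?(hom1 (iQ_hom D)) //.
  by left.
Qed.
End ExtResidual.

(** * The extension attached to a presentation *)

Section Instance.
Context {Q : Grp} (n : nat) (gens : nat -> Q) (R : list word) (HQ : Presents Q n gens R).

(** The [M] indices form [n + 2] pairs under [v]: one pair for each generator of Q and two of
    trivial cost. As [u] fixes one index and cycles the others, its order is [m = M - 1], which is
    odd. *)
Let M := 2 * n + 4.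
Let m := 2 * n + 3.
Local Notation F := (FF m).
Lemma m_gt2 : 2 < m. Proof. by rewrite /m; lia. Qed.

(* The action on t_0, ..., t_m: u fixes t_0 and cycles t_1, ..., t_m, and
   v t_(2i) = (kap i) t_(2i+1) v.  The first two costs kap are trivial so that v joins 0 to the cycle
   and some loop at 0 has trivial cost. *)
Definition su (j : nat) : nat := if j =? 0 then 0 else S (j mod m).
Definition sv (j : nat) : nat := if Nat.even j then S j else j - 1.
Definition kap (i : nat) : Q := match i with S (S i') => gens i' | _ => \1 end.
Definition cv (j : nat) : Q := if Nat.even j then kap (Nat.div2 j) else (kap (Nat.div2 j))^-1.
Definition kword (i : nat) : word := match i with S (S i') => [(i', true)] | _ => [] end.

Definition idx : Type := {j : nat | j < M}.
Lemma idx_eq (i j : idx) : proj1_sig i = proj1_sig j -> i = j.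
Proof. by case: i j => i hi [j hj] /= e; subst j; rewrite (proof_irrelevance _ hi hj). Qed.
Lemma Jof_lt k : k mod M < M.
Proof. by apply: Nat.mod_upper_bound; rewrite /M; lia. Qed.
Definition Jof (k : nat) : idx := exist (fun i => i < M) (k mod M) (Jof_lt k).
Lemma JofE k : k < M -> proj1_sig (Jof k) = k.
Proof. exact: Nat.mod_small. Qed.
Lemma Jof_proj (j : idx) : Jof (proj1_sig j) = j.
Proof. by apply: idx_eq; rewrite JofE //; apply: (proj2_sig j). Qed.

Lemma su_lt j : j < M -> su j < M.
Proof.
  rewrite /su /M => h; case: Nat.eqb => //; first by lia.
  by have := Nat.mod_upper_bound j m ltac:(rewrite /m; lia); rewrite {2}/m; lia.
Qed.
Lemma even_cases j : exists i, (j = 2 * i /\ Nat.even j = true /\ Nat.div2 j = i) \/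
  (j = S (2 * i) /\ Nat.even j = false /\ Nat.div2 j = i).
Proof.
  case E : (Nat.even j).
  - have [i ei] := proj1 (Nat.even_spec j) E; exists i; left; split=> //; split=> //.
    by rewrite ei Nat.div2_double.
  - have [i ei] : Nat.Odd j by apply/Nat.odd_spec; rewrite -Nat.negb_even E.
    exists i; right; split; first by lia.
    by split=> //; rewrite ei Nat.add_1_r Nat.div2_succ_double.
Qed.
Lemma sv_lt j : j < M -> sv j < M.
Proof.
  rewrite /sv /M => h; have [i [[e [-> _]]|[e [-> _]]]] := even_cases j; lia.
Qed.
Lemma svK j : sv (sv j) = j.
Proof.
  have [i [[e [h _]]|[e [h _]]]] := even_cases j; rewrite {2}/sv h /sv.
  - by rewrite Nat.even_succ -Nat.negb_even h /=; lia.
  - by have -> : j - 1 = 2 * i by [lia]; rewrite Nat.even_mul /= e; lia.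
Qed.
Lemma cv_sv j : cv j ** cv (sv j) = \1.
Proof.
  have [i [[e [h d]]|[e [h d]]]] := even_cases j; rewrite /cv /sv h d.
  - by rewrite Nat.even_succ -Nat.negb_even h e Nat.div2_succ_double; apply: mulVr.
  - have -> : j - 1 = 2 * i by lia.
    by rewrite Nat.even_mul Nat.div2_double; apply: gmul_Vl.
Qed.

Lemma su_iter k i : i < m -> Nat.iter k su (S i) = S ((i + k) mod m).
Proof.
  move=> hi; elim: k => [|k IH] /=; first by rewrite Nat.add_0_r Nat.mod_small.
  rewrite IH /su /=; congr S.
  rewrite -[S (_ mod m)]Nat.add_1_r Nat.Div0.add_mod_idemp_l; congr (_ mod m); lia.
Qed.
Lemma su_m j : j < M -> Nat.iter m su j = j.
Proof.
  case: j => [|i] hi.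
  - by have h k : Nat.iter k su 0 = 0 by [elim: k => //= k ->]; apply: h.
  - have hm : i < m by move: hi; rewrite /M /m; lia.
    rewrite su_iter //; have -> : i + m = i + 1 * m by lia.
    by rewrite Nat.Div0.mod_add Nat.mod_small.
Qed.

Definition suJ (j : idx) : idx := exist (fun i => i < M) _ (su_lt _ (proj2_sig j)).
Definition svJ (j : idx) : idx := exist (fun i => i < M) _ (sv_lt _ (proj2_sig j)).
Lemma suJ_iter k j : proj1_sig (Nat.iter k suJ j) = Nat.iter k su (proj1_sig j).
Proof. by elim: k => //= k ->. Qed.
Lemma suJ_m j : Nat.iter m suJ j = j.
Proof. by apply: idx_eq; rewrite suJ_iter su_m //; apply: (proj2_sig j). Qed.
Lemma svJ_K j : svJ (svJ j) = j.
Proof. by apply: idx_eq; apply: svK. Qed.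

(** An action on indices with a Q-valued cocycle is the same as an action on [Q x idx] commuting
    with left multiplication by Q. In this form only [u^m] and [v^2] have to be checked. *)
Let QJ : Type := (Q * idx)%type.
Definition wu (p : QJ) : QJ := (fst p, suJ (snd p)).
Definition wv (p : QJ) : QJ := (fst p ** cv (proj1_sig (snd p)), svJ (snd p)).
Lemma wu_iter k p : Nat.iter k wu p = (fst p, Nat.iter k suJ (snd p)).
Proof. by elim: k => [|k IH] /=; [case: p|rewrite IH]. Qed.
Lemma wu_m p : Nat.iter m wu p = p.
Proof. by rewrite wu_iter suJ_m; case: p. Qed.
Lemma wvK p : wv (wv p) = p.
Proof. by case: p => q j; rewrite /wv /= mulA cv_sv mul1r svJ_K. Qed.
Definition perm_wu : Sym QJ.
Proof.
  refine {| pfun := wu; pbk := Nat.iter (m - 1) wu |} => x.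
  - by rewrite -Nat.iter_succ_r; have -> : S (m - 1) = m by [rewrite /m; lia]; apply: wu_m.
  - by rewrite -Nat.iter_succ; have -> : S (m - 1) = m by [rewrite /m; lia]; apply: wu_m.
Defined.

Lemma wreath_ex : exists f : F -> Sym QJ, hom f /\ f (uF m) = perm_wu /\ f (vF m) = involution wv wvK.
Proof.
  apply: FF_hom.
  - by apply: perm_eq => p; rewrite sym_powE; apply: wu_m.
  - by apply: perm_eq => p; apply: wvK.
Qed.
Definition wr : F -> Sym QJ := proj1_sig (constructive_indefinite_description _ wreath_ex).
Lemma wr_spec : hom wr /\ wr (uF m) = perm_wu /\ wr (vF m) = involution wv wvK.
Proof. exact: (proj2_sig (constructive_indefinite_description _ wreath_ex)). Qed.

Definition lmul (q : Q) (p : QJ) : QJ := (q ** fst p, snd p).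
Lemma wr_lmul x q p : pfun (wr x) (lmul q p) = lmul q (pfun (wr x) p).
Proof.
  have [h [hu hv]] := wr_spec.
  move: x q p; apply: FF_ind.
  - by move=> q p; rewrite (hom1 h).
  - by move=> x y hx hy q p; rewrite h !sym_mulE hy hx.
  - move=> x hx q p; apply: (perm_inj _ (wr x)).
    by rewrite hx -!sym_mulE -!h mulVr (hom1 h).
  - by move=> q p; rewrite hu.
  - by move=> q p; rewrite hv /= /wv /lmul /= mulA.
Qed.

Definition pjI (x : F) (j : idx) : idx := snd (pfun (wr x) (\1, j)).
Definition ccI (x : F) (j : idx) : Q := fst (pfun (wr x) (\1, j)).
Lemma wrE x q j : pfun (wr x) (q, j) = (q ** ccI x j, pjI x j).
Proof. by have := wr_lmul x q (\1, j); rewrite /lmul /= mul1r. Qed.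
Lemma pjI1 j : pjI \1 j = j.
Proof. by rewrite /pjI (hom1 (proj1 wr_spec)). Qed.
Lemma pjIM x y j : pjI (x ** y) j = pjI x (pjI y j).
Proof. by rewrite {1}/pjI (proj1 wr_spec) sym_mulE !wrE. Qed.
Lemma ccIM x y j : ccI (x ** y) j = ccI y j ** ccI x (pjI y j).
Proof. by rewrite {1}/ccI (proj1 wr_spec) sym_mulE !wrE /= gmul_1l. Qed.
Lemma pjI_u j : pjI (uF m) j = suJ j.
Proof. by rewrite /pjI (proj1 (proj2 wr_spec)). Qed.
Lemma ccI_u j : ccI (uF m) j = \1.
Proof. by rewrite /ccI (proj1 (proj2 wr_spec)). Qed.
Lemma pjI_v j : pjI (vF m) j = svJ j.
Proof. by rewrite /pjI (proj2 (proj2 wr_spec)). Qed.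
Lemma ccI_v j : ccI (vF m) j = cv (proj1_sig j).
Proof. by rewrite /ccI (proj2 (proj2 wr_spec)) /= gmul_1l. Qed.

(** * The finite presentation and its universal property *)

Let iu := n.
Let iv := S n.
Let it (j : nat) := S (S n) + j.
Let NG := S (S n) + M.

(** The [v]-relations are listed at even indices only; those at odd indices follow because [v] is an
    involution commuting with Q. *)
Definition relG : list word :=
  R ++ map (fun i => [(iu, true); (i, true); (iu, false); (i, false)]) (seq 0 n)
    ++ map (fun i => [(iv, true); (i, true); (iv, false); (i, false)]) (seq 0 n)
    ++ [repeat (iu, true) m; [(iv, true); (iv, true)]]
    ++ map (fun j => [(iu, true); (it j, true); (iu, false); (it (su j), false)]) (seq 0 M)
    ++ map (fun i => [(iv, true); (it (2 * i), true); (iv, false); (it (S (2 * i)), false)] ++ winv (kword i))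
        (seq 0 (n + 2)).

Lemma in_relG r : In r relG <->
  In r R \/
  (exists i, i < n /\ r = [(iu, true); (i, true); (iu, false); (i, false)]) \/
  (exists i, i < n /\ r = [(iv, true); (i, true); (iv, false); (i, false)]) \/
  r = repeat (iu, true) m \/ r = [(iv, true); (iv, true)] \/
  (exists j, j < M /\ r = [(iu, true); (it j, true); (iu, false); (it (su j), false)]) \/
  (exists i, i < n + 2 /\
    r = [(iv, true); (it (2 * i), true); (iv, false); (it (S (2 * i)), false)] ++ winv (kword i)).
Proof.
  have aux (f : nat -> word) k : In r (map f (seq 0 k)) <-> exists i, i < k /\ r = f i.
  { rewrite in_map_iff; split=> -[i [h1 h2]]; exists i.
    - by move: h2; rewrite in_seq => h2; split; [lia|].
    - by rewrite in_seq; split; [|lia]. }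
  rewrite /relG !in_app_iff !aux /=; intuition auto.
Qed.

Lemma relG_on r : In r relG -> word_on NG r.
Proof.
  have l4 a b c d : fst a < NG -> fst b < NG -> fst c < NG -> fst d < NG -> word_on NG [a; b; c; d].
  { by move=> *; move=> e /= [<-|[<-|[<-|[<-|//]]]]. }
  rewrite in_relG /iu /iv /it => -[h|[[i [hi ->]]|[[i [hi ->]]|[->|[->|[[j [hj ->]]|[i [hi ->]]]]]]]].
  - by move=> a ha; have := proj1 HQ r h a ha; rewrite /NG; lia.
  - by apply: l4; rewrite /NG /=; lia.
  - by apply: l4; rewrite /NG /=; lia.
  - by move=> a ha; rewrite (repeat_spec _ _ _ ha) /NG /=; lia.
  - by move=> a /= [<-|[<-|//]]; rewrite /NG /=; lia.
  - by have := su_lt j hj; move=> h; apply: l4; rewrite /NG /=; lia.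
  - apply: word_on_app; first by apply: l4; rewrite /NG /M /=; lia.
    apply: word_on_winv; case: i hi => [|[|i]] hi a //= [<-|//].
    by rewrite /NG /=; lia.
Qed.

Definition presG : Grp := PG NG relG.
Lemma presG_presents : Presents presG NG (pgen NG relG) relG.
Proof. exact: PG_presents _ _ relG_on. Qed.
Local Notation genG := (pgen NG relG).

Lemma quad (H : Grp) (h : nat -> H) i j k l :
  eval_word H h [(i, true); (j, true); (k, false); (l, false)] = h i ** h j ** (h k)^-1 ** (h l)^-1.
Proof. by rewrite /= /eval_letter /= mul1r !mulA. Qed.

Lemma eval_winv_kword (H : Grp) (h : nat -> H) (a : Q -> H) i : hom a ->
  (forall k, k < n -> h k = a (gens k)) -> i < n + 2 -> eval_word H h (winv (kword i)) = (a (kap i))^-1.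
Proof.
  move=> ha e hi; rewrite eval_winv; congr (_^-1).
  case: i hi => [|[|i]] hi /=; try by rewrite (hom1 ha).
  by rewrite /eval_letter /= mul1r e //; lia.
Qed.

Definition sel {H : Type} (fq : nat -> H) (xu xv : H) (ft : nat -> H) (i : nat) : H :=
  if i <? n then fq i else if i =? iu then xu else if i =? iv then xv else ft (i - S (S n)).
Lemma sel_q {H : Type} (fq : nat -> H) xu xv ft i : i < n -> sel fq xu xv ft i = fq i.
Proof. by rewrite /sel => /Nat.ltb_lt ->. Qed.
Lemma sel_u {H : Type} (fq : nat -> H) xu xv ft : sel fq xu xv ft iu = xu.
Proof. by rewrite /sel /iu Nat.ltb_irrefl Nat.eqb_refl. Qed.
Lemma sel_v {H : Type} (fq : nat -> H) xu xv ft : sel fq xu xv ft iv = xv.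
Proof.
  rewrite /sel /iv /iu; case: Nat.ltb_spec => h1; first by lia.
  by case: Nat.eqb_spec => h2; [lia|rewrite Nat.eqb_refl].
Qed.
Lemma sel_t {H : Type} (fq : nat -> H) xu xv ft j : sel fq xu xv ft (it j) = ft j.
Proof.
  rewrite /sel /it /iv /iu; case: Nat.ltb_spec => h1; first by lia.
  case: Nat.eqb_spec => h2; first by lia.
  case: Nat.eqb_spec => h3; first by lia.
  by congr ft; lia.
Qed.

Lemma presG_hom (H : Grp) (a : Q -> H) (xu xv : H) (s : nat -> H) : hom a ->
  (forall q, commute (a q) xu) -> (forall q, commute (a q) xv) ->
  gpow xu m = \1 -> xv ** xv = \1 ->
  (forall j, j < M -> xu ** s j = s (su j) ** xu) ->
  (forall i, i < n + 2 -> xv ** s (2 * i) = a (kap i) ** s (S (2 * i)) ** xv) ->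
  exists f : presG -> H, hom f /\ (forall i, i < n -> f (genG i) = a (gens i)) /\
    f (genG iu) = xu /\ f (genG iv) = xv /\ (forall j, j < M -> f (genG (it j)) = s j).
Proof.
  move=> ha cu cv' pu pv ru rv.
  pose h := sel (fun i => a (gens i)) xu xv s.
  have hq i : i < n -> h i = a (gens i) by apply: sel_q.
  have hu : h iu = xu by apply: sel_u.
  have hv : h iv = xv by apply: sel_v.
  have ht j : h (it j) = s j by apply: sel_t.
  have [|f [hf e]] := presents_hom _ _ _ _ H h presG_presents.
  { move=> r /in_relG [hr|[[i [hi ->]]|[[i [hi ->]]|[->|[->|[[j [hj ->]]|[i [hi ->]]]]]]]].
    - rewrite -(hom_eval a gens h r n ha) ?(presents_rel _ _ _ _ HQ r hr) ?(hom1 ha) //.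
      + by move=> i hi; rewrite hq.
      + exact: (proj1 HQ).
    - by rewrite quad hu hq // -cu; grp.
    - by rewrite quad hv hq // -cv'; grp.
    - by rewrite eval_repeat hu.
    - by rewrite /= /eval_letter /= hv mul1r.
    - by rewrite quad hu !ht ru //; grp.
    - by rewrite eval_app quad hv !ht (eval_winv_kword H h a) // rv //; grp. }
  exists f; split=> //; split; first by move=> i hi; rewrite e ?hq // /NG; lia.
  rewrite !e ?hu ?hv /NG /iu /iv; try lia.
  by do 2 split=> //; move=> j hj; rewrite e ?ht // /it /NG; lia.
Qed.

Lemma presG_rel r : In r relG -> eval_word presG genG r = \1.
Proof. exact: presents_rel _ _ _ _ presG_presents r. Qed.

Lemma quad_rel (H : Grp) (a b c d : H) : a ** b ** c^-1 ** d^-1 = \1 -> a ** b = d ** c.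
Proof.
  move=> e; apply: (@mulIr _ c^-1); apply: (@mulIr _ d^-1).
  by rewrite e; grp.
Qed.

Lemma iQ_ex : exists f : Q -> presG, hom f /\ forall i, i < n -> f (gens i) = genG i.
Proof. by apply: (presents_hom _ _ _ _ _ _ HQ) => r hr; apply: presG_rel; apply/in_relG; left. Qed.
Definition iQI := proj1_sig (constructive_indefinite_description _ iQ_ex).
Lemma iQI_spec : hom iQI /\ forall i, i < n -> iQI (gens i) = genG i.
Proof. exact: (proj2_sig (constructive_indefinite_description _ iQ_ex)). Qed.

Lemma iF_ex : exists f : F -> presG, hom f /\ f (uF m) = genG iu /\ f (vF m) = genG iv.
Proof.
  apply: FF_hom.
  - by rewrite -eval_repeat; apply: presG_rel; apply/in_relG; tauto.
  - have := presG_rel [(iv, true); (iv, true)] ltac:(apply/in_relG; tauto).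
    by rewrite /= /eval_letter /= mul1r.
Qed.
Definition iFI := proj1_sig (constructive_indefinite_description _ iF_ex).
Lemma iFI_spec : hom iFI /\ iFI (uF m) = genG iu /\ iFI (vF m) = genG iv.
Proof. exact: (proj2_sig (constructive_indefinite_description _ iF_ex)). Qed.

Definition ttI (j : idx) : presG := genG (it (proj1_sig j)).

Lemma Q_ind (P : Q -> Prop) : P \1 -> (forall x y, P x -> P y -> P (x ** y)) ->
  (forall x, P x -> P x^-1) -> (forall i, i < n -> P (gens i)) -> forall q, P q.
Proof. exact: presents_ind _ _ _ _ P HQ. Qed.

Lemma commute_Q (x : presG) : (forall i, i < n -> commute (genG i) x) -> forall q, commute (iQI q) x.
Proof.
  have [hq e] := iQI_spec; move=> h; apply: Q_ind.
  - by rewrite (hom1 hq); apply: commute1.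
  - by move=> q r cq cr; rewrite hq; apply: commuteM.
  - by move=> q cq; rewrite (homV hq); apply: commuteV.
  - by move=> i hi; rewrite e //; apply: h.
Qed.

Lemma iQFI q x : commute (iQI q) (iFI x).
Proof.
  have [hf [eu ev]] := iFI_spec.
  apply: commute_sym; move: x; apply: FF_ind.
  - by rewrite (hom1 hf); apply: commute1.
  - by move=> x y cx cy; rewrite hf; apply: commuteM.
  - by move=> x cx; rewrite (homV hf); apply: commuteV.
  - rewrite eu; apply: commute_sym; apply: commute_Q => i hi.
    by apply: commute_sym; apply: quad_rel; rewrite -quad; apply: presG_rel; apply/in_relG; eauto.
  - rewrite ev; apply: commute_sym; apply: commute_Q => i hi.
    by apply: commute_sym; apply: quad_rel; rewrite -quad; apply: presG_rel; apply/in_relG; right; right; left; exists i.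
Qed.

Lemma rel_v j : genG iv ** genG (it (proj1_sig j)) = iQI (cv (proj1_sig j)) ** ttI (svJ j) ** genG iv.
Proof.
  have [hq eq] := iQI_spec; have [hf [eu ev]] := iFI_spec.
  have base i : i < n + 2 -> genG iv ** genG (it (2 * i)) = iQI (kap i) ** genG (it (S (2 * i))) ** genG iv.
  { move=> hi; have := presG_rel _ (proj2 (in_relG _) (or_intror (or_intror (or_intror (or_intror (or_intror (or_intror
      (ex_intro _ i (Logic.conj hi eq_refl))))))))).
    rewrite eval_app quad (eval_winv_kword presG genG iQI i hq (fun k hk => eq_sym (eq k hk)) hi) => e.
    apply: (@mulIr _ (genG iv)^-1); apply: (@mulIr _ (genG (it (S (2 * i))))^-1); apply: (@mulIr _ (iQI (kap i))^-1).
    by rewrite e; grp. }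
  have sq : genG iv ** genG iv = \1 by rewrite -ev -hf (vF_sq m) (hom1 hf).
  have cvq q : commute (iQI q) (genG iv) by rewrite -ev; apply: iQFI.
  case: j => j hj; rewrite /ttI /svJ /=.
  have [i [[e [h d]]|[e [h d]]]] := even_cases j; rewrite /cv /sv h d.
  - by rewrite e; apply: base; move: hj; rewrite /M; lia.
  - have -> : j - 1 = 2 * i by lia.
    have {}base := base i ltac:(move: hj; rewrite /M; lia).
    have et : genG (it (S (2 * i))) = (iQI (kap i))^-1 ** (genG iv ** genG (it (2 * i))) ** (genG iv)^-1.
    { by rewrite base; grp. }
    have vV : (genG iv)^-1 = genG iv by symmetry; apply: inv_unique.
    rewrite e (homV hq) et.
    transitivity ((iQI (kap i))^-1 ** (genG iv ** genG iv) ** genG (it (2 * i)) ** (genG iv)^-1).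
    + by rewrite !gmul_assoc -(commuteV _ _ (cvq (kap i))).
    + by rewrite sq mul1r vV.
Qed.

Lemma tt_relI x j : iFI x ** ttI j = iQI (ccI x j) ** ttI (pjI x j) ** iFI x.
Proof.
  have [hq eq] := iQI_spec; have [hf [eu ev]] := iFI_spec.
  move: x j; apply: FF_ind.
  - move=> j; rewrite (hom1 hf) pjI1.
    have -> : ccI \1 j = \1.
    { have := ccIM \1 \1 j; rewrite gmul_1l pjI1 => e.
      by apply: (@mulI _ (ccI \1 j)); rewrite -e mul1r. }
    by rewrite (hom1 hq) mul1r.
  - move=> x y hx hy j; rewrite hf mulA hy ccIM pjIM hq.
    have -> : iFI x ** (iQI (ccI y j) ** ttI (pjI y j) ** iFI y) =
      iQI (ccI y j) ** (iFI x ** ttI (pjI y j)) ** iFI y.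
    { by rewrite !gmul_assoc -(iQFI (ccI y j) x). }
    by rewrite hx; grp.
  - move=> x hx j; have := hx (pjI x^-1 j).
    have e : ccI x^-1 j ** ccI x (pjI x^-1 j) = \1.
    { by have := ccIM x x^-1 j; rewrite mulVr /ccI (hom1 (proj1 wr_spec)) => /= <-. }
    rewrite -pjIM mulVr pjI1 => e2.
    have -> : ccI x^-1 j = (ccI x (pjI x^-1 j))^-1 by rewrite (inv_unique _ _ e) invK.
    have et : ttI (pjI x^-1 j) = (iFI x)^-1 ** (iQI (ccI x (pjI x^-1 j)) ** ttI j ** iFI x).
    { by rewrite -e2 mulVK. }
    rewrite (homV hq) (homV hf) et.
    have c := commuteV _ _ (commute_sym _ _ (commuteV _ _ (iQFI (ccI x (pjI x^-1 j)) x))).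
    by rewrite !gmul_assoc -c; grp.
  - move=> j; rewrite ccI_u pjI_u (hom1 hq) gmul_1l eu.
    apply: quad_rel; rewrite -quad; apply: presG_rel; apply/in_relG.
    by do 5 right; left; exists (proj1_sig j); split=> //; apply: (proj2_sig j).
  - by move=> j; rewrite ccI_v pjI_v ev; apply: rel_v.
Qed.

Lemma rF_exI : exists f : presG -> F, hom f /\ (forall q, f (iQI q) = \1) /\
  (forall x, f (iFI x) = x) /\ (forall j, f (ttI j) = \1).
Proof.
  have [hq eq] := iQI_spec; have [hf [eu ev]] := iFI_spec.
  have [|||||||f [h [fq [fu [fv ft]]]]] := presG_hom F (fun _ => \1) (uF m) (vF m) (fun _ => \1).
  { by move=> q r; rewrite gmul_1l. }
  { by move=> q; apply: commute1. }
  { by move=> q; apply: commute1. }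
  { exact: uF_pow. }
  { exact: vF_sq. }
  { by move=> j _; rewrite gmul_1l mul1r. }
  { by move=> i _; rewrite !gmul_1l mul1r. }
  exists f; split=> //; split; last split.
  - apply: Q_ind; first by rewrite (hom1 hq) (hom1 h).
    + by move=> x y ex ey; rewrite hq h ex ey gmul_1l.
    + by move=> x ex; rewrite (homV hq) (homV h) ex inv1.
    + by move=> i hi; rewrite eq // fq.
  - apply: (FF_hom_ext m F (fun x => f (iFI x)) (fun x => x)) => //.
    + exact: hom_comp hf h.
    + by rewrite eu fu.
    + by rewrite ev fv.
  - by move=> j; apply: ft; apply: (proj2_sig j).
Qed.
Definition rFI := proj1_sig (constructive_indefinite_description _ rF_exI).
Lemma rFI_spec : hom rFI /\ (forall q, rFI (iQI q) = \1) /\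
  (forall x, rFI (iFI x) = x) /\ (forall j, rFI (ttI j) = \1).
Proof. exact: (proj2_sig (constructive_indefinite_description _ rF_exI)). Qed.

Lemma presG_ind (P : presG -> Prop) : P \1 -> (forall g h, P g -> P h -> P (g ** h)) ->
  (forall g, P g -> P g^-1) -> (forall q, P (iQI q)) -> (forall x, P (iFI x)) ->
  (forall j, P (ttI j)) -> forall g, P g.
Proof.
  move=> p1 pM pV pq px pt; apply: (presents_ind _ _ _ _ P presG_presents) => // i hi.
  have [hq eq] := iQI_spec; have [hf [eu ev]] := iFI_spec.
  have [h|[h|[h|[k [hk h]]]]] : i < n \/ i = iu \/ i = iv \/ exists k, k < M /\ i = it k.
  { rewrite /iu /iv /it; case: (lt_dec i (S (S n))) => h; first by lia.
    by do 3 right; exists (i - S (S n)); move: hi; rewrite /NG; lia. }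
  - by rewrite -eq.
  - by rewrite h -eu.
  - by rewrite h -ev.
  - by rewrite h -(JofE k hk); apply: pt.
Qed.

Lemma presG_univ (H : Grp) (a : Q -> H) (b : F -> H) (s : idx -> H) : hom a -> hom b ->
  (forall q x, commute (a q) (b x)) ->
  (forall x j, b x ** s j = a (ccI x j) ** s (pjI x j) ** b x) ->
  exists f : presG -> H, hom f /\ (forall q, f (iQI q) = a q) /\
      (forall x, f (iFI x) = b x) /\ (forall j, f (ttI j) = s j).
Proof.
  move=> ha hb cab rel.
  have [hq eq] := iQI_spec; have [hf [eu ev]] := iFI_spec.
  have [||||||f [h [fq [fu [fv ft]]]]] := presG_hom H a (b (uF m)) (b (vF m)) (fun k => s (Jof k)) ha.
  { by move=> q; apply: cab. }
  { by move=> q; apply: cab. }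
  { by rewrite -(hom_pow _ hb) uF_pow (hom1 hb). }
  { by rewrite -hb vF_sq (hom1 hb). }
  { move=> j hj; rewrite rel ccI_u pjI_u (hom1 ha) gmul_1l; congr (s _ ** _).
    by apply: idx_eq; rewrite /= !Nat.mod_small //; apply: su_lt. }
  { move=> i hi; rewrite rel ccI_v pjI_v; have l : S (2 * i) < M by rewrite /M; lia.
    rewrite JofE; last by lia.
    have [i' [[e [h d]]|[e [h d]]]] := even_cases (2 * i); last by lia.
    rewrite {1}/cv h d; have -> : i' = i by lia.
    congr (_ ** s _ ** _); apply: idx_eq.
    change (sv (proj1_sig (Jof (2 * i))) = proj1_sig (Jof (S (2 * i)))).
    by rewrite !JofE; try lia; rewrite /sv h. }
  exists f; split=> //; split; last split.
  - apply: Q_ind; first by rewrite (hom1 hq) (hom1 h) (hom1 ha).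
    + by move=> x y ex ey; rewrite hq h ex ey ha.
    + by move=> x ex; rewrite (homV hq) (homV h) ex (homV ha).
    + by move=> i hi; rewrite eq // fq.
  - apply: (FF_hom_ext m H (fun x => f (iFI x)) b) => //.
    + exact: hom_comp hf h.
    + by rewrite eu fu.
    + by rewrite ev fv.
  - by move=> j; rewrite /ttI ft ?Jof_proj //; apply: (proj2_sig j).
Qed.

Definition ext : Ext Q m :=
  {| EG := presG; EJ := idx; pj := pjI; cc := ccI; iQ := iQI; iF := iFI; tj := ttI; rF := rFI;
     pj1 := pjI1; pjM := pjIM; ccM := ccIM; iQ_hom := proj1 iQI_spec; iF_hom := proj1 iFI_spec;
     rF_hom := proj1 rFI_spec; iQF := iQFI; tt_rel := tt_relI;
     rF_Q := proj1 (proj2 rFI_spec); rF_F := proj1 (proj2 (proj2 rFI_spec));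
     rF_t := proj2 (proj2 (proj2 rFI_spec)); EG_ind := presG_ind; EG_hom := presG_univ |}.

Lemma ext_finpres : FinPres ext.
Proof. by exists NG, genG, relG; apply: presG_presents. Qed.

Lemma idx_fin : Fin idx.
Proof.
  have [l hl] := list_preimage (fun j : idx => proj1_sig j) idx_eq (seq 0 M).
  by exists l => -[j hj]; apply: hl; apply/in_seq => /=; lia.
Qed.

Let o : EJ ext := Jof 0.

Lemma pjI_upow k i : i < m -> pjI (gpow (uF m) k) (Jof (S i)) = Jof (S ((i + k) mod m)).
Proof.
  move=> hi; have -> : pjI (gpow (uF m) k) (Jof (S i)) = Nat.iter k suJ (Jof (S i)).
  { by elim: k => [|k IH] /=; rewrite ?pjI1 // pjIM IH pjI_u. }
  have b : m < M by rewrite /m /M; lia.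
  have := Nat.mod_upper_bound (i + k) m ltac:(rewrite /m; lia) => l.
  by apply: idx_eq; rewrite suJ_iter !JofE ?su_iter //; lia.
Qed.
Lemma ccI_upow k j : ccI (gpow (uF m) k) j = \1.
Proof.
  elim: k => [|k IH] /=; last by rewrite ccIM IH ccI_u gmul_1l.
  by rewrite /ccI (hom1 (proj1 wr_spec)).
Qed.
Lemma pjI_v_o : pjI (vF m) o = Jof 1.
Proof.
  rewrite pjI_v; apply: idx_eq; change (sv (proj1_sig (Jof 0)) = proj1_sig (Jof 1)).
  by rewrite !JofE // /M; lia.
Qed.

Definition to_pt (i : nat) : F := gpow (uF m) i ** vF m.
Lemma to_ptE i : i < m -> pjI (to_pt i) o = Jof (S i).
Proof. by move=> hi; rewrite /to_pt pjIM pjI_v_o pjI_upow ?Nat.mod_small //; rewrite /m; lia. Qed.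
Lemma cc_to_pt i : ccI (to_pt i) o = \1.
Proof.
  have o0 : proj1_sig o = 0 by apply: JofE; rewrite /M; lia.
  by rewrite /to_pt ccIM ccI_upow mul1r ccI_v o0.
Qed.

(** [v] takes [2i] to [2i + 1] at cost [kap i], and [u^-1] leads back at no cost. *)
Definition turn : F := (uF m)^-1 ** vF m.
Lemma turnE i : 0 < i < n + 2 -> pjI turn (Jof (2 * i)) = Jof (2 * i) /\ ccI turn (Jof (2 * i)) = kap i.
Proof.
  move=> hi; have b : S (2 * i) < M by rewrite /M; lia.
  have [i' [[e [h d]]|[e [h d]]]] := even_cases (2 * i); last by lia.
  have ei : i' = i by lia.
  rewrite ei in d.
  have ev : pjI (vF m) (Jof (2 * i)) = Jof (S (2 * i)).
  { rewrite pjI_v; apply: idx_eq; change (sv (proj1_sig (Jof (2 * i))) = proj1_sig (Jof (S (2 * i)))).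
    by rewrite !JofE; try lia; rewrite /sv h. }
  have eu : pjI (uF m) (Jof (2 * i)) = Jof (S (2 * i)).
  { rewrite pjI_u; apply: idx_eq; change (su (proj1_sig (Jof (2 * i))) = proj1_sig (Jof (S (2 * i)))).
    rewrite !JofE; try lia.
    rewrite /su Nat.mod_small; last by rewrite /m; lia.
    by case: Nat.eqb_spec => //; lia. }
  have euV : pjI (uF m)^-1 (Jof (S (2 * i))) = Jof (2 * i).
  { by rewrite -eu -pjIM gmul_Vl pjI1. }
  split; first by rewrite /turn pjIM ev.
  rewrite /turn ccIM ev ccI_v JofE; last by lia.
  have -> : ccI (uF m)^-1 (Jof (S (2 * i))) = \1.
  { by have [k ->] := inUV m m_gt2 _ (ex_intro _ 1 (eq_sym (mul1r (uF m)))); apply: ccI_upow. }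
  by rewrite mul1r /cv h d.
Qed.

(** [to_pt (2 * i - 1)] leads from 0 to [2 * i] at no cost. Elements of F_o of every cost [kap i]
    thus arise as conjugates in F of the single element [turn]. *)
Definition loop (i : nat) : F := (to_pt (2 * i - 1))^-1 ** turn ** to_pt (2 * i - 1).
Lemma conj_fix y t : ccI y o = \1 -> pjI t (pjI y o) = pjI y o ->
  pjI (y^-1 ** t ** y) o = o /\ ccI (y^-1 ** t ** y) o = ccI t (pjI y o).
Proof.
  move=> cy ty; have yV : pjI y^-1 (pjI y o) = o by rewrite -pjIM gmul_Vl pjI1.
  have cV : ccI y^-1 (pjI y o) = \1.
  { have := ccIM y^-1 y o; rewrite gmul_Vl cy gmul_1l => <-.
    by rewrite /ccI (hom1 (proj1 wr_spec)). }
  by rewrite !pjIM !ccIM ?pjIM ty yV cy cV mul1r gmul_1l.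
Qed.
Lemma loopE i : 0 < i < n + 2 -> pjI (loop i) o = o /\ ccI (loop i) o = kap i.
Proof.
  move=> hi; have [t1 t2] := turnE i hi.
  have e : pjI (to_pt (2 * i - 1)) o = Jof (2 * i).
  { by rewrite to_ptE; [congr Jof; lia|rewrite /m; lia]. }
  have [|l1 l2] := conj_fix (to_pt (2 * i - 1)) turn (cc_to_pt _); first by rewrite e t1.
  by rewrite /loop l1 l2 e t2.
Qed.

Lemma ext_generic : ~ Fin Q -> Generic ext o.
Proof.
  move=> inf; have o0 : proj1_sig o = 0 by apply: JofE; rewrite /M; lia.
  have fixu : pjI (uF m) o = o.
  { by rewrite pjI_u; apply: idx_eq; change (su (proj1_sig o) = proj1_sig o); rewrite o0. }
  split.
  - exact: m_gt2.
  - by exists (n + 1); rewrite /m; lia.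
  - exact: inf.
  - exact: idx_fin.
  - move=> j; rewrite -(Jof_proj j); case: (proj1_sig j) (proj2_sig j) => [|i] hi.
    + by exists \1; apply: pjI1.
    + by exists (to_pt i); apply: to_ptE; move: hi; rewrite /M /m; lia.
  - exact: fixu.
  - exact: ccI_u.
  (* [c] is an antihomomorphism on F_o, so its image is a subgroup, and the loops put all generators
     into it. *)
  - apply: Q_ind.
    + by exists \1; rewrite /= pjI1 /ccI (hom1 (proj1 wr_spec)).
    + move=> q r [x [hx <-]] [y [hy <-]]; exists (y ** x).
      by rewrite /= pjIM ccIM; rewrite /= in hx hy; rewrite hx hy.
    + move=> q [x [hx <-]]; exists x^-1; rewrite /= in hx.
      have hV : pjI x^-1 o = o by rewrite -{1}hx -pjIM gmul_Vl pjI1.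
      split; first exact: hV.
      apply: inv_unique; have := ccIM x^-1 x o; rewrite gmul_Vl /= hx => <-.
      by rewrite /ccI (hom1 (proj1 wr_spec)).
    + by move=> i hi; exists (loop (S (S i))); apply: (loopE (S (S i))); lia.
  (* Q is infinite, so some generator is nontrivial; its loop is conjugate in F to [loop 1], whose
     cost is trivial. *)
  - have [i [hi ne]] : exists i, i < n /\ gens i <> \1.
    { apply: NNPP => no; apply: inf; exists [\1] => q; left; move: q; apply: Q_ind => //.
      - by move=> x y <- <-; rewrite gmul_1l.
      - by move=> x <-; rewrite inv1.
      - by move=> i hi; apply: NNPP => ne; apply: no; exists i; split=> // e; apply: ne. }
    pose y := (to_pt (2 * S (S i) - 1))^-1 ** to_pt (2 * 1 - 1).
    have e : y ** loop 1 ** y^-1 = loop (S (S i)) by rewrite /y /loop; grp.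
    exists (loop 1), y; rewrite e.
    have [a1 a2] := loopE 1 ltac:(lia); have [b1 b2] := loopE (S (S i)) ltac:(lia).
    by split=> //; split=> //; split=> //; rewrite [cc _ _]b2.
  - move=> z hz cz tr; have zu : z (uF m) = \1 by apply: tr.
    (* The values of [z] commute, so [z] agrees on [turn] and its conjugate [loop 1], which lies in
       F_o. *)
    have zt : z turn = \1.
    { have ez y t : z (y^-1 ** t ** y) = z t by rewrite !hz (homV hz) mulA (cz t y) mulVK.
      by have := tr (loop 1) (proj1 (loopE 1 ltac:(lia))); rewrite /loop ez. }
    have zv : z (vF m) = \1.
    { by move: zt; rewrite /turn hz (homV hz) zu inv1 gmul_1l. }
    apply: FF_ind => //; first exact: hom1.
    + by move=> x y ex ey; rewrite hz ex ey gmul_1l.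
    + by move=> x ex; rewrite (homV hz) ex inv1.
Qed.
End Instance.

(** * Finite groups and the theorem *)

(* The relators are the words of length 3 that hold, so every word reduces to a single letter. *)
Lemma finite_finpres (G : Grp) : Fin G -> FinPres G.
Proof.
  move=> [l hl]; pose N := length l; pose gens i := nth i l \1.
  have surj g : exists k, k < N /\ gens k = g by have [k [h1 h2]] := In_nth l g \1 (hl g); exists k.
  pose letters := list_prod (seq 0 N) [true; false].
  have in_letters (a : letter) : In a letters <-> fst a < N.
  { case: a => i b; rewrite /letters in_prod_iff in_seq /=; case: b; intuition lia. }
  pose cand := map (fun p : letter * (letter * letter) => [fst p; fst (snd p); snd (snd p)])
    (list_prod letters (list_prod letters letters)).
  pose holds (r : word) : bool :=
    match excluded_middle_informative (eval_word G gens r = \1) with left _ => true | right _ => false end.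
  have holdsE r : holds r = true <-> eval_word G gens r = \1.
  { by rewrite /holds; case: excluded_middle_informative. }
  pose R := filter holds cand.
  have R_in a b c : fst a < N -> fst b < N -> fst c < N -> eval_word G gens [a; b; c] = \1 -> In [a; b; c] R.
  { move=> ha hb hc e; apply/filter_In; split; last exact/holdsE.
    by apply/in_map_iff; exists (a, (b, c)); split=> //; rewrite !in_prod_iff !in_letters. }
  have R_eval r : In r R -> eval_word G gens r = \1 by move=> /filter_In [_ /holdsE].
  have letter1 k : k < N -> gens k = \1 -> wequiv R [(k, true)] [].
  { move=> hk ek; apply: (we_trans _ _ [(k, true); (k, true); (k, false)]).
    - by apply: we_sym; exact: (we_cancel R [(k, true)] [] (k, true)).
    - apply: (we_rel R [] [] [(k, true); (k, true); (k, false)]); apply: R_in => //.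
      by rewrite /= /eval_letter /= ek; grp. }
  have single w : word_on N w -> exists k, k < N /\ wequiv R w [(k, true)].
  { elim: w => [|a w IH] hw.
    - have [k [hk ek]] := surj \1; exists k; split=> //; by apply: we_sym; apply: letter1.
    - have [j [hj ej]] := IH (fun b hb => hw b (or_intror hb)).
      have [k [hk ek]] := surj (eval_letter G gens a ** gens j); exists k; split=> //.
      apply: (we_trans _ _ [a; (j, true)]).
      { by have := wequiv_app R _ _ [a] [] ej; rewrite !app_nil_r. }
      apply: (we_trans _ _ ([a; (j, true); (k, false)] ++ [(k, true)])).
      + by apply: we_sym; exact: (we_cancel R [a; (j, true)] [] (k, false)).
      + apply: (we_rel R [] [(k, true)] [a; (j, true); (k, false)]); apply: R_in => //.
        * by apply: hw; left.
        * by rewrite /= -[eval_letter G gens (j, true)]/(gens j) -[eval_letter G gens (k, false)]/((gens k)^-1) ek; grp. }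
  exists N, gens, R; split; last split.
  - move=> r /filter_In [/in_map_iff [[a [b c]] [<-]]]; rewrite !in_prod_iff !in_letters => -[ha [hb hc]] _.
    by move=> d /= [<-|[<-|[<-|//]]].
  - move=> g; have [k [hk <-]] := surj g; exists [(k, true)]; split; first by move=> a [<-|].
    by rewrite /= /eval_letter /= mul1r.
  - move=> w hw; split=> [e|e]; last by rewrite (eval_wequiv gens R _ _ R_eval e).
    have [k [hk ek]] := single w hw; apply: (we_trans _ _ _ _ ek); apply: letter1 => //.
    by have := eval_wequiv gens R _ _ R_eval ek; rewrite e /= /eval_letter /= mul1r.
Qed.

Lemma finite_residually_finite (G : Grp) : Fin G -> ResFinite G.
Proof. by move=> h g hg; apply: (residual_by_hom (fun x : G => x)). Qed.

Section FiniteCase.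
Context (Q : Grp).

Definition cube : Grp.
Proof.
  refine (Build_Grp (Q -> bool) (fun f g x => xorb (f x) (g x)) (fun _ => false) (fun f => f) _ _ _).
  - by move=> f g h; apply: functional_extensionality => x; rewrite Bool.xorb_assoc.
  - by move=> f; apply: functional_extensionality => x; rewrite Bool.xorb_false_l.
  - by move=> f; apply: functional_extensionality => x; rewrite Bool.xorb_nilpotent.
Defined.

Lemma cube_mulC (f g : cube) : f ** g = g ** f.
Proof. by apply: functional_extensionality => x; apply: Bool.xorb_comm. Qed.

Lemma cube_fin : Fin Q -> Fin cube.
Proof. by move=> h; apply: Fin_fun => //; exists [true; false] => -[]; [left|right; left]. Qed.

Definition translate (q : Q) (f : cube) : cube := fun x => f (x ** q).

Lemma translateM q r f : translate (q ** r) f = translate q (translate r f).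
Proof. by apply: functional_extensionality => x; rewrite /translate mulA. Qed.
Lemma translate1 f : translate \1 f = f.
Proof. by apply: functional_extensionality => x; rewrite /translate mul1r. Qed.

Lemma cube_embeds : Fin Q -> EmbedsFiniteIndexInOut Q cube.
Proof.
  move=> fQ; exists translate; split; last split; last split.
  - move=> q; split; first by [].
    by exists (translate q^-1); split=> f; rewrite -translateM ?gmul_Vl ?mulVr translate1.
  - by move=> q r; exists \1 => f; rewrite translateM; grp.
  - move=> q [h e]; pose d : cube := fun x =>
      match excluded_middle_informative (x = \1) with left _ => true | right _ => false end.
    have := f_equal (fun f : cube => f \1) (e d).
    rewrite cube_mulC mulVK /translate /d gmul_1l.
    by do 2 case: excluded_middle_informative.
  - have [L hL] := Fin_fun (cube_fin fQ) (cube_fin fQ).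
    exists L => a _; exists a, \1; split; first exact: hL.
    by exists \1 => f; rewrite translate1; grp.
Qed.
End FiniteCase.

Theorem theoremD (Q : Grp) (hfp : FinPres Q) (hFA : PropertyFA Q) :
  (exists G : Grp, FinPres G /\ EmbedsFiniteIndexInOut Q G) /\
  (ResFinite Q -> exists G : Grp, FinPres G /\ EmbedsFiniteIndexInOut Q G /\ ResFinite G).
Proof.
  suff [G [h1 [h2 h3]]] : exists G : Grp,
    FinPres G /\ EmbedsFiniteIndexInOut Q G /\ (ResFinite Q -> ResFinite G).
  { by split; [exists G|move=> rf; exists G; split=> //; split=> //; apply: h3]. }
  case: (classic (Fin Q)) => hQ.
  - exists (cube Q); have hc := cube_fin Q hQ; split; first exact: finite_finpres.
    by split; [apply: cube_embeds|move=> _; apply: finite_residually_finite].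
  - have [n [gens [R HQ]]] := hfp; exists (ext n gens R HQ).
    have C := ext_generic n gens R HQ hQ; split; first exact: ext_finpres.
    split; first exact: Ext_embeds C hFA.
    by apply: Ext_residually_finite; [apply: (g_m2 _ _ C)|apply: (g_fin _ _ C)].
Qed.
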